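(* Let $m\in\{2,3\}$. The map $\pi\in\mathbb{H}_m\mapsto \mathcal{M}_m(\pi)$ is a near-minimizer of the problem $$\inf\{\det M : M\in S_2^+ \text{ such that } e_M(\pi)_m\leq 1\}$$ in the following sense. If $\pi\in\mathbb{H}_m$ is non-univariate, then the matrix $\mathcal{M}_m(\pi)$ is non-degenerate (so that $\mathcal{M}_m(\pi)\in S_2^+$). Furthermore there exists a constant $C$, independent of $\pi$, such that for every non-univariate $\pi\in\mathbb{H}_m$ one has $$e_{\mathcal{M}_m(\pi)}(\pi)_m\leq C$$ and $$\det \mathcal{M}_m(\pi)\leq C\,\inf\{\det M : M\in S_2^+ \text{ such that } e_M(\pi)_m\leq 1\}.$$
   Context: Polynomials. For an integer $m\ge 2$, $\mathbb{P}_{m-1}$ denotes the space of real bivariate polynomials of total degree at most $m-1$, and $\mathbb{H}_m$ the space of real homogeneous bivariate polynomials of degree $m$ (in the variables $x,y$). An element $\pi\in\mathbb{H}_m$ is called univariate if it depends on a single linear coordinate, i.e. $\pi(x,y)=\lambda(px+qy)^m$ for some $\lambda,p,q\in\mathbb{R}$ (this includes $\pi=0$); otherwise it is non-univariate. The space $\mathbb{H}_m$ is equipped with the norm $\|\pi\|:=\sup_{|u|\le 1}|\pi(u)|$, where $|u|$ is the Euclidean norm of $u\in\mathbb{R}^2$. Interpolation error. Triangles are non-degenerate triangles in $\mathbb{R}^2$, and $|T|$ denotes the area of $T$. For a triangle $T$, $\mathrm{I}_T^{m-1}$ denotes the Lagrange interpolation operator on $T$ onto $\mathbb{P}_{m-1}$: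 $\mathrm{I}_T^{m-1}f$ is the unique element of $\mathbb{P}_{m-1}$ that agrees with $f$ at the Lagrange points of $T$, which are the three vertices of $T$ if $m=2$, and the three vertices together with the three edge midpoints of $T$ if $m=3$. For $f\in H^1(T)\cap C^0(T)$ define $e_T(f)_m\ge 0$ by $$e_T(f)_m^2:=\frac{1}{|T|}\int_T|\nabla(f-\mathrm{I}_T^{m-1}f)|^2.$$ Matrices attached to triangles. $S_2^+$ is the set of real $2\times 2$ symmetric positive definite matrices. For a triangle $T$ with vertices $v_1,v_2,v_3$ and barycenter $z_T:=(v_1+v_2+v_3)/3$, the matrix $\mathcal{H}_T\in S_2^+$ is defined by $$\mathcal{H}_T^{-1}:=\frac23\sum_{i=1}^3(v_i-z_T)(v_i-z_T)^{\mathrm T}.$$ For $M\in S_2^+$ and $\pi\in\mathbb{H}_m$, define $$e_M(\pi)_m:=\sup\{e_T(\pi)_m : T \text{ a triangle such that } \mathcal{H}_T=M\}.$$ The maps $\mathcal{M}_m$. For $\pi=ax^2+2bxy+cy^2\in\mathbb{H}_2$ put $[\pi]:=\begin{pmatrix}a&b\\ b&c\end{pmatrix}$. The absolute value of a symmetric matrix (resp. the square root of a non-negative symmetric matrix) is obtained by taking the absolute value (resp. square root) of the eigenvalues in an orthogonal diagonalization; squares of matrices are matrix products. For $\pi\in\mathbb{H}_2$ set $$\mathcal{M}_2(\pi):=\|\pi\|\,\big|[\pi]\big|.$$ For $\pi=ax^3+3bx^2y+3cxy^2+dy^3\in\mathbb{H}_3$ set $$\mathcal{M}_3(\pi):=\sqrt{[\partial_x\pi]^2+[\partial_y\pi]^2}+\left(\frac{-\operatorname{disc}\pi}{\|\pi\|}\right)_+^{1/3}\mathrm{Id},$$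 where $\operatorname{disc}\pi:=4(ac-b^2)(bd-c^2)-(ad-bc)^2$, $\lambda_+:=\max\{\lambda,0\}$ and $\mathrm{Id}$ is the $2\times2$ identity matrix. *)

(* Defs.v *)
From HB Require Import structures.
From mathcomp Require Import all_boot all_order all_algebra.
From mathcomp Require Import all_classical all_reals all_analysis.
(* The notations of mpoly clash with those of mathcomp-analysis. *)
From mathcomp Require Import -(notations) mpoly.

Set Implicit Arguments.
Unset Strict Implicit.
Unset Printing Implicit Defensive.

Import Order.TTheory GRing.Theory Num.Theory.

Local Open Scope classical_set_scope.
Local Open Scope ring_scope.

Section Polynomials.
Variable R : realType.

Definition peval (p : mpoly 2 R) (z : 'cV[R]_2) : R :=
  meval (fun i => z i 0) p.

(* P_{m-1}; [msize p] is the total degree plus one (and 0 for p = 0). *)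
Definition Pspace (m : nat) : set (mpoly 2 R) := [set p | (msize p <= m)%N].

Definition Hspace (m : nat) : set (mpoly 2 R) :=
  [set p | p \is @ishomog1 2 R m (@mdeg 2)].

Definition univariate (m : nat) (p : mpoly 2 R) : Prop :=
  exists l a b : R,
    p = l *: (a *: mpolyX R (mnm1 0) + b *: mpolyX R (mnm1 1)) ^+ m.

Definition enorm (u : 'cV[R]_2) : R := Num.sqrt (\sum_i u i 0 ^+ 2).

(* The supremum is over a nonempty bounded set, so the real [sup] is the
   actual least upper bound. *)
Definition pnorm (p : mpoly 2 R) : R :=
  sup [set `|peval p u| | u in [set u | enorm u <= 1]].

(* The coefficient of x^i y^j divided by 'C(i + j, i). *)
Definition bcoef (p : mpoly 2 R) (i j : nat) : R :=
  mcoeff (mnm_add (mnm_muln (mnm1 0) i) (mnm_muln (mnm1 1) j)) p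
    / 'C(i + j, i)%:R.

Definition grad_sq (p : mpoly 2 R) (z : 'cV[R]_2) : R :=
  \sum_(i < 2) peval (mderiv i p) z ^+ 2.

End Polynomials.

Section Triangles.
Variable R : realType.

Record triangle := Triangle {
  vertex :> 'I_3 -> 'cV[R]_2;
  triangle_nondegenerate :
    \det (row_mx (vertex 1 - vertex 0) (vertex 2%:R - vertex 0)
          : 'M[R]_(1 + 1)) != 0 }.

Definition hull (T : triangle) : set 'cV[R]_2 :=
  [set z | exists l : 'I_3 -> R,
    [/\ forall i, 0 <= l i, \sum_i l i = 1 & z = \sum_i l i *: T i]].

(* Integration takes place on R * R, with the product Lebesgue measure. *)
Definition pt (x : R * R) : 'cV[R]_2 :=
  \col_(i < 2) if i == 0 then x.1 else x.2.

Definition lebesgue2 := (@lebesgue_measure R \x @lebesgue_measure R)%E.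

Definition area (T : triangle) : R := fine (lebesgue2 (pt @^-1` hull T)).

(* Meaningful for m = 2 (vertices) and m = 3 (vertices and edge midpoints). *)
Definition lagrange_points (m : nat) (T : triangle) : set 'cV[R]_2 :=
  range T `|`
  [set z | m = 3%N /\ exists i j, i != j /\ z = 2^-1 *: (T i + T j)].

Definition interp (m : nat) (T : triangle) (f : 'cV[R]_2 -> R) : mpoly 2 R :=
  xget 0 [set p | Pspace m p /\
                  forall z, lagrange_points m T z -> peval p z = f z].

Definition eT (m : nat) (T : triangle) (p : mpoly 2 R) : R :=
  Num.sqrt ((area T)^-1 *
    Rintegral lebesgue2 (pt @^-1` hull T)
      (fun x => grad_sq (p - interp m T (peval p)) (pt x))).

Definition barycenter (T : triangle) : 'cV[R]_2 := 3^-1 *: \sum_i T i.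

Definition HT (T : triangle) : 'M[R]_2 :=
  invmx ((2 / 3) *:
    \sum_i (T i - barycenter T) *m (T i - barycenter T)^T).

Definition S2plus : set 'M[R]_2 :=
  [set M | M^T = M /\
           forall u : 'cV[R]_2, u != 0 -> 0 < (u^T *m M *m u) 0 0].

Definition eM (m : nat) (M : 'M[R]_2) (p : mpoly 2 R) : \bar R :=
  ereal_sup [set (eT m T p)%:E | T in [set T : triangle | HT T = M]].

End Triangles.

Section MetricMaps.
Variable R : realType.

(* f applied to the eigenvalues of the symmetric matrix S; the result does not
   depend on the orthogonal diagonalization chosen. *)
Definition spectral_map (f : R -> R) (S : 'M[R]_2) : 'M[R]_2 :=
  xget 0 [set B | exists (P : 'M[R]_2) (d : 'rV[R]_2),
    [/\ P^T *m P = 1%:M,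
        S = P *m diag_mx d *m P^T &
        B = P *m diag_mx (map_mx f d) *m P^T]].

Definition mxabs (S : 'M[R]_2) : 'M[R]_2 := spectral_map (fun x => `|x|) S.
Definition mxsqrt (S : 'M[R]_2) : 'M[R]_2 := spectral_map Num.sqrt S.

(* For p = a x^2 + 2 b x y + c y^2 this is the matrix with rows (a, b) and
   (b, c). *)
Definition quadmx (p : mpoly 2 R) : 'M[R]_2 :=
  \matrix_(i < 2, j < 2) bcoef p (2 - (i + j))%N (i + j)%N.

Definition disc (p : mpoly 2 R) : R :=
  let a := bcoef p 3 0 in let b := bcoef p 2 1 in
  let c := bcoef p 1 2 in let d := bcoef p 0 3 in
  4 * (a * c - b ^+ 2) * (b * d - c ^+ 2) - (a * d - b * c) ^+ 2.

Definition Mmap2 (p : mpoly 2 R) : 'M[R]_2 := pnorm p *: mxabs (quadmx p).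

Definition Mmap3 (p : mpoly 2 R) : 'M[R]_2 :=
  mxsqrt (quadmx (mderiv 0 p) *m quadmx (mderiv 0 p)
          + quadmx (mderiv 1 p) *m quadmx (mderiv 1 p))
  + (Num.max (- disc p / pnorm p) 0 `^ 3^-1)%:M.

(* Only used for m = 2 and m = 3. *)
Definition Mmap (m : nat) : mpoly 2 R -> 'M[R]_2 :=
  if m == 2%N then Mmap2 else Mmap3.

End MetricMaps.

(* Main.v *)
Require Import Defs.
From mathcomp Require Import all_boot all_order all_algebra.
From mathcomp Require Import all_classical all_reals all_analysis.
From mathcomp Require Import measurable_realfun.
From mathcomp Require Import -(notations) mpoly.
From mathcomp Require Import ring lra.

(** In the edge coordinates of a triangle [T] the interpolation error of a form
    is an explicit polynomial in the coefficients of the form, so that [e_T] is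
    controlled by the pointwise size of its gradient.  Conversely, if the mean
    of the squared gradient is at most 1, every small homothetic copy of [T]
    inside [T] contains a point where the gradient is not large, and finitely
    many such points determine the coefficients.  Choosing the equilateral
    triangle (for the metric [M]) with a vertex on the axis of the largest
    eigenvalue, this shows that [e_M(pi) <= 1] holds, up to constants, iff
    [tr M * pi(v)^2 <= (v^T M v)^m] for all [v].

    It remains to compare determinants.  For [m = 2], diagonalize [pi].  For
    [m = 3], let [H = ac - b^2], [K = bd - c^2], [L = ad - bc] be the
    coefficients of the Hessian covariant: [det (Qx^2 + Qy^2)] is
    [81 (2H^2 + L^2 + 2K^2)], where [Qx], [Qy] are the matrices of the partial
    derivatives, and [L^2 = 4HK - disc].  In the eigenframe of [Qx^2 + Qy^2]
    this last identity bounds the coefficient [d], the only one that is not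
    controlled by the eigenvalues.  In the eigenframe of a competitor [M] all of
    [H], [K], [L] and [disc] scale by powers of [det M]. *)

Set Implicit Arguments.
Unset Strict Implicit.
Unset Printing Implicit Defensive.

Import Order.TTheory GRing.Theory Num.Theory.

Local Open Scope classical_set_scope.
Local Open Scope ring_scope.

(** * Binary quadratic and cubic forms *)

Section BinaryForms.
Variable R : realFieldType.
Implicit Types a b c d p q x y n e : R.

(** Why [tr M] appears: [e_T] measures gradients in the Euclidean norm, while the coefficients in
    edge coordinates come from derivatives along edges. If [s ^+ 2] is the largest eigenvalue of
    [M], a vector of [M]-length 1 on its axis has Euclidean length [1 / s], so a gradient of size 1
    yields a derivative of size [1 / s] there; and [s ^+ 2] is comparable to the trace. Necessity
    uses this single direction, the median through the vertex on the axis, so the coefficients must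
    be recovered from the sum of the two edge derivatives alone. Why the discriminant enters the
    metric: sufficiency requires [s1 * d ^+ 2] to be at most a multiple of [(s2 + e) ^+ 3], whereas
    the Gram matrix only bounds [d ^+ 2] by [s2 ^+ 2], too weak when [s2] is much smaller than [s1];
    the identity for [L] supplies the missing factor at the price of [e]. Roots and suprema enter
    the algebra only through their defining relations, so that it runs over any ordered field. All
    constants come from crude estimates. *)

Lemma norm_le_sqr x y : 0 <= y -> x ^+ 2 <= y ^+ 2 -> `|x| <= y.
Proof. by move=> y0 ?; rewrite -ler_sqr ?nnegrE// real_normK ?num_real. Qed.

Lemma sqr_le_norm x y : `|x| <= y -> x ^+ 2 <= y ^+ 2.
Proof.
by move=> xy; rewrite -real_normK ?num_real// ler_sqr ?nnegrE// (le_trans _ xy).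
Qed.

Lemma normM_le x y u v : `|x| <= u -> `|y| <= v -> `|x * y| <= u * v.
Proof. by move=> xu yv; rewrite normrM ler_pM. Qed.

Definition cubic a b c d x y :=
  a * x ^+ 3 + 3 * b * x ^+ 2 * y + 3 * c * x * y ^+ 2 + d * y ^+ 3.

Definition quadr a b c x y := a * x ^+ 2 + 2 * b * x * y + c * y ^+ 2.

Definition cdisc a b c d :=
  4 * (a * c - b ^+ 2) * (b * d - c ^+ 2) - (a * d - b * c) ^+ 2.

(** Twice the squared Frobenius norm of the matrix of the Hessian covariant
    [H x ^+ 2 + L x y + K y ^+ 2], hence a quantity invariant under rotations. *)
Definition hess_norm2 a b c d :=
  2 * (a * c - b ^+ 2) ^+ 2 + (a * d - b * c) ^+ 2 + 2 * (b * d - c ^+ 2) ^+ 2.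

(** The symmetric trilinear form with diagonal [cubic]: its values on the vectors of a basis are the
    coefficients of the cubic in that basis. *)
Definition polar3 a b c d x1 y1 x2 y2 x3 y3 :=
  a * x1 * x2 * x3 + b * (x1 * x2 * y3 + x1 * y2 * x3 + y1 * x2 * x3)
  + c * (x1 * y2 * y3 + y1 * x2 * y3 + y1 * y2 * x3) + d * y1 * y2 * y3.

Definition polar2 a b c x1 y1 x2 y2 :=
  a * x1 * x2 + b * (x1 * y2 + y1 * x2) + c * y1 * y2.

(** Rational points of the unit circle suffice: the sum of the values at [(3 / 5, 4 / 5)] and
    [(3 / 5, - (4 / 5))] involves only [a] and [c], their difference only [b] and [d]. *)
Lemma cubic_coef_bound a b c d n :
  (forall x y, x ^+ 2 + y ^+ 2 <= 1 -> `|cubic a b c d x y| <= n) ->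
  [/\ `|a| <= n, `|b| <= 2 * n, `|c| <= 2 * n & `|d| <= n].
Proof.
move=> h.
have h1 := h 1 0; have h2 := h 0 1.
have h3 := h (3 / 5) (4 / 5); have h4 := h (3 / 5) (- (4 / 5)).
have {h1} : `|cubic a b c d 1 0| <= n by apply: h1; lra.
have {h2} : `|cubic a b c d 0 1| <= n by apply: h2; lra.
have {h3} : `|cubic a b c d (3 / 5) (4 / 5)| <= n by apply: h3; lra.
have {h4} : `|cubic a b c d (3 / 5) (- (4 / 5))| <= n by apply: h4; lra.
rewrite /cubic !ler_norml => /andP[? ?] /andP[? ?] /andP[? ?] /andP[? ?].
by split; apply/andP; split; lra.
Qed.

Lemma cubic_le a b c d x y : x ^+ 2 + y ^+ 2 <= 1 ->
  `|cubic a b c d x y| <= `|a| + 3 * `|b| + 3 * `|c| + `|d|.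
Proof.
move=> xy1.
have hx : `|x| <= 1 by apply: norm_le_sqr => //; nra.
have hy : `|y| <= 1 by apply: norm_le_sqr => //; nra.
have h k i j : `|k * x ^+ i * y ^+ j| <= `|k|.
  rewrite !normrM !normrX -mulrA ler_piMr//.
  by apply: mulr_ile1; rewrite ?exprn_ge0 ?exprn_ile1.
rewrite /cubic; have := h a 3%N 0%N; have := h (3 * b) 2%N 1%N.
have := h (3 * c) 1%N 2%N; have := h d 0%N 3%N.
rewrite !expr0 !mulr1 !expr1 !(normrM 3) (@ger0_norm _ 3)// => h1 h2 h3 h4.
apply: (le_trans (ler_normD _ _)); apply: lerD => //.
apply: (le_trans (ler_normD _ _)); apply: lerD => //.
by apply: (le_trans (ler_normD _ _)); apply: lerD.
Qed.

Lemma cubic_sqr_le a b c d x y :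
  cubic a b c d x y ^+ 2 <= 4 * (a ^+ 2 * x ^+ 6 +
    (3 * b) ^+ 2 * (x ^+ 4 * y ^+ 2) + (3 * c) ^+ 2 * (x ^+ 2 * y ^+ 4) + d ^+ 2 * y ^+ 6).
Proof.
rewrite /cubic.
set u1 := a * x ^+ 3; set u2 := 3 * b * x ^+ 2 * y.
set u3 := 3 * c * x * y ^+ 2; set u4 := d * y ^+ 3.
have -> : a ^+ 2 * x ^+ 6 + (3 * b) ^+ 2 * (x ^+ 4 * y ^+ 2) +
  (3 * c) ^+ 2 * (x ^+ 2 * y ^+ 4) + d ^+ 2 * y ^+ 6 =
  u1 ^+ 2 + u2 ^+ 2 + u3 ^+ 2 + u4 ^+ 2 by rewrite /u1 /u2 /u3 /u4; ring.
move: u1 u2 u3 u4 => u1 u2 u3 u4.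
have := sqr_ge0 (u1 - u2); have := sqr_ge0 (u1 - u3); have := sqr_ge0 (u1 - u4).
have := sqr_ge0 (u2 - u3); have := sqr_ge0 (u2 - u4); have := sqr_ge0 (u3 - u4).
lra.
Qed.

(** Each hypothesis matches one term in the expansion of the cube of the diagonal form, so the
    comparison is made term by term; 256 is 64 times the 4 of [cubic_sqr_le]. *)
Lemma cubic_sqr_le_of_coefs a b c d k al be x y :
  0 <= k -> 0 <= al -> 0 <= be ->
  k * a ^+ 2 <= 64 * al ^+ 3 -> k * (3 * b) ^+ 2 <= 64 * (al ^+ 2 * be) ->
  k * (3 * c) ^+ 2 <= 64 * (al * be ^+ 2) -> k * d ^+ 2 <= 64 * be ^+ 3 ->
  k * cubic a b c d x y ^+ 2 <= 256 * (al * x ^+ 2 + be * y ^+ 2) ^+ 3.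
Proof.
move=> k0 al0 be0 t1 t2 t3 t4.
have sum4 := cubic_sqr_le a b c d x y.
have x6 : 0 <= x ^+ 6 by rewrite exprn_even_ge0.
have y6 : 0 <= y ^+ 6 by rewrite exprn_even_ge0.
have x4 : 0 <= x ^+ 4 * y ^+ 2 by rewrite mulr_ge0// exprn_even_ge0.
have y4 : 0 <= x ^+ 2 * y ^+ 4 by rewrite mulr_ge0// exprn_even_ge0.
apply: (le_trans (ler_wpM2l k0 sum4)); rewrite {sum4}.
have t2' : 0 <= al ^+ 2 * be * (x ^+ 4 * y ^+ 2) by rewrite mulr_ge0// mulr_ge0// exprn_ge0.
have t3' : 0 <= al * be ^+ 2 * (x ^+ 2 * y ^+ 4) by rewrite mulr_ge0// mulr_ge0// exprn_ge0.
have {x6} t1 := ler_wpM2r x6 t1.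
have {x4} t2 := ler_wpM2r x4 t2.
have {y4} t3 := ler_wpM2r y4 t3.
have {y6} t4 := ler_wpM2r y6 t4.
have -> : (al * x ^+ 2 + be * y ^+ 2) ^+ 3 = al ^+ 3 * x ^+ 6 +
  3 * (al ^+ 2 * be * (x ^+ 4 * y ^+ 2)) + 3 * (al * be ^+ 2 * (x ^+ 2 * y ^+ 4)) +
  be ^+ 3 * y ^+ 6 by ring.
clear k0 al0 be0; lra.
Qed.

(** Since [e] is at most a multiple of [s1], the factor on the left may be replaced by [10 * s1];
    the rest is the bound of each coefficient required by [cubic_sqr_le_of_coefs], of which only
    that of [d] is not immediate. *)
Lemma metric3_upper_ordered a b c d n s1 s2 e x y :
  0 < n -> 0 <= e -> 0 <= s2 -> s2 <= s1 ->
  n <= `|a| + 3 * `|b| + 3 * `|c| + `|d| ->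
  s1 <= 11 * n ->
  s1 ^+ 2 = 9 * (a ^+ 2 + 2 * b ^+ 2 + c ^+ 2) ->
  s2 ^+ 2 = 9 * (b ^+ 2 + 2 * c ^+ 2 + d ^+ 2) ->
  n * e ^+ 3 = Num.max (- cdisc a b c d) 0 ->
  (s1 + s2 + 2 * e) * cubic a b c d x y ^+ 2 <=
    2560 * ((s1 + e) * x ^+ 2 + (s2 + e) * y ^+ 2) ^+ 3.
Proof.
move=> n0 e0 s20 s21 nle s1n s1E s2E eE.
have s10 : 0 <= s1 by exact: le_trans s21.
have ha : `|a| <= s1 / 3 by apply: norm_le_sqr; nra.
have hb : `|b| <= s2 / 3 by apply: norm_le_sqr; nra.
have hc : `|c| <= s2 / 3 by apply: norm_le_sqr; nra.
have hd : `|d| <= s2 / 3 by apply: norm_le_sqr; nra.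
have n3 : n <= 3 * s1 by lra.
have s1p : 0 < s1 by lra.
have hac := normM_le ha hc; have hbb := normM_le hb hb.
have hbd := normM_le hb hd; have hcc := normM_le hc hc.
have had := normM_le ha hd; have hbc := normM_le hb hc.
have s12 : s2 * s2 <= s1 * s2 by rewrite ler_wpM2r.
have hH : `|a * c - b ^+ 2| <= 2 / 9 * (s1 * s2).
  by apply: (le_trans (ler_normB _ _)); rewrite expr2; clear - hac hbb hbd hcc s12; lra.
have hK : `|b * d - c ^+ 2| <= 2 / 9 * (s2 * s2).
  by apply: (le_trans (ler_normB _ _)); rewrite expr2; clear - hac hbb hbd hcc s12; lra.
have hL : `|a * d - b * c| <= 2 / 9 * (s1 * s2).
  by apply: (le_trans (ler_normB _ _)); clear - had hbc s12; lra.
have hHK := normM_le hH hK; have hLL := normM_le hL hL.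
have s120 : 0 <= s1 * s2 by rewrite mulr_ge0.
have s220 : 0 <= s2 * s2 by rewrite mulr_ge0.
have s1s2 : s1 * s2 <= s1 * s1 by rewrite ler_wpM2l.
have disc_max : Num.max (- cdisc a b c d) 0 <= s1 ^+ 4.
  rewrite ge_max exprn_ge0// andbT /cdisc.
  have : (s1 * s2) * (s2 * s2) <= s1 * s1 * (s1 * s1) by rewrite ler_pM// (le_trans s12).
  have : (s1 * s2) * (s1 * s2) <= s1 * s1 * (s1 * s1) by rewrite ler_pM.
  move: hHK hLL; clear; rewrite !ler_norml => /andP[? ?] /andP[? ?] ? ?; lra.
have disc_ge : - cdisc a b c d <= n * e ^+ 3 by rewrite eE le_max lexx.
have e3 : 0 <= e ^+ 3 by rewrite exprn_ge0.
(* From [s1 <= 11 * n] and [n * e ^+ 3 <= s1 ^+ 4] follows [e ^+ 3 <= 11 * s1 ^+ 3], and 11 is less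
   than 27. *)
have es : e <= 3 * s1.
  rewrite leNgt; apply/negP => lt_e.
  have : (3 * s1) ^+ 3 < e ^+ 3 by rewrite ltrXn2r// ?mulr_ge0.
  have : n * e ^+ 3 <= s1 ^+ 4 by rewrite eE.
  have : s1 * e ^+ 3 <= 11 * n * e ^+ 3 by rewrite ler_wpM2r.
  move=> h1 h2 h3.
  have : s1 * ((3 * s1) ^+ 3) < s1 * e ^+ 3 by rewrite ltr_pM2l.
  have : 0 < s1 ^+ 4 by rewrite exprn_gt0.
  clear - h1 h2; lra.
have s23 : 0 <= s2 ^+ 3 by rewrite exprn_ge0.
(* Both parts of [L ^+ 2 = 4 H K - disc] are bounded with a single factor [s1]: [H K] through
   [s1 * s2 ^+ 3], and [- disc <= n * e ^+ 3] through [n <= 3 * s1]. *)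
have L2 : (a * d - b * c) ^+ 2 <= 3 * s1 * (s2 ^+ 3 + e ^+ 3).
  have : n * e ^+ 3 <= 3 * s1 * e ^+ 3 by rewrite ler_wpM2r.
  have : 0 <= s1 * s2 ^+ 3 by rewrite mulr_ge0.
  move: hHK disc_ge; clear; rewrite /cdisc !ler_norml => /andP[? ?] ? ? ?; lra.
have s24 : s2 ^+ 4 <= s1 * s2 ^+ 3 by rewrite exprS ler_wpM2r.
have s1e : 0 <= s1 * e ^+ 3 by rewrite mulr_ge0.
(* After one more multiplication by [s1], the Gram formula expresses [s1 ^+ 2 * d ^+ 2] by the
   squares of [a d], [b d] and [c d]; the delicate one is [a d = L + b c]. *)
have d2 : s1 * d ^+ 2 <= 64 * (s2 ^+ 3 + e ^+ 3).
  rewrite -(ler_pM2l s1p).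
  have /sqr_le_norm bc2 := hbc.
  have /sqr_le_norm bd2 := hbd.
  have /sqr_le_norm cd2 := normM_le hc hd.
  have : (a * d) ^+ 2 <= 2 * (a * d - b * c) ^+ 2 + 2 * (b * c) ^+ 2.
    have := sqr_ge0 (a * d - 2 * (b * c)); clear; lra.
  have : s1 * (s1 * d ^+ 2) = 9 * (a * d) ^+ 2 + 18 * (b * d) ^+ 2 + 9 * (c * d) ^+ 2.
    have -> : s1 * (s1 * d ^+ 2) = s1 ^+ 2 * d ^+ 2 by ring.
    by rewrite s1E; ring.
  have : 0 <= s1 * s2 ^+ 3 by rewrite mulr_ge0.
  clear - L2 s24 s1e bc2 bd2 cd2; lra.
have /sqr_le_norm a2 := ha.
have /sqr_le_norm b2 := hb.
have /sqr_le_norm c2 := hc.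
set al := s1 + e; set be := s2 + e.
have al0 : 0 <= al by rewrite addr_ge0.
have be0 : 0 <= be by rewrite addr_ge0.
have als : s1 <= al by rewrite lerDl.
have bes : s2 <= be by rewrite lerDl.
have t1 : s1 * a ^+ 2 <= al ^+ 3.
  apply: (@le_trans _ _ (s1 ^+ 3)); last by rewrite lerXn2r.
  by rewrite exprS ler_wpM2l//; have := sqr_ge0 s1; clear - a2; lra.
have t2 : s1 * b ^+ 2 * 9 <= al ^+ 2 * be.
  apply: (@le_trans _ _ (s1 * (s1 * s2))); first by rewrite -mulrA ler_wpM2l//; clear - b2 s12; lra.
  by rewrite mulrA -expr2 ler_pM// ?sqr_ge0// lerXn2r.
have t3 : s1 * c ^+ 2 * 9 <= al * be ^+ 2.
  apply: (@le_trans _ _ (s1 * (s2 ^+ 2))); first by rewrite -mulrA ler_wpM2l//; clear - c2; lra.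
  by rewrite ler_pM// ?sqr_ge0// lerXn2r.
have t4 : s1 * d ^+ 2 <= 64 * be ^+ 3.
  apply: (le_trans d2); rewrite ler_wpM2l//.
  have : 0 <= s2 ^+ 2 * e by rewrite mulr_ge0// sqr_ge0.
  have : 0 <= s2 * e ^+ 2 by rewrite mulr_ge0// sqr_ge0.
  by rewrite /be; clear; lra.
apply: (@le_trans _ _ (10 * (s1 * cubic a b c d x y ^+ 2))).
  by rewrite mulrA ler_wpM2r ?sqr_ge0//; clear - s21 s10 e0 es; lra.
have := @cubic_sqr_le_of_coefs a b c d s1 al be x y s10 al0 be0.
have h1 : 0 <= al ^+ 3 by rewrite exprn_ge0.
have h2 : 0 <= al ^+ 2 * be by rewrite mulr_ge0// exprn_ge0.
have h3 : 0 <= al * be ^+ 2 by rewrite mulr_ge0// exprn_ge0.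
move=> h; rewrite (_ : 2560 = 10 * 256); last by ring.
rewrite -mulrA ler_wpM2l//; apply: h => //.
- by clear - t1 h1; lra.
- by clear - t2 h2; lra.
- by clear - t3 h3; lra.
Qed.

End BinaryForms.

(** * Rotations of cubics, their invariants, and the two comparisons in diagonal form *)

Section Cubics.
Variable R : realFieldType.
Implicit Types a b c d p q x y n e : R.

(** Being the least upper bound of [|f|] on the unit disc, expressed without a supremum operator. *)
Definition disc_sup (f : R -> R -> R) n :=
  (forall x y, x ^+ 2 + y ^+ 2 <= 1 -> `|f x y| <= n) /\
  (forall B, (forall x y, x ^+ 2 + y ^+ 2 <= 1 -> `|f x y| <= B) -> n <= B).

Lemma disc_sup_rot f n p q : p ^+ 2 + q ^+ 2 = 1 -> disc_sup f n ->
  disc_sup (fun u v => f (p * u - q * v) (q * u + p * v)) n.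
Proof.
move=> pq [h1 h2]; split=> [u v uv|B hB].
  apply: h1; rewrite (_ : _ + _ = (p ^+ 2 + q ^+ 2) * (u ^+ 2 + v ^+ 2)); last by ring.
  by rewrite pq mul1r.
apply: h2 => x y xy.
have := hB (p * x + q * y) (p * y - q * x).
rewrite (_ : _ + _ = (p ^+ 2 + q ^+ 2) * (x ^+ 2 + y ^+ 2)); last by ring.
rewrite pq mul1r => /(_ xy).
rewrite (_ : _ - _ = (p ^+ 2 + q ^+ 2) * x); last by ring.
rewrite (_ : _ * _ + _ = (p ^+ 2 + q ^+ 2) * y); last by ring.
by rewrite pq !mul1r.
Qed.

Lemma cubic_polar a b c d x1 y1 x2 y2 u v :
  cubic a b c d (x1 * u + x2 * v) (y1 * u + y2 * v) =
  cubic (polar3 a b c d x1 y1 x1 y1 x1 y1) (polar3 a b c d x1 y1 x1 y1 x2 y2)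
        (polar3 a b c d x1 y1 x2 y2 x2 y2) (polar3 a b c d x2 y2 x2 y2 x2 y2) u v.
Proof. by rewrite /cubic /polar3; ring. Qed.

(** The discriminant of a binary cubic is an invariant of degree 4, hence of weight 6. *)
Lemma cdisc_polar a b c d x1 y1 x2 y2 :
  cdisc (polar3 a b c d x1 y1 x1 y1 x1 y1) (polar3 a b c d x1 y1 x1 y1 x2 y2)
        (polar3 a b c d x1 y1 x2 y2 x2 y2) (polar3 a b c d x2 y2 x2 y2 x2 y2) =
  (x1 * y2 - x2 * y1) ^+ 6 * cdisc a b c d.
Proof. by rewrite /cdisc /polar3; ring. Qed.

Lemma hess_norm2_rot a b c d p q :
  hess_norm2 (polar3 a b c d p q p q p q) (polar3 a b c d p q p q (- q) p)
        (polar3 a b c d p q (- q) p (- q) p)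
        (polar3 a b c d (- q) p (- q) p (- q) p) =
  (p ^+ 2 + q ^+ 2) ^+ 6 * hess_norm2 a b c d.
Proof. by rewrite /hess_norm2 /polar3; ring. Qed.

(* The entries of the matrix under the square root in [Mmap3]. *)
Definition gram11 a b c d : R := 9 * (a ^+ 2 + 2 * b ^+ 2 + c ^+ 2).
Definition gram12 a b c d : R := 9 * (a * b + 2 * b * c + c * d).
Definition gram22 a b c d : R := 9 * (b ^+ 2 + 2 * c ^+ 2 + d ^+ 2).

(** Cauchy-Binet: up to the factor 9 this is the Gram matrix of the vectors [(a, b, b, c)] and
    [(b, c, c, d)], whose 2 by 2 minors are [H] twice, [K] twice, [L] and 0. *)
Lemma gram_det a b c d :
  gram11 a b c d * gram22 a b c d - gram12 a b c d ^+ 2 = 81 * hess_norm2 a b c d.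
Proof. by rewrite /gram11 /gram12 /gram22 /hess_norm2; ring. Qed.

Lemma gram11_rot a b c d p q :
  gram11 (polar3 a b c d p q p q p q) (polar3 a b c d p q p q (- q) p)
        (polar3 a b c d p q (- q) p (- q) p)
        (polar3 a b c d (- q) p (- q) p (- q) p) =
  (p ^+ 2 + q ^+ 2) ^+ 2 * (p ^+ 2 * gram11 a b c d +
    2 * p * q * gram12 a b c d + q ^+ 2 * gram22 a b c d).
Proof. by rewrite /gram11 /gram12 /gram22 /polar3; ring. Qed.

Lemma gram22_rot a b c d p q :
  gram22 (polar3 a b c d p q p q p q) (polar3 a b c d p q p q (- q) p)
        (polar3 a b c d p q (- q) p (- q) p)
        (polar3 a b c d (- q) p (- q) p (- q) p) =
  (p ^+ 2 + q ^+ 2) ^+ 2 * (q ^+ 2 * gram11 a b c d -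
    2 * p * q * gram12 a b c d + p ^+ 2 * gram22 a b c d).
Proof. by rewrite /gram11 /gram12 /gram22 /polar3; ring. Qed.

(** Exchanging [x] and [y] reverses the list of coefficients and swaps [s1] with [s2], so the
    ordered case suffices. *)
Lemma metric3_upper a b c d n s1 s2 e x y :
  0 < n -> 0 <= e -> 0 <= s1 -> 0 <= s2 ->
  disc_sup (cubic a b c d) n ->
  s1 ^+ 2 = gram11 a b c d -> s2 ^+ 2 = gram22 a b c d ->
  n * e ^+ 3 = Num.max (- cdisc a b c d) 0 ->
  (s1 + s2 + 2 * e) * cubic a b c d x y ^+ 2 <=
    2560 * ((s1 + e) * x ^+ 2 + (s2 + e) * y ^+ 2) ^+ 3.
Proof.
move=> n0 e0 s10 s20 [h1 h2] s1E s2E eE.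
have nle : n <= `|a| + 3 * `|b| + 3 * `|c| + `|d|.
  by apply: h2 => u v; exact: cubic_le.
have [na nb nc nd] := cubic_coef_bound h1.
have /sqr_le_norm a2 := na; have /sqr_le_norm b2 := nb.
have /sqr_le_norm c2 := nc; have /sqr_le_norm d2 := nd.
rewrite /gram11 in s1E; rewrite /gram22 in s2E.
have n11 : 0 <= 11 * n by rewrite mulr_ge0// ltW.
have n2 : 0 <= n ^+ 2 by rewrite sqr_ge0.
have s1n : s1 <= 11 * n.
  by rewrite -ler_sqr ?nnegrE// s1E; clear - a2 b2 c2 n2; lra.
have s2n : s2 <= 11 * n.
  by rewrite -ler_sqr ?nnegrE// s2E; clear - d2 b2 c2 n2; lra.
have [s21|/ltW s12] := leP s2 s1.
  exact: (metric3_upper_ordered x y n0 e0 s20 s21 nle s1n s1E s2E eE).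
have -> : cubic a b c d x y = cubic d c b a y x by rewrite /cubic; ring.
have -> : s1 + s2 = s2 + s1 by ring.
have -> : (s1 + e) * x ^+ 2 + (s2 + e) * y ^+ 2 = (s2 + e) * y ^+ 2 + (s1 + e) * x ^+ 2 by ring.
apply: (@metric3_upper_ordered _ _ _ _ _ n) => //.
- by clear - nle; lra.
- by rewrite s2E; ring.
- by rewrite s1E; ring.
- by rewrite eE; congr (Num.max _ _); rewrite /cdisc; ring.
Qed.

(** The axes give [a] and [d]. At [(t, s)] and [(t, - s)] both terms of the diagonal metric are
    equal; the sum of the values there then gives [c], and their difference [b]. *)
Lemma metric3_lower_coefs a b c d s t k :
  0 < t -> t <= s -> 0 <= k ->
  (forall x y, s ^+ 2 * cubic a b c d x y ^+ 2 <=
     k ^+ 2 * (s ^+ 2 * x ^+ 2 + t ^+ 2 * y ^+ 2) ^+ 3) ->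
  [/\ `|a| <= k * s ^+ 2, `|b| <= 2 * k * s * t, `|c| <= 2 * k * t ^+ 2 &
      `|d| * s <= k * t ^+ 3].
Proof.
move=> t0 ts k0 h; have s0 : 0 < s by exact: lt_le_trans ts.
have sn0 := ltW s0; have tn0 := ltW t0.
have ha : `|a| <= k * s ^+ 2.
  rewrite -(ler_pM2l s0) -{1}(gtr0_norm s0) -normrM; apply: norm_le_sqr.
    by rewrite !mulr_ge0// sqr_ge0.
  have := h 1 0; rewrite /cubic !(expr0n,expr1n,mulr0,mulr1,addr0)/= => h1.
  by rewrite exprMn (le_trans h1)// le_eqVlt; apply/orP; left; apply/eqP; ring.
have hd : `|d| * s <= k * t ^+ 3.
  rewrite -{1}(gtr0_norm s0) -normrM; apply: norm_le_sqr.
    by rewrite mulr_ge0// exprn_ge0.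
  have := h 0 1; rewrite /cubic !(expr0n,expr1n,mulr0,mulr1,addr0,mul0r,add0r)/= => h1.
  by rewrite exprMn mulrC (le_trans h1)// le_eqVlt; apply/orP; left; apply/eqP; ring.
have st0 : 0 <= k * s ^+ 3 * t ^+ 3 by rewrite !mulr_ge0// exprn_ge0.
(* The hypothesis yields [8 * (k * s ^+ 3 * t ^+ 3) ^+ 2] as a bound of the square; 8 is rounded up
   to 9. *)
have hpm y : y ^+ 2 = s ^+ 2 -> `|s * cubic a b c d t y| <= 3 * (k * s ^+ 3 * t ^+ 3).
  move=> ys; apply: norm_le_sqr; first by rewrite mulr_ge0.
  rewrite exprMn (le_trans (h _ _))// ys.
  have -> : k ^+ 2 * (s ^+ 2 * t ^+ 2 + t ^+ 2 * s ^+ 2) ^+ 3 = 8 * (k * s ^+ 3 * t ^+ 3) ^+ 2.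
    by ring.
  by rewrite [X in _ <= X]exprMn ler_wpM2r ?sqr_ge0//; clear; lra.
have h1 := hpm s erefl.
have h2 := hpm (- s) (sqrrN _).
have ha' : `|a * (s * t ^+ 3)| <= k * s ^+ 3 * t ^+ 3.
  have r0 : 0 <= s * t ^+ 3 by rewrite mulr_ge0// exprn_ge0.
  rewrite normrM (ger0_norm r0); have := ler_wpM2r r0 ha.
  by rewrite (_ : k * s ^+ 2 * _ = k * s ^+ 3 * t ^+ 3); last by ring.
have hd' : `|d * s ^+ 4| <= k * s ^+ 3 * t ^+ 3.
  have r0 : 0 <= s ^+ 3 by rewrite exprn_ge0.
  have r4 : 0 <= s ^+ 4 by rewrite exprn_ge0.
  rewrite normrM (ger0_norm r4); have := ler_wpM2r r0 hd.
  rewrite (_ : k * t ^+ 3 * _ = k * s ^+ 3 * t ^+ 3); last by ring.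
  by rewrite -[`|d| * s * _]mulrA -exprS.
split=> //.
- have r0 : 0 < s ^+ 2 * t ^+ 2 by rewrite mulr_gt0// exprn_gt0.
  rewrite -(ler_pM2r r0) -{1}(gtr0_norm r0) -normrM.
  move: h1 h2 ha' hd'; clear - st0; rewrite /cubic !ler_norml.
  move=> /andP[? ?] /andP[? ?] /andP[? ?] /andP[? ?]; apply/andP; split; lra.
- have r0 : 0 < s ^+ 3 * t by rewrite mulr_gt0// exprn_gt0.
  rewrite -(ler_pM2r r0) -{1}(gtr0_norm r0) -normrM.
  move: h1 h2 ha' hd'; clear - st0; rewrite /cubic !ler_norml.
  move=> /andP[? ?] /andP[? ?] /andP[? ?] /andP[? ?]; apply/andP; split; lra.
Qed.

(** As [s1], [s2] and [e] are at most multiples of [n], the product on the left is at most [s1 * s2]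
    plus a multiple of [n * e], and these two are compared with the determinant separately. The
    numbers [s1] and [s2] may come from another frame than the coefficients: only their product and
    their size relative to [n] are assumed. *)
Lemma metric3_lower a b c d n s1 s2 e s t k :
  0 < n -> 0 <= e -> 0 <= s1 -> 0 <= s2 ->
  disc_sup (cubic a b c d) n ->
  s1 <= 11 * n -> s2 <= 11 * n ->
  (s1 * s2) ^+ 2 = 81 * hess_norm2 a b c d ->
  n * e ^+ 3 = Num.max (- cdisc a b c d) 0 ->
  0 < t -> t <= s -> 0 <= k ->
  (forall x y, s ^+ 2 * cubic a b c d x y ^+ 2 <=
     k ^+ 2 * (s ^+ 2 * x ^+ 2 + t ^+ 2 * y ^+ 2) ^+ 3) ->
  (s1 + e) * (s2 + e) <= 1200 * k ^+ 2 * (s ^+ 2 * t ^+ 2).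
Proof.
move=> n0 e0 s10 s20 [h1 h2] s1n s2n s12E eE t0 ts k0 h.
have [ha hb hc hd] := metric3_lower_coefs t0 ts k0 h.
have s0 : 0 < s by exact: lt_le_trans ts.
have sn0 := ltW s0; have tn0 := ltW t0.
have tt_st : t * t <= s * t by rewrite ler_wpM2r.
have st_ss : s * t <= s * s by rewrite ler_wpM2l.
have tt_ss : t * t <= s * s by rewrite (le_trans tt_st).
have ttst0 : 0 <= t * t by rewrite mulr_ge0.
have hd' : `|d| <= k * t ^+ 2.
  rewrite -(ler_pM2r s0) (le_trans hd)// -mulrA ler_wpM2l// exprSr ler_wpM2l// sqr_ge0.
(* The geometric progression [w], [r], [v] gives the sizes of [a], [b], [c]; then [H], [L], [K] have
   sizes [r ^+ 2], [v * r], [v ^+ 2]. *)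
set w := k * s ^+ 2.
have w0 : 0 <= w by rewrite mulr_ge0// sqr_ge0.
have nw : n <= 14 * w.
  have /h2 : forall x y, x ^+ 2 + y ^+ 2 <= 1 -> `|cubic a b c d x y| <=
    `|a| + 3 * `|b| + 3 * `|c| + `|d| by move=> x y; exact: cubic_le.
  have e1 : k * (s * t) <= k * (s * s) by rewrite ler_wpM2l.
  have e2 : k * (t * t) <= k * (s * s) by rewrite ler_wpM2l.
  move=> /le_trans; apply; rewrite /w; clear - ha hb hc hd' e1 e2; lra.
set r := k * s * t.
have r0 : 0 <= r by rewrite !mulr_ge0.
set v := k * t * t.
have v0 : 0 <= v by rewrite !mulr_ge0.
have vr : v <= r by rewrite /v /r -!mulrA ler_wpM2l.
have wv : w * v = r ^+ 2 by rewrite /w /v /r; ring.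
have {}hb : `|b| <= 2 * r by rewrite /r !mulrA.
have {}hc : `|c| <= 2 * v by rewrite /v (le_trans hc)// expr2 !mulrA.
have {}hd' : `|d| <= v by rewrite /v (le_trans hd')// expr2 !mulrA.
(* The sharp bound of [|d| * s] is spent here and on [b * d]; with [|d| <= v] alone, [a * d] would
   only be bounded by [w * v = r ^+ 2]. *)
have had : `|a * d| <= v * r.
  rewrite -(ler_pM2r s0) normrM -mulrA (le_trans (ler_pM _ _ ha hd))//.
    by rewrite mulr_ge0.
  by rewrite /v /r le_eqVlt; apply/orP; left; apply/eqP; ring.
have hbd : `|b * d| <= 2 * v ^+ 2.
  have b' : `|b| <= (2 * k * t) * s by rewrite (le_trans hb)// /r le_eqVlt; apply/orP; left; apply/eqP; ring.
  have kt0 : 0 <= 2 * k * t by rewrite !mulr_ge0.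
  rewrite normrM; apply: (le_trans (ler_wpM2r (normr_ge0 d) b')).
  rewrite (_ : 2 * k * t * s * `|d| = 2 * k * t * (`|d| * s)); last by ring.
  apply: (le_trans (ler_wpM2l kt0 hd)).
  by rewrite /v le_eqVlt; apply/orP; left; apply/eqP; ring.
have hac := normM_le ha hc; have hbb := normM_le hb hb.
have hcc := normM_le hc hc; have hbc := normM_le hb hc.
have vr2 : v * r <= r ^+ 2 by rewrite expr2 ler_wpM2r.
have vv : v ^+ 2 <= v * r by rewrite expr2 ler_wpM2l.
have hH : `|a * c - b ^+ 2| <= 6 * r ^+ 2.
  apply: (le_trans (ler_normB _ _)); rewrite (expr2 b).
  rewrite -/w mulrCA wv in hac.
  by clear - hac hbb; lra.
have hK : `|b * d - c ^+ 2| <= 6 * v ^+ 2.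
  by apply: (le_trans (ler_normB _ _)); rewrite (expr2 c); clear - hbd hcc; lra.
have hL : `|a * d - b * c| <= 5 * (v * r).
  by apply: (le_trans (ler_normB _ _)); clear - had hbc; lra.
have hHK := normM_le hH hK.
have /sqr_le_norm hL2 := hL.
have /sqr_le_norm hH2 := hH.
have /sqr_le_norm hK2 := hK.
have vr0 : 0 <= v * r by rewrite mulr_ge0.
have vr22 : (v * r) ^+ 2 <= (r ^+ 2) ^+ 2 by rewrite lerXn2r// nnegrE// sqr_ge0.
have vv2 : (v ^+ 2) ^+ 2 <= (r ^+ 2) ^+ 2.
  by rewrite lerXn2r// ?nnegrE ?sqr_ge0// (le_trans vv).
have s12 : s1 * s2 <= 117 * r ^+ 2.
  rewrite -ler_sqr ?nnegrE ?mulr_ge0 ?sqr_ge0// s12E /hess_norm2.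
  by clear - hL2 hH2 hK2 vr22 vv2; lra.
have disc_le : n * e ^+ 3 <= 169 * (v * r) ^+ 2.
  rewrite eE ge_max mulr_ge0 ?sqr_ge0// andbT /cdisc.
  by move: hHK hL2; clear; rewrite ler_norml => /andP[? ?] ?; lra.
have ne0 : 0 <= n * e by rewrite mulr_ge0// ltW.
(* Cubing produces [n ^+ 2 * (n * e ^+ 3)], where the discriminant bound applies. The weights fit
   because [w * v = r ^+ 2], and the constants because [14 * 13 = 182] is at most [6 ^+ 3]. *)
have ne : n * e <= 36 * r ^+ 2.
  have r20 : 0 <= 36 * r ^+ 2 by rewrite mulr_ge0// sqr_ge0.
  rewrite -(@ler_pXn2r _ 3)// ?nnegrE//.
  have -> : (n * e) ^+ 3 = n ^+ 2 * (n * e ^+ 3) by ring.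
  have n2 : n ^+ 2 <= (14 * w) ^+ 2.
    by rewrite lerXn2r// ?nnegrE ?mulr_ge0// ltW.
  apply: (le_trans (ler_pM _ _ n2 disc_le)); rewrite ?sqr_ge0//.
    by rewrite mulr_ge0// ?exprn_ge0// ltW.
  have -> : (14 * w) ^+ 2 * (169 * (v * r) ^+ 2) = (182 * (w * v * r)) ^+ 2 by ring.
  have -> : (36 * r ^+ 2) ^+ 3 = (216 * (r ^+ 2 * r)) ^+ 2 by ring.
  have r3 : 0 <= r ^+ 2 * r by rewrite mulr_ge0 ?sqr_ge0.
  by rewrite wv lerXn2r// ?nnegrE ?mulr_ge0// ler_wpM2r//; clear; lra.
have [na nb nc nd] := cubic_coef_bound h1.
have nac := normM_le na nc; have nbb := normM_le nb nb.
have ncc := normM_le nc nc; have nbc := normM_le nb nc.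
have nad := normM_le na nd; have nbd := normM_le nb nd.
have nH : `|a * c - b ^+ 2| <= 6 * n ^+ 2.
  by apply: (le_trans (ler_normB _ _)); rewrite (expr2 b); clear - nac nbb; lra.
have nK : `|b * d - c ^+ 2| <= 6 * n ^+ 2.
  by apply: (le_trans (ler_normB _ _)); rewrite (expr2 c); clear - nbd ncc; lra.
have nL : `|a * d - b * c| <= 5 * n ^+ 2.
  by apply: (le_trans (ler_normB _ _)); clear - nad nbc; lra.
have nHK := normM_le nH nK.
have /sqr_le_norm nL2 := nL.
have en : e <= 6 * n.
  have n60 : 0 <= 6 * n by rewrite mulr_ge0// ltW.
  rewrite -(@ler_pXn2r _ 3)// ?nnegrE// -(ler_pM2l n0) eE ge_max.
  rewrite mulr_ge0 ?exprn_ge0 ?(ltW n0)// andbT.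
  have : 0 <= n ^+ 4 by rewrite exprn_ge0 ?ltW.
  by move: nHK nL2; clear; rewrite /cdisc ler_norml => /andP[? ?] ? ?; lra.
(* The total is [117 + 36 * (11 + 11 + 6) = 1125], rounded up to 1200. *)
have -> : 1200 * k ^+ 2 * (s ^+ 2 * t ^+ 2) = 1200 * r ^+ 2 by rewrite /r; ring.
have h3 : e * s1 <= e * (11 * n) by rewrite ler_wpM2l.
have h4 : e * s2 <= e * (11 * n) by rewrite ler_wpM2l.
have h5 : e * e <= e * (6 * n) by rewrite ler_wpM2l.
have h6 := sqr_ge0 r.
clear - s12 ne h3 h4 h5 h6; lra.
Qed.
End Cubics.

(** * Passage from diagonal form to arbitrary eigenframes *)

Section Frames.
Variable R : realFieldType.
Implicit Types a b c d p q x y n e mu nu s t k : R.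

(* A symmetric matrix in terms of its eigenvalues and of the rotation by (p, q). *)
Definition eig11 mu nu p q : R := mu * p ^+ 2 + nu * q ^+ 2.
Definition eig12 mu nu p q : R := (mu - nu) * p * q.
Definition eig22 mu nu p q : R := mu * q ^+ 2 + nu * p ^+ 2.

(** Inserting a power of [p ^+ 2 + q ^+ 2] makes both sides of an identity homogeneous of the same
    degree in [p] and [q], after which [ring] proves it without using the constraint. *)
Lemma frame_one p q x i : p ^+ 2 + q ^+ 2 = 1 -> x = (p ^+ 2 + q ^+ 2) ^+ i * x.
Proof. by move=> ->; rewrite expr1n mul1r. Qed.

Lemma quadr_eig mu nu p q x y :
  quadr (eig11 mu nu p q) (eig12 mu nu p q) (eig22 mu nu p q) x y =
  mu * (p * x + q * y) ^+ 2 + nu * (p * y - q * x) ^+ 2.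
Proof. by rewrite /quadr /eig11 /eig12 /eig22; ring. Qed.

Lemma det_eig mu nu p q : p ^+ 2 + q ^+ 2 = 1 ->
  eig11 mu nu p q * eig22 mu nu p q - eig12 mu nu p q ^+ 2 = mu * nu.
Proof.
move=> pq; rewrite [RHS](frame_one _ 2 pq) /eig11 /eig12 /eig22; ring.
Qed.

Lemma trace_eig mu nu p q : p ^+ 2 + q ^+ 2 = 1 ->
  eig11 mu nu p q + eig22 mu nu p q = mu + nu.
Proof.
move=> pq; rewrite [RHS](frame_one _ 1 pq) /eig11 /eig22; ring.
Qed.

Lemma frame_back p q x y : p ^+ 2 + q ^+ 2 = 1 ->
  (p * (p * x + q * y) - q * (p * y - q * x) = x) *
  (q * (p * x + q * y) + p * (p * y - q * x) = y).
Proof.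
move=> pq; split.
  by rewrite [RHS](frame_one _ 1 pq); ring.
by rewrite [RHS](frame_one _ 1 pq); ring.
Qed.

Lemma disc_sup_eq f g n : (forall x y, f x y = g x y) -> @disc_sup R f n -> disc_sup g n.
Proof.
move=> fg [h1 h2]; split=> [x y xy|B hB]; first by rewrite -fg h1.
by apply: h2 => x y xy; rewrite fg hB.
Qed.

Section Cubic.
Variables a b c d n : R.
Hypothesis nP : disc_sup (cubic a b c d) n.

(** Coefficients of the cubic in the orthonormal frame [(p, q)], [(- q, p)]. *)
Let A p q := polar3 a b c d p q p q p q.
Let B p q := polar3 a b c d p q p q (- q) p.
Let C p q := polar3 a b c d p q (- q) p (- q) p.
Let D p q := polar3 a b c d (- q) p (- q) p (- q) p.

Let cubic_frame p q u v :
  cubic a b c d (p * u - q * v) (q * u + p * v) = cubic (A p q) (B p q) (C p q) (D p q) u v.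
Proof. by rewrite -cubic_polar mulNr. Qed.

Let nPF p q : p ^+ 2 + q ^+ 2 = 1 ->
  disc_sup (cubic (A p q) (B p q) (C p q) (D p q)) n.
Proof.
by move=> pq; apply: disc_sup_eq (disc_sup_rot pq nP) => u v; exact: cubic_frame.
Qed.

Hypothesis nonuniv : forall l u v,
  ~ [/\ a = l * u ^+ 3, b = l * u ^+ 2 * v, c = l * u * v ^+ 2 & d = l * v ^+ 3].

Lemma cubic_norm_gt0 : 0 < n.
Proof.
have [h1 _] := nP; rewrite ltNge; apply/negP => n0.
have [ha hb hc hd] := cubic_coef_bound h1.
apply: (nonuniv (l := 0) (u := 0) (v := 0)); rewrite !mul0r.
by split; apply/eqP; rewrite -normr_le0; lra.
Qed.

Variables p q s1 s2 e : R.
Hypothesis pq : p ^+ 2 + q ^+ 2 = 1.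
Hypotheses (s10 : 0 <= s1) (s20 : 0 <= s2).
Hypothesis g11 : gram11 a b c d = eig11 (s1 ^+ 2) (s2 ^+ 2) p q.
Hypothesis g12 : gram12 a b c d = eig12 (s1 ^+ 2) (s2 ^+ 2) p q.
Hypothesis g22 : gram22 a b c d = eig22 (s1 ^+ 2) (s2 ^+ 2) p q.

Let s1E : s1 ^+ 2 = gram11 (A p q) (B p q) (C p q) (D p q).
Proof.
rewrite gram11_rot pq expr1n mul1r g11 g12 g22 /eig11 /eig12 /eig22.
by rewrite [LHS](frame_one _ 2 pq); ring.
Qed.

Let s2E : s2 ^+ 2 = gram22 (A p q) (B p q) (C p q) (D p q).
Proof.
rewrite gram22_rot pq expr1n mul1r g11 g12 g22 /eig11 /eig12 /eig22.
by rewrite [LHS](frame_one _ 2 pq); ring.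
Qed.

Let inv3 : [/\ a = polar3 (A p q) (B p q) (C p q) (D p q) p (- q) p (- q) p (- q),
  b = polar3 (A p q) (B p q) (C p q) (D p q) p (- q) p (- q) q p,
  c = polar3 (A p q) (B p q) (C p q) (D p q) p (- q) q p q p &
  d = polar3 (A p q) (B p q) (C p q) (D p q) q p q p q p].
Proof.
split; rewrite [LHS](frame_one _ 3 pq) /A /B /C /D /polar3; ring.
Qed.

(** A zero eigenvalue annihilates three of the four coefficients in the eigenframe, which leaves the
    cube of a linear form. *)
Lemma gram_eig_gt0 : 0 < s1 /\ 0 < s2.
Proof.
have [ia ib ic id] := inv3.
split; rewrite lt_neqAle ?s10 ?s20 andbT; apply/eqP => s0.
- move: s1E; rewrite -s0 expr0n/= /gram11 => h.
  have A2 := sqr_ge0 (A p q); have B2 := sqr_ge0 (B p q); have C2 := sqr_ge0 (C p q).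
  have /eqP : A p q ^+ 2 = 0 by lra.
  have /eqP : B p q ^+ 2 = 0 by lra.
  have /eqP : C p q ^+ 2 = 0 by lra.
  rewrite !sqrf_eq0 => /eqP C0 /eqP B0 /eqP A0.
  apply: (nonuniv (l := D p q) (u := - q) (v := p)).
  rewrite {1}ia {1}ib {1}ic {1}id A0 B0 C0 /polar3.
  by split; ring.
- move: s2E; rewrite -s0 expr0n/= /gram22 => h.
  have D2 := sqr_ge0 (D p q); have B2 := sqr_ge0 (B p q); have C2 := sqr_ge0 (C p q).
  have /eqP : D p q ^+ 2 = 0 by lra.
  have /eqP : B p q ^+ 2 = 0 by lra.
  have /eqP : C p q ^+ 2 = 0 by lra.
  rewrite !sqrf_eq0 => /eqP C0 /eqP B0 /eqP D0.
  apply: (nonuniv (l := A p q) (u := p) (v := q)).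
  rewrite {1}ia {1}ib {1}ic {1}id D0 B0 C0 /polar3.
  by split; ring.
Qed.

Hypothesis e0 : 0 <= e.
Hypothesis eE : n * e ^+ 3 = Num.max (- cdisc a b c d) 0.

Let eE' r w : r ^+ 2 + w ^+ 2 = 1 ->
  n * e ^+ 3 = Num.max (- cdisc (A r w) (B r w) (C r w) (D r w)) 0.
Proof.
move=> rw; rewrite eE cdisc_polar (_ : r * r - - w * w = r ^+ 2 + w ^+ 2); last by ring.
by rewrite rw expr1n mul1r.
Qed.

Lemma metric3_upper_frame x y :
  (s1 + s2 + 2 * e) * cubic a b c d x y ^+ 2 <=
    2560 * quadr (eig11 (s1 + e) (s2 + e) p q) (eig12 (s1 + e) (s2 + e) p q)
      (eig22 (s1 + e) (s2 + e) p q) x y ^+ 3.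
Proof.
rewrite quadr_eig -[x in cubic _ _ _ _ x](frame_back x y pq).1.
rewrite -[y in cubic _ _ _ _ _ y](frame_back x y pq).2 cubic_frame.
apply: (@metric3_upper _ _ _ _ _ n) => //; first exact: cubic_norm_gt0.
  exact: nPF.
exact: eE'.
Qed.

(** Two frames meet: [s1] and [s2] are bounded by multiples of [n] in the eigenframe [(p, q)] of the
    Gram matrix, while the estimate takes place in the frame [(r, w)] of the competitor. The product
    [s1 * s2] passes from one to the other by rotation invariance of [hess_norm2]. *)
Lemma metric3_lower_frame r w s t k :
  r ^+ 2 + w ^+ 2 = 1 -> 0 < t -> t <= s -> 0 <= k ->
  (forall x y, s ^+ 2 * cubic a b c d x y ^+ 2 <=
     k ^+ 2 * quadr (eig11 (s ^+ 2) (t ^+ 2) r w) (eig12 (s ^+ 2) (t ^+ 2) r w)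
      (eig22 (s ^+ 2) (t ^+ 2) r w) x y ^+ 3) ->
  (s1 + e) * (s2 + e) <= 1200 * k ^+ 2 * (s ^+ 2 * t ^+ 2).
Proof.
move=> rw t0 ts k0 h.
have [h1 _] := nPF pq.
have [na nb nc nd] := cubic_coef_bound h1.
have /sqr_le_norm a2 := na; have /sqr_le_norm b2 := nb.
have /sqr_le_norm c2 := nc; have /sqr_le_norm d2 := nd.
have n11 : 0 <= 11 * n by rewrite mulr_ge0// ltW// cubic_norm_gt0.
have n2 : 0 <= n ^+ 2 by rewrite sqr_ge0.
apply: (@metric3_lower _ (A r w) (B r w) (C r w) (D r w) n) => //.
- exact: cubic_norm_gt0.
- exact: nPF.
- rewrite -ler_sqr ?nnegrE// s1E /gram11; lra.
- rewrite -ler_sqr ?nnegrE// s2E /gram22; lra.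
- by rewrite hess_norm2_rot rw expr1n mul1r -gram_det g11 g12 g22 det_eig// exprMn.
- exact: eE'.
move=> x y; rewrite -cubic_frame; apply: le_trans (h _ _) _.
rewrite quadr_eig le_eqVlt; apply/orP; left; apply/eqP.
congr (_ * (_ * _ ^+ 2 + _ * _ ^+ 2) ^+ 3).
  by rewrite [RHS](frame_one _ 1 rw); ring.
by rewrite [RHS](frame_one _ 1 rw); ring.
Qed.

End Cubic.

Section Quadratic.
Variables a b c n : R.
Hypothesis nP : disc_sup (quadr a b c) n.
Hypothesis nonuniv : forall l u v,
  ~ [/\ a = l * u ^+ 2, b = l * u * v & c = l * v ^+ 2].
Variables p q mu nu : R.
Hypothesis pq : p ^+ 2 + q ^+ 2 = 1.
Hypothesis aE : a = eig11 mu nu p q.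
Hypothesis bE : b = eig12 mu nu p q.
Hypothesis cE : c = eig22 mu nu p q.

Lemma quadr_eig_neq0 : mu != 0 /\ nu != 0.
Proof.
split; apply/eqP => z0.
  apply: (nonuniv (l := nu) (u := - q) (v := p)).
  by rewrite aE bE cE z0 /eig11 /eig12 /eig22; split; ring.
apply: (nonuniv (l := mu) (u := p) (v := q)).
by rewrite aE bE cE z0 /eig11 /eig12 /eig22; split; ring.
Qed.

Lemma eig_le_norm : `|mu| <= n /\ `|nu| <= n.
Proof.
have [h1 _] := nP; have pq' : q ^+ 2 + p ^+ 2 = 1 by rewrite addrC.
split.
  have := h1 p q; rewrite pq => /(_ (lexx _)).
  rewrite aE bE cE quadr_eig [X in `|X|](_ : _ = mu * (p ^+ 2 + q ^+ 2) ^+ 2); last by ring.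
  by rewrite pq expr1n mulr1.
have := h1 (- q) p; rewrite sqrrN pq' => /(_ (lexx _)).
rewrite aE bE cE quadr_eig [X in `|X|](_ : _ = nu * (p ^+ 2 + q ^+ 2) ^+ 2); last by ring.
by rewrite pq expr1n mulr1.
Qed.

Lemma quadr_norm_gt0 : 0 < n.
Proof.
have [mu0 _] := quadr_eig_neq0; have [hmu _] := eig_le_norm.
by apply: lt_le_trans hmu; rewrite normr_gt0.
Qed.

(** Both [|mu|] and [|nu|] are at most [n], so the trace is at most [2 * n ^+ 2]; the factor
    [n ^+ 2] is what the normalization of the metric by [n] provides on the right. *)
Lemma metric2_upper_frame x y :
  (n * `|mu| + n * `|nu|) * quadr a b c x y ^+ 2 <=
    2 * quadr (eig11 (n * `|mu|) (n * `|nu|) p q) (eig12 (n * `|mu|) (n * `|nu|) p q)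
      (eig22 (n * `|mu|) (n * `|nu|) p q) x y ^+ 2.
Proof.
have n0 := quadr_norm_gt0; have [hmu hnu] := eig_le_norm.
rewrite {1}aE {1}bE {1}cE !quadr_eig.
set X := (p * x + q * y) ^+ 2; set Y := (p * y - q * x) ^+ 2.
have X0 : 0 <= X by exact: sqr_ge0.
have Y0 : 0 <= Y by exact: sqr_ge0.
have h : `|mu * X + nu * Y| <= `|mu| * X + `|nu| * Y.
  by rewrite (le_trans (ler_normD _ _))// (normrM mu) (normrM nu) (ger0_norm X0) (ger0_norm Y0).
have /sqr_le_norm h2 := h.
rewrite (_ : n * `|mu| * X + n * `|nu| * Y = n * (`|mu| * X + `|nu| * Y)); last by ring.
rewrite (exprMn _ n) [X in _ <= X]mulrA.
have n20 : 0 <= n * `|mu| + n * `|nu| by rewrite addr_ge0// mulr_ge0// ltW.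
apply: (le_trans (ler_wpM2l n20 h2)); rewrite ler_wpM2r ?sqr_ge0//.
by have := ler_wpM2l (ltW n0) hmu; have := ler_wpM2l (ltW n0) hnu; lra.
Qed.

(** In the competitor's frame [n] is at most [4 * k * s] and the determinant at most
    [2 * (k ^+ 2 * t ^+ 2)] in absolute value. The latter is invariant under rotation and equals
    [mu * nu], whence [32 = 4 ^+ 2 * 2]. *)
Lemma metric2_lower_frame r w s t k :
  r ^+ 2 + w ^+ 2 = 1 -> 0 < t -> t <= s -> 0 <= k ->
  (forall x y, s ^+ 2 * quadr a b c x y ^+ 2 <=
     k ^+ 2 * quadr (eig11 (s ^+ 2) (t ^+ 2) r w) (eig12 (s ^+ 2) (t ^+ 2) r w)
      (eig22 (s ^+ 2) (t ^+ 2) r w) x y ^+ 2) ->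
  (n * `|mu|) * (n * `|nu|) <= 32 * k ^+ 4 * (s ^+ 2 * t ^+ 2).
Proof.
move=> rw t0 ts k0 h.
pose A := quadr a b c r w; pose B := polar2 a b c r w (- w) r.
pose C := quadr a b c (- w) r.
have frameE x y : quadr a b c (r * x - w * y) (w * x + r * y) = quadr A B C x y.
  by rewrite /quadr /A /B /C /quadr /polar2; ring.
have {}h x y : s ^+ 2 * quadr A B C x y ^+ 2 <= k ^+ 2 * (s ^+ 2 * x ^+ 2 + t ^+ 2 * y ^+ 2) ^+ 2.
  rewrite -frameE; apply: le_trans (h _ _) _.
  rewrite quadr_eig le_eqVlt; apply/orP; left; apply/eqP.
  congr (_ * (_ * _ ^+ 2 + _ * _ ^+ 2) ^+ 2).
    by rewrite [RHS](frame_one _ 1 rw); ring.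
  by rewrite [RHS](frame_one _ 1 rw); ring.
have s0 : 0 < s by exact: lt_le_trans ts.
have sn0 := ltW s0; have tn0 := ltW t0.
have hA : `|A| <= k * s.
  rewrite -(ler_pM2l s0) -{1}(gtr0_norm s0) -normrM; apply: norm_le_sqr.
    by rewrite !mulr_ge0.
  have := h 1 0; rewrite /quadr !(expr0n,expr1n,mulr0,mulr1,addr0)/= => h1.
  by rewrite exprMn (le_trans h1)// le_eqVlt; apply/orP; left; apply/eqP; ring.
have hC : `|C| * s <= k * t ^+ 2.
  rewrite -{1}(gtr0_norm s0) -normrM; apply: norm_le_sqr.
    by rewrite mulr_ge0// exprn_ge0.
  have := h 0 1; rewrite /quadr !(expr0n,expr1n,mulr0,mulr1,addr0,mul0r,add0r)/= => h1.
  by rewrite exprMn mulrC (le_trans h1)// le_eqVlt; apply/orP; left; apply/eqP; ring.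
have hpm y : y ^+ 2 = s ^+ 2 -> `|s * quadr A B C t y| <= 2 * (k * s ^+ 2 * t ^+ 2).
  move=> ys; apply: norm_le_sqr; first by rewrite !mulr_ge0// sqr_ge0.
  rewrite exprMn (le_trans (h _ _))// ys le_eqVlt; apply/orP; left; apply/eqP; ring.
have h1 := hpm s erefl.
have h2 := hpm (- s) (sqrrN _).
have hB : `|B| <= k * t.
  have r0 : 0 < s ^+ 2 * t by rewrite mulr_gt0// exprn_gt0.
  rewrite -(ler_pM2r r0) -{1}(gtr0_norm r0) -normrM.
  move: h1 h2; rewrite /quadr !ler_norml.
  move=> /andP[? ?] /andP[? ?]; apply/andP; split; lra.
have ts2 : t * t <= t * s by rewrite ler_wpM2l.
have hC' : `|C| <= k * t.
  rewrite -(ler_pM2r s0) (le_trans hC)// -mulrA ler_wpM2l// expr2//.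
have hn : n <= 4 * k * s.
  have : disc_sup (quadr A B C) n by apply: disc_sup_eq (disc_sup_rot rw nP) => u v; exact: frameE.
  move=> [_]; apply=> x y xy.
  have hx : `|x| <= 1 by apply: norm_le_sqr => //; nra.
  have hy : `|y| <= 1 by apply: norm_le_sqr => //; nra.
  have hxx := normM_le hx hx; have hxy := normM_le hx hy; have hyy := normM_le hy hy.
  have hAx := normM_le hA hxx; have hBx := normM_le hB hxy; have hCx := normM_le hC' hyy.
  have kts : k * t <= k * s by rewrite ler_wpM2l.
  have -> : quadr A B C x y = A * (x * x) + (B * (x * y) + B * (x * y)) + C * (y * y).
    by rewrite /quadr; ring.
  apply: (le_trans (ler_normD _ _)).
  have := ler_normD (A * (x * x)) (B * (x * y) + B * (x * y)).
  have := ler_normD (B * (x * y)) (B * (x * y)).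
  lra.
have hAC : `|A * C| <= k ^+ 2 * t ^+ 2.
  rewrite normrM (le_trans (ler_wpM2r (normr_ge0 _) hA))//.
  rewrite -mulrA (mulrC s) (le_trans (ler_wpM2l k0 hC))// mulrA -expr2//.
have hBB := normM_le hB hB.
have hdet : `|A * C - B ^+ 2| <= 2 * (k ^+ 2 * t ^+ 2).
  by apply: (le_trans (ler_normB _ _)); rewrite (expr2 B); lra.
have -> : n * `|mu| * (n * `|nu|) = n ^+ 2 * `|A * C - B ^+ 2|.
  have -> : A * C - B ^+ 2 = (r ^+ 2 + w ^+ 2) ^+ 2 * (a * c - b ^+ 2).
    by rewrite /A /B /C /quadr /polar2; ring.
  by rewrite rw expr1n mul1r aE bE cE det_eig// normrM; ring.
have n0 := ltW quadr_norm_gt0.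
have n2 : n ^+ 2 <= (4 * k * s) ^+ 2 by rewrite lerXn2r// ?nnegrE// !mulr_ge0.
apply: (le_trans (ler_pM _ _ n2 hdet)); rewrite ?sqr_ge0//.
by rewrite le_eqVlt; apply/orP; left; apply/eqP; ring.
Qed.

End Quadratic.
End Frames.

(** * Interpolation error in the coordinates of a triangle *)

Section TriangleAlgebra.
Variable R : realFieldType.
Implicit Types a b c d p q x y s t : R.

(* The entries of [HT T] for a triangle [T] with edges [(x1, y1)] and [(x2, y2)]
   issued from the same vertex. *)
Definition tri_det (x1 y1 x2 y2 : R) := x1 * y2 - x2 * y1.
Definition tri11 (x1 y1 x2 y2 : R) :=
  3 * (y1 ^+ 2 + y2 ^+ 2 - y1 * y2) / tri_det x1 y1 x2 y2 ^+ 2.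
Definition tri12 (x1 y1 x2 y2 : R) :=
  - (3 / 2) * (2 * x1 * y1 + 2 * x2 * y2 - x1 * y2 - x2 * y1) /
  tri_det x1 y1 x2 y2 ^+ 2.
Definition tri22 (x1 y1 x2 y2 : R) :=
  3 * (x1 ^+ 2 + x2 ^+ 2 - x1 * x2) / tri_det x1 y1 x2 y2 ^+ 2.

(** Every triangle is equilateral for its own metric: in edge coordinates the metric is a fixed
    form, equal to 3 on each edge. *)
Lemma quadr_tri x1 y1 x2 y2 s t : tri_det x1 y1 x2 y2 != 0 ->
  quadr (tri11 x1 y1 x2 y2) (tri12 x1 y1 x2 y2) (tri22 x1 y1 x2 y2)
    (x1 * s + x2 * t) (y1 * s + y2 * t) = 3 * (s ^+ 2 + s * t + t ^+ 2).
Proof. by rewrite /quadr /tri11 /tri12 /tri22 /tri_det => D0; field. Qed.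

Lemma tri_span x1 y1 x2 y2 x y : tri_det x1 y1 x2 y2 != 0 ->
  exists s t, x = x1 * s + x2 * t /\ y = y1 * s + y2 * t.
Proof.
rewrite /tri_det => D0.
exists ((y2 * x - x2 * y) / (x1 * y2 - x2 * y1)).
exists ((x1 * y - y1 * x) / (x1 * y2 - x2 * y1)).
by split; field.
Qed.

(** Cramer's rule recovers the gradient from its components [u] and [v] along the edges; after
    multiplication by the squared determinant, the difference of the two sides is a sum of
    nonnegative terms. *)
Lemma tri_grad_le x1 y1 x2 y2 gx gy : tri_det x1 y1 x2 y2 != 0 ->
  gx ^+ 2 + gy ^+ 2 <= 2 / 3 * (tri11 x1 y1 x2 y2 + tri22 x1 y1 x2 y2) *
    ((gx * x1 + gy * y1) ^+ 2 + (gx * x2 + gy * y2) ^+ 2).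
Proof.
move=> D0; have D2 : 0 < tri_det x1 y1 x2 y2 ^+ 2 by rewrite exprn_even_gt0.
rewrite -(ler_pM2l D2).
set u := gx * x1 + _; set v := gx * x2 + _.
have -> : tri_det x1 y1 x2 y2 ^+ 2 *
   (2 / 3 * (tri11 x1 y1 x2 y2 + tri22 x1 y1 x2 y2) * (u ^+ 2 + v ^+ 2)) =
  2 * (x1 ^+ 2 + y1 ^+ 2 + x2 ^+ 2 + y2 ^+ 2 - x1 * x2 - y1 * y2) * (u ^+ 2 + v ^+ 2).
  by move: D0; rewrite /tri11 /tri22 /tri_det => D0; field.
have -> : tri_det x1 y1 x2 y2 ^+ 2 * (gx ^+ 2 + gy ^+ 2) =
  (y2 * u - y1 * v) ^+ 2 + (x1 * v - x2 * u) ^+ 2.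
  by rewrite /tri_det /u /v; ring.
move: u v => u v; rewrite -subr_ge0.
have -> : 2 * (x1 ^+ 2 + y1 ^+ 2 + x2 ^+ 2 + y2 ^+ 2 - x1 * x2 - y1 * y2) * (u ^+ 2 + v ^+ 2) -
  ((y2 * u - y1 * v) ^+ 2 + (x1 * v - x2 * u) ^+ 2) =
  ((x1 - x2) ^+ 2 + (y1 - y2) ^+ 2) * (u ^+ 2 + v ^+ 2) +
  (y1 * u + y2 * v) ^+ 2 + (x1 * u + x2 * v) ^+ 2 by ring.
apply: addr_ge0; last exact: sqr_ge0.
apply: addr_ge0; last exact: sqr_ge0.
by apply: mulr_ge0; exact: (addr_ge0 (sqr_ge0 _) (sqr_ge0 _)).
Qed.

(* The partial derivatives, in the affine coordinates [(s, t)] of the triangle, of the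
   interpolation error of the form with coefficients [A B C D] in the basis of edges. *)
Definition err2s (A B C s t : R) := A * (2 * s - 1) + 2 * B * t.
Definition err2t (A B C s t : R) := C * (2 * t - 1) + 2 * B * s.
Definition err3s (A B C D s t : R) := A * (3 * s ^+ 2 - 3 * s + 2^-1) +
  3 * B * (2 * s * t - t / 2) + 3 * C * (t ^+ 2 - t / 2).
Definition err3t (A B C D s t : R) := D * (3 * t ^+ 2 - 3 * t + 2^-1) +
  3 * C * (2 * s * t - s / 2) + 3 * B * (s ^+ 2 - s / 2).

Definition poly2 (k : R * R * R * R * R * R) x y :=
  let: (k0, k1, k2, k3, k4, k5) := k in
  k0 + k1 * x + k2 * y + k3 * x ^+ 2 + k4 * x * y + k5 * y ^+ 2.
Definition poly2x (k : R * R * R * R * R * R) x y :=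
  let: (k0, k1, k2, k3, k4, k5) := k in k1 + 2 * k3 * x + k4 * y.
Definition poly2y (k : R * R * R * R * R * R) x y :=
  let: (k0, k1, k2, k3, k4, k5) := k in k2 + k4 * x + 2 * k5 * y.

(** Translating the triangle changes the form by a polynomial of lower degree, which interpolation
    reproduces; this is why [x0] and [y0] are absent from the result. The nodal values of [E] added
    in the proof form the derivative of the interpolant of [E], which vanishes. *)
Lemma interp_err2 a b c k0 k1 k2 x0 y0 x1 y1 x2 y2 s t :
  let E x y := quadr a b c x y - (k0 + k1 * x + k2 * y) in
  let x := x0 + x1 * s + x2 * t in let y := y0 + y1 * s + y2 * t in
  let gx := 2 * (a * x + b * y) - k1 in
  let gy := 2 * (b * x + c * y) - k2 in
  E x0 y0 = 0 -> E (x0 + x1) (y0 + y1) = 0 -> E (x0 + x2) (y0 + y2) = 0 ->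
  let A := quadr a b c x1 y1 in let B := polar2 a b c x1 y1 x2 y2 in
  let C := quadr a b c x2 y2 in
  gx * x1 + gy * y1 = err2s A B C s t /\ gx * x2 + gy * y2 = err2t A B C s t.
Proof.
move=> E x y gx gy h0 h1 h2 A B C; split.
  rewrite [LHS](_ : _ = err2s A B C s t + E (x0 + x1) (y0 + y1) - E x0 y0).
    by rewrite h0 h1 addr0 subr0.
  by rewrite /err2s /A /B /C /E /gx /gy /x /y /quadr /polar2; ring.
rewrite [LHS](_ : _ = err2t A B C s t + E (x0 + x2) (y0 + y2) - E x0 y0).
  by rewrite h0 h2 addr0 subr0.
by rewrite /err2t /A /B /C /E /gx /gy /x /y /quadr /polar2; ring.
Qed.

Lemma interp_err3 a b c d k x0 y0 x1 y1 x2 y2 s t :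
  let E x y := cubic a b c d x y - poly2 k x y in
  let x := x0 + x1 * s + x2 * t in let y := y0 + y1 * s + y2 * t in
  let gx := 3 * quadr a b c x y - poly2x k x y in
  let gy := 3 * quadr b c d x y - poly2y k x y in
  E x0 y0 = 0 -> E (x0 + x1) (y0 + y1) = 0 -> E (x0 + x2) (y0 + y2) = 0 ->
  E (x0 + x1 / 2) (y0 + y1 / 2) = 0 -> E (x0 + x2 / 2) (y0 + y2 / 2) = 0 ->
  E (x0 + (x1 + x2) / 2) (y0 + (y1 + y2) / 2) = 0 ->
  let A := polar3 a b c d x1 y1 x1 y1 x1 y1 in
  let B := polar3 a b c d x1 y1 x1 y1 x2 y2 in
  let C := polar3 a b c d x1 y1 x2 y2 x2 y2 in
  let D := polar3 a b c d x2 y2 x2 y2 x2 y2 in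
  gx * x1 + gy * y1 = err3s A B C D s t /\ gx * x2 + gy * y2 = err3t A B C D s t.
Proof.
case: k => [[[[[k0 k1] k2] k3] k4] k5] E x y gx gy h0 h1 h2 h3 h4 h5 A B C D; split.
  (* The factors of the nodal values are the [s]-derivatives of the quadratic Lagrange basis written
     in the barycentric coordinates [1 - s - t], [s], [t]. *)
  rewrite [LHS](_ : _ = err3s A B C D s t
     + (4 * s + 4 * t - 3) * E x0 y0 + (4 * s - 1) * E (x0 + x1) (y0 + y1)
     + (4 - 8 * s - 4 * t) * E (x0 + x1 / 2) (y0 + y1 / 2)
     - 4 * t * E (x0 + x2 / 2) (y0 + y2 / 2)
     + 4 * t * E (x0 + (x1 + x2) / 2) (y0 + (y1 + y2) / 2)).
    by rewrite h0 h1 h3 h4 h5 !mulr0 !addr0 subr0.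
  rewrite /err3s /A /B /C /D /E /gx /gy /x /y /poly2 /poly2x /poly2y.
  by rewrite /cubic /quadr /polar3; field.
rewrite [LHS](_ : _ = err3t A B C D s t
     + (4 * s + 4 * t - 3) * E x0 y0 + (4 * t - 1) * E (x0 + x2) (y0 + y2)
     + (4 - 8 * t - 4 * s) * E (x0 + x2 / 2) (y0 + y2 / 2)
     - 4 * s * E (x0 + x1 / 2) (y0 + y1 / 2)
     + 4 * s * E (x0 + (x1 + x2) / 2) (y0 + (y1 + y2) / 2)).
  by rewrite h0 h2 h3 h4 h5 !mulr0 !addr0 subr0.
rewrite /err3t /A /B /C /D /E /gx /gy /x /y /poly2 /poly2x /poly2y.
by rewrite /cubic /quadr /polar3; field.
Qed.

(** Cauchy-Schwarz for three terms with weights at most 5: [225 = 3 * 3 * 25]. *)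
Lemma wsqr3_le (h L A B C al be ga : R) : 0 <= h ->
  h * A ^+ 2 <= L -> h * B ^+ 2 <= L -> h * C ^+ 2 <= L ->
  `|al| <= 5 -> `|be| <= 5 -> `|ga| <= 5 ->
  h * (A * al + B * be + C * ga) ^+ 2 <= 225 * L.
Proof.
move=> h0 hA hB hC hal hbe hga.
have L0 : 0 <= L by apply: le_trans hA; rewrite mulr_ge0 ?sqr_ge0.
have step X e : h * X ^+ 2 <= L -> `|e| <= 5 -> h * (X * e) ^+ 2 <= 25 * L.
  move=> hX /sqr_le_norm e5.
  rewrite (_ : h * (X * e) ^+ 2 = h * X ^+ 2 * e ^+ 2); last by ring.
  apply: (le_trans (ler_wpM2r (sqr_ge0 e) hX)); rewrite (mulrC 25) ler_wpM2l//.
  by apply: (le_trans e5); clear; lra.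
apply: (@le_trans _ _ (h * (3 * ((A * al) ^+ 2 + (B * be) ^+ 2 + (C * ga) ^+ 2)))).
  rewrite ler_wpM2l//; move: (A * al) (B * be) (C * ga) => X Y Z; clear.
  have := sqr_ge0 (X - Y); have := sqr_ge0 (X - Z); have := sqr_ge0 (Y - Z); lra.
have := step _ _ hA hal; have := step _ _ hB hbe; have := step _ _ hC hga.
clear; lra.
Qed.

Lemma err2_le (h L A B C s t : R) : 0 <= h -> 0 <= s -> 0 <= t -> s + t <= 1 ->
  h * A ^+ 2 <= L -> h * B ^+ 2 <= L -> h * C ^+ 2 <= L ->
  h * (err2s A B C s t ^+ 2 + err2t A B C s t ^+ 2) <= 450 * L.
Proof.
move=> h0 s0 t0 st hA hB hC; rewrite mulrDr.
have n0 : `|0 : R| <= 5 by rewrite normr0.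
have h1 : h * err2s A B C s t ^+ 2 <= 225 * L.
  rewrite (_ : err2s A B C s t = A * (2 * s - 1) + B * (2 * t) + C * 0); last by rewrite /err2s; ring.
  by apply: wsqr3_le => //; rewrite ler_norml; apply/andP; split; clear - s0 t0 st; lra.
have h2 : h * err2t A B C s t ^+ 2 <= 225 * L.
  rewrite (_ : err2t A B C s t = A * 0 + B * (2 * s) + C * (2 * t - 1)); last by rewrite /err2t; ring.
  by apply: wsqr3_le => //; rewrite ler_norml; apply/andP; split; clear - s0 t0 st; lra.
clear - h1 h2; lra.
Qed.

Lemma err3_le (h L A B C D s t : R) : 0 <= h -> 0 <= s -> 0 <= t -> s + t <= 1 ->
  h * A ^+ 2 <= L -> h * B ^+ 2 <= L -> h * C ^+ 2 <= L -> h * D ^+ 2 <= L ->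
  h * (err3s A B C D s t ^+ 2 + err3t A B C D s t ^+ 2) <= 450 * L.
Proof.
move=> h0 s0 t0 st hA hB hC hD; rewrite mulrDr.
have s1 : s <= 1 by lra.
have t1 : t <= 1 by lra.
have st0 : 0 <= s * t by rewrite mulr_ge0.
have st1 : s * t <= t by rewrite ler_piMl.
have st2 : s * t <= s by rewrite ler_piMr.
have ss1 : s * s <= s by rewrite ler_piMl.
have tt1 : t * t <= t by rewrite ler_piMl.
have ss0 : 0 <= s * s by rewrite mulr_ge0.
have tt0 : 0 <= t * t by rewrite mulr_ge0.
have h1 : h * err3s A B C D s t ^+ 2 <= 225 * L.
  rewrite (_ : err3s A B C D s t = A * (3 * s ^+ 2 - 3 * s + 2^-1) +
    B * (3 * (2 * s * t - t / 2)) + C * (3 * (t ^+ 2 - t / 2))); last by rewrite /err3s; ring.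
  by apply: wsqr3_le => //; rewrite ler_norml; apply/andP; split;
    clear - s0 t0 st st0 st1 st2 ss1 tt1 ss0 tt0 s1 t1; lra.
have h2 : h * err3t A B C D s t ^+ 2 <= 225 * L.
  rewrite (_ : err3t A B C D s t = B * (3 * (s ^+ 2 - s / 2)) +
    C * (3 * (2 * s * t - s / 2)) + D * (3 * t ^+ 2 - 3 * t + 2^-1)); last by rewrite /err3t; ring.
  by apply: wsqr3_le => //; rewrite ler_norml; apply/andP; split;
    clear - s0 t0 st st0 st1 st2 ss1 tt1 ss0 tt0 s1 t1; lra.
clear - h1 h2; lra.
Qed.

Lemma sub_scaled_le (h K L X u v : R) : 0 <= h ->
  h * u ^+ 2 <= L -> h * v ^+ 2 <= L -> h * X ^+ 2 <= L -> 
  h * (u + v - 2 * X) ^+ 2 <= 18 * L.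
Proof.
move=> h0 hu hv hX.
apply: (@le_trans _ _ (h * (3 * (u ^+ 2 + v ^+ 2 + 4 * X ^+ 2)))); last by lra.
rewrite ler_wpM2l//; clear.
have := sqr_ge0 (u - v); have := sqr_ge0 (u + 2 * X); have := sqr_ge0 (v + 2 * X); lra.
Qed.

(** At the edge coordinates [(1, 0)], [(0, 1)], [(1, 1)], [(1, - 1)] the metric is 3, 3, 9, 3. The
    constant [729 = 9 ^+ 3] is the one that cubics require at [(1, 1)], shared by both degrees. *)
Lemma tri_quadr_coefs a b c x1 y1 x2 y2 (h K : R) : tri_det x1 y1 x2 y2 != 0 ->
  0 <= h -> 0 <= K ->
  (forall x y, h * quadr a b c x y ^+ 2 <=
     K * quadr (tri11 x1 y1 x2 y2) (tri12 x1 y1 x2 y2) (tri22 x1 y1 x2 y2) x y ^+ 2) ->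
  let A := quadr a b c x1 y1 in let B := polar2 a b c x1 y1 x2 y2 in
  let C := quadr a b c x2 y2 in
  [/\ h * A ^+ 2 <= 729 * K, h * B ^+ 2 <= 729 * K & h * C ^+ 2 <= 729 * K].
Proof.
move=> D0 h0 K0 hyp A B C.
have H s t := hyp (x1 * s + x2 * t) (y1 * s + y2 * t).
have hA := H 1 0; have hC := H 0 1; have hP := H 1 1; have hM := H 1 (- 1).
rewrite !quadr_tri// in hA hC hP hM.
rewrite [quadr a _ _ _ _](_ : _ = A) in hA; last by rewrite /A /quadr; ring.
rewrite [quadr a _ _ _ _](_ : _ = C) in hC; last by rewrite /C /quadr; ring.
rewrite [quadr a _ _ _ _](_ : _ = A + 2 * B + C) in hP;
  last by rewrite /A /B /C /quadr /polar2; ring.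
rewrite [quadr a _ _ _ _](_ : _ = A - 2 * B + C) in hM;
  last by rewrite /A /B /C /quadr /polar2; ring.
have {}hA : h * A ^+ 2 <= 9 * K by lra.
have {}hC : h * C ^+ 2 <= 9 * K by lra.
have {}hP : h * (A + 2 * B + C) ^+ 2 <= 81 * K by lra.
have {}hM : h * (A - 2 * B + C) ^+ 2 <= 9 * K by lra.
have hB : h * (4 * B) ^+ 2 <= 2 * (h * (A + 2 * B + C) ^+ 2) + 2 * (h * (A - 2 * B + C) ^+ 2).
  have e : 0 <= h * (2 * (A + C)) ^+ 2 by rewrite mulr_ge0 ?sqr_ge0.
  by clear - e; lra.
split; lra.
Qed.

Lemma tri_cubic_coefs a b c d x1 y1 x2 y2 (h K : R) : tri_det x1 y1 x2 y2 != 0 ->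
  0 <= h -> 0 <= K ->
  (forall x y, h * cubic a b c d x y ^+ 2 <=
     K * quadr (tri11 x1 y1 x2 y2) (tri12 x1 y1 x2 y2) (tri22 x1 y1 x2 y2) x y ^+ 3) ->
  let A := polar3 a b c d x1 y1 x1 y1 x1 y1 in
  let B := polar3 a b c d x1 y1 x1 y1 x2 y2 in
  let C := polar3 a b c d x1 y1 x2 y2 x2 y2 in
  let D := polar3 a b c d x2 y2 x2 y2 x2 y2 in
  [/\ h * A ^+ 2 <= 729 * K, h * B ^+ 2 <= 729 * K, h * C ^+ 2 <= 729 * K &
      h * D ^+ 2 <= 729 * K].
Proof.
move=> D0 h0 K0 hyp A B C D.
have H s t := hyp (x1 * s + x2 * t) (y1 * s + y2 * t).
have hA := H 1 0; have hD := H 0 1; have hP := H 1 1; have hM := H 1 (- 1).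
rewrite !quadr_tri// !cubic_polar -/A -/B -/C -/D in hA hD hP hM.
have {}hA : h * A ^+ 2 <= 27 * K by move: hA; rewrite /cubic; clear - K0; lra.
have {}hD : h * D ^+ 2 <= 27 * K by move: hD; rewrite /cubic; clear - K0; lra.
have {}hP : h * (A + 3 * B + 3 * C + D) ^+ 2 <= 729 * K by move: hP; rewrite /cubic; clear - K0; lra.
have {}hM : h * (A - 3 * B + 3 * C - D) ^+ 2 <= 27 * K by move: hM; rewrite /cubic; clear - K0; lra.
have big X : h * X ^+ 2 <= 27 * K -> h * X ^+ 2 <= 729 * K by clear - K0; lra.
have hMN : h * (- (A - 3 * B + 3 * C - D)) ^+ 2 <= 729 * K by rewrite sqrrN; exact: big.
have hB : h * (6 * B) ^+ 2 <= 18 * (729 * K).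
  rewrite (_ : 6 * B = (A + 3 * B + 3 * C + D) + - (A - 3 * B + 3 * C - D) - 2 * D); last by ring.
  by apply: sub_scaled_le => //; exact: big.
have hC : h * (6 * C) ^+ 2 <= 18 * (729 * K).
  rewrite (_ : 6 * C = (A + 3 * B + 3 * C + D) + (A - 3 * B + 3 * C - D) - 2 * A); last by ring.
  by apply: sub_scaled_le => //; exact: big.
by split; [exact: big| | |exact: big]; clear - hB hC K0; lra.
Qed.

End TriangleAlgebra.

(** * Recovery of the coefficients from a single directional derivative *)

Section Recovery.
Variable R : realFieldType.
Implicit Types a b c d p q x y s t : R.

Lemma wsum4_le (A B C D al be ga de l : R) : 0 <= l ->
  `|al| <= l -> `|be| <= l -> `|ga| <= l -> `|de| <= l ->
  `|A * al + B * be + C * ga + D * de| <= l * (`|A| + `|B| + `|C| + `|D|).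
Proof.
move=> l0 hal hbe hga hde.
have h X e : `|e| <= l -> `|X * e| <= l * `|X| by rewrite normrM mulrC => ?; rewrite ler_wpM2r.
apply: (le_trans (ler_normD _ _)); rewrite mulrDr; apply: lerD; last exact: h.
apply: (le_trans (ler_normD _ _)); rewrite mulrDr; apply: lerD; last exact: h.
by apply: (le_trans (ler_normD _ _)); rewrite mulrDr; apply: lerD; exact: h.
Qed.

(** What an average can provide: no bound at a prescribed point, but one at some point within [l] of
    it in each coordinate. *)
Definition near_bounded (G : R -> R -> R) (l r : R) := forall s t, 0 <= s -> 0 <= t -> s + t <= 1 ->
  exists s' t', [/\ `|s' - s| <= l, `|t' - t| <= l & `|G s' t'| <= r].

(** The values at the three vertices determine the coefficients. Moving from a vertex to the nearby
    good point costs a multiple of [l * S], with [S] the sum of the absolute values of the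
    coefficients; as [l] is at most 1/1000, this is absorbed on the left. *)
Lemma err2_recover (A B C l r : R) : 0 <= l -> 1000 * l <= 1 ->
  near_bounded (fun s t => err2s A B C s t + err2t A B C s t) l r ->
  [/\ `|A| <= 44 * r, `|B| <= 44 * r & `|C| <= 44 * r].
Proof.
move=> ln lle h; pose S := `|A| + `|B| + `|C| + `|0 : R|.
have H s t : 0 <= s -> 0 <= t -> s + t <= 1 ->
    `|err2s A B C s t + err2t A B C s t| <= r + 4 * l * S.
  move=> s0 t0 st; have [s' [t' [hs ht hr]]] := h s t s0 t0 st.
  have := ler_normB (err2s A B C s' t' + err2t A B C s' t')
    (A * (2 * (s' - s)) + B * (2 * (s' - s) + 2 * (t' - t)) + C * (2 * (t' - t)) + 0 * 0).
  rewrite (_ : _ - _ = err2s A B C s t + err2t A B C s t); last by rewrite /err2s /err2t; ring.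
  move=> /le_trans; apply; apply: lerD => //.
  have l0 : 0 <= 4 * l by rewrite mulr_ge0.
  apply: wsum4_le; rewrite ?normr0//;
  by move: hs ht; clear; rewrite !ler_norml => /andP[? ?] /andP[? ?]; apply/andP; split; lra.
have := H 0 0; have := H 1 0; have := H 0 1.
rewrite /S normr0 addr0; set x := r + _.
move=> /(_ (lexx _) ler01 _) h01 /(_ ler01 (lexx _) _) h10 /(_ (lexx _) (lexx _) _) h00.
have {}h01 : `|err2s A B C 0 1 + err2t A B C 0 1| <= x by apply: h01; lra.
have {}h10 : `|err2s A B C 1 0 + err2t A B C 1 0| <= x by apply: h10; lra.
have {}h00 : `|err2s A B C 0 0 + err2t A B C 0 0| <= x by apply: h00; lra.
have [hA hB hC] : [/\ `|A| <= x, `|B| <= x & `|C| <= x].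
  move: h01 h10 h00; move: x => x; clear; rewrite /err2s /err2t !ler_norml.
  move=> /andP[? ?] /andP[? ?] /andP[? ?].
  by split; apply/andP; split; lra.
have r0 : 0 <= r.
  have [s' [t' [_ _ hr]]] := h 0 0 (lexx _) (lexx _) ltac:(lra).
  exact: le_trans hr.
rewrite /x -mulrA in hA hB hC.
have lS : 1000 * (l * (`|A| + `|B| + `|C|)) <= `|A| + `|B| + `|C| by rewrite mulrA ler_piMl// !addr_ge0.
move: (l * _) lS hA hB hC => m lS hA hB hC.
by split; clear - lS hA hB hC r0; lra.
Qed.

(** The function is now quadratic in [(s, t)], and its values at the six Lagrange points determine
    the coefficients; the absorption is that of [err2_recover]. *)
Lemma err3_recover (A B C D l r : R) : 0 <= l -> 1000 * l <= 1 ->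
  near_bounded (fun s t => err3s A B C D s t + err3t A B C D s t) l r ->
  [/\ `|A| <= 44 * r, `|B| <= 44 * r, `|C| <= 44 * r & `|D| <= 44 * r].
Proof.
move=> ln lle h.
have half0 : (0 : R) <= 2^-1 by lra.
have half1 : (2^-1 : R) + 2^-1 <= 1 by lra.
have half2 : (2^-1 : R) <= 1 by lra.
pose S := `|A| + `|B| + `|C| + `|D|.
have H s t : 0 <= s -> 0 <= t -> s + t <= 1 ->
    `|err3s A B C D s t + err3t A B C D s t| <= r + 30 * l * S.
  move=> s0 t0 st; have [s' [t' [hs ht hr]]] := h s t s0 t0 st.
  have s1 : `|s| <= 1 by rewrite ger0_norm//; lra.
  have t1 : `|t| <= 1 by rewrite ger0_norm//; lra.
  have hs1 : `|s'| <= 2.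
    have l1 : l <= 1 by (clear - ln lle; lra).
    by move: hs s1; clear - l1; rewrite !ler_norml => /andP[? ?] /andP[? ?]; apply/andP; split; lra.
  have ht1 : `|t'| <= 2.
    have l1 : l <= 1 by (clear - ln lle; lra).
    by move: ht t1; clear - l1; rewrite !ler_norml => /andP[? ?] /andP[? ?]; apply/andP; split; lra.
  have us := normM_le hs s1; have us' := normM_le hs hs1.
  have ut := normM_le hs t1; have ut' := normM_le hs ht1.
  have vs := normM_le ht s1; have vs' := normM_le ht hs1.
  have vt := normM_le ht t1; have vt' := normM_le ht ht1.
  (* The second argument is the exact increment of the function from [(s, t)] to [(s', t')], with
     [s' - s] and [t' - t] factored out. *)
  have := ler_normB (err3s A B C D s' t' + err3t A B C D s' t')
    (A * (3 * ((s' - s) * s') + 3 * ((s' - s) * s) - 3 * (s' - s)) +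
     B * (3 * (2 * ((s' - s) * t') + 2 * ((t' - t) * s) - (t' - t) / 2
       + (s' - s) * s' + (s' - s) * s - (s' - s) / 2)) +
     C * (3 * (2 * ((s' - s) * t') + 2 * ((t' - t) * s) - (s' - s) / 2
       + (t' - t) * t' + (t' - t) * t - (t' - t) / 2)) +
     D * (3 * ((t' - t) * t') + 3 * ((t' - t) * t) - 3 * (t' - t))).
  rewrite (_ : _ - _ = err3s A B C D s t + err3t A B C D s t);
    last by rewrite /err3s /err3t; field.
  move=> /le_trans; apply; apply: lerD => //.
  move: hs ht us us' ut ut' vs vs' vt vt'; clear - ln => hs ht us us' ut ut' vs vs' vt vt'.
  have l0 : 0 <= 30 * l by rewrite mulr_ge0.
  apply: wsum4_le => //.
  - by move: hs us us'; clear; rewrite !ler_norml => /andP[? ?] /andP[? ?] /andP[? ?];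
      apply/andP; split; lra.
  - move: hs ht us us' ut' vs; clear; rewrite !ler_norml => /andP[? ?] /andP[? ?] /andP[? ?].
    by move=> /andP[? ?] /andP[? ?] /andP[? ?]; apply/andP; split; lra.
  - move: hs ht vt vt' ut' vs; clear; rewrite !ler_norml => /andP[? ?] /andP[? ?] /andP[? ?].
    by move=> /andP[? ?] /andP[? ?] /andP[? ?]; apply/andP; split; lra.
  - by move: ht vt vt'; clear; rewrite !ler_norml => /andP[? ?] /andP[? ?] /andP[? ?];
      apply/andP; split; lra.
have h00 := H 0 0 (lexx _) (lexx _); have h10 := H 1 0 ler01 (lexx _).
have h01 := H 0 1 (lexx _) ler01; have hm0 := H 2^-1 0 half0 (lexx _).
have h0m := H 0 2^-1 (lexx _) half0; have hmm := H 2^-1 2^-1 half0 half0 half1.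
rewrite addr0 in h00; rewrite addr0 in h10; rewrite addr0 in hm0.
rewrite add0r in h01; rewrite add0r in h0m.
have {}h00 := h00 ler01; have {}h10 := h10 (lexx _); have {}h01 := h01 (lexx _).
have {}hm0 := hm0 half2; have {}h0m := h0m half2.
move: h00 h10 h01 hm0 h0m hmm.
rewrite /S; set x := r + _ => h00 h10 h01 hm0 h0m hmm.
have [hA hB hC hD] : [/\ `|A| <= 4 * x, `|B| <= 7 * x, `|C| <= 7 * x & `|D| <= 4 * x].
  move: h00 h10 h01 hm0 h0m hmm; move: x => x; clear; rewrite /err3s /err3t !ler_norml.
  move=> /andP[? ?] /andP[? ?] /andP[? ?] /andP[? ?] /andP[? ?] /andP[? ?].
  by split; apply/andP; split; lra.
have r0 : 0 <= r.
  have [s' [t' [_ _ hr]]] := h 0 0 (lexx _) (lexx _) ltac:(lra).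
  exact: le_trans hr.
rewrite /x -mulrA in hA hB hC hD.
have lS : 1000 * (l * (`|A| + `|B| + `|C| + `|D|)) <= `|A| + `|B| + `|C| + `|D| by rewrite mulrA ler_piMl// !addr_ge0.
move: (l * _) lS hA hB hC hD => m lS hA hB hC hD.
by split; clear - lS hA hB hC hD r0; lra.
Qed.

Lemma sqr_sum_le s t : s ^+ 2 + t ^+ 2 <= 2 * (s ^+ 2 + s * t + t ^+ 2).
Proof. by have := sqr_ge0 (s + t); lra. Qed.

Lemma quadr_le_of_coefs (A B C T s t : R) :
  A ^+ 2 <= T -> B ^+ 2 <= T -> C ^+ 2 <= T ->
  quadr A B C s t ^+ 2 <= 4 * T * (3 * (s ^+ 2 + s * t + t ^+ 2)) ^+ 2.
Proof.
move=> hA hB hC; have T0 : 0 <= T by exact: le_trans (sqr_ge0 _) hA.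
have s4 : 0 <= s ^+ 4 by rewrite exprn_even_ge0.
have t4 : 0 <= t ^+ 4 by rewrite exprn_even_ge0.
have st : 0 <= s ^+ 2 * t ^+ 2 by rewrite mulr_ge0 ?sqr_ge0.
have h1 : quadr A B C s t ^+ 2 <= 3 * (A ^+ 2 * s ^+ 4 + 4 * (B ^+ 2 * (s ^+ 2 * t ^+ 2)) + C ^+ 2 * t ^+ 4).
  rewrite /quadr.
  have -> : A ^+ 2 * s ^+ 4 + 4 * (B ^+ 2 * (s ^+ 2 * t ^+ 2)) + C ^+ 2 * t ^+ 4 =
    (A * s ^+ 2) ^+ 2 + (2 * B * s * t) ^+ 2 + (C * t ^+ 2) ^+ 2 by ring.
  move: (A * _) (2 * B * s * t) (C * _) => X Y Z; clear.
  have := sqr_ge0 (X - Y); have := sqr_ge0 (X - Z); have := sqr_ge0 (Y - Z); lra.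
have hA' := ler_wpM2r s4 hA; have hB' := ler_wpM2r st hB; have hC' := ler_wpM2r t4 hC.
have h2 : (s ^+ 2 + t ^+ 2) ^+ 2 <= (2 * (s ^+ 2 + s * t + t ^+ 2)) ^+ 2.
  have n1 : 0 <= s ^+ 2 + t ^+ 2 by rewrite addr_ge0// sqr_ge0.
  by rewrite lerXn2r// ?nnegrE ?(le_trans n1) ?sqr_sum_le.
have h3 := ler_wpM2l T0 h2.
have h4 : T * (s ^+ 2 + t ^+ 2) ^+ 2 = T * s ^+ 4 + 2 * (T * (s ^+ 2 * t ^+ 2)) + T * t ^+ 4 by ring.
have h5 := mulr_ge0 T0 s4; have h6 := mulr_ge0 T0 t4; have h7 := mulr_ge0 T0 st.
rewrite (_ : 4 * T * _ = 9 * (T * (2 * (s ^+ 2 + s * t + t ^+ 2)) ^+ 2)); last by ring.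
move: (T * (2 * _) ^+ 2) h3 => Z h3.
clear - h1 hA' hB' hC' h3 h4 h5 h6 h7; lra.
Qed.

Lemma cubic_le_of_coefs (A B C D T s t : R) :
  A ^+ 2 <= T -> B ^+ 2 <= T -> C ^+ 2 <= T -> D ^+ 2 <= T ->
  cubic A B C D s t ^+ 2 <= 4 * T * (3 * (s ^+ 2 + s * t + t ^+ 2)) ^+ 3.
Proof.
move=> hA hB hC hD; have T0 : 0 <= T by exact: le_trans (sqr_ge0 _) hA.
have s6 : 0 <= s ^+ 6 by rewrite exprn_even_ge0.
have t6 : 0 <= t ^+ 6 by rewrite exprn_even_ge0.
have st : 0 <= s ^+ 4 * t ^+ 2 by rewrite mulr_ge0// exprn_even_ge0.
have ts : 0 <= s ^+ 2 * t ^+ 4 by rewrite mulr_ge0// exprn_even_ge0.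
have h1 := cubic_sqr_le A B C D s t.
have hA' := ler_wpM2r s6 hA; have hB' := ler_wpM2r st hB.
have hC' := ler_wpM2r ts hC; have hD' := ler_wpM2r t6 hD.
have h2 : (s ^+ 2 + t ^+ 2) ^+ 3 <= (2 * (s ^+ 2 + s * t + t ^+ 2)) ^+ 3.
  have n1 : 0 <= s ^+ 2 + t ^+ 2 by rewrite addr_ge0// sqr_ge0.
  by rewrite lerXn2r// ?nnegrE ?(le_trans n1) ?sqr_sum_le.
have h3 := ler_wpM2l T0 h2.
have h4 : T * (s ^+ 2 + t ^+ 2) ^+ 3 = T * s ^+ 6 + 3 * (T * (s ^+ 4 * t ^+ 2)) +
  3 * (T * (s ^+ 2 * t ^+ 4)) + T * t ^+ 6 by ring.
have h5 := mulr_ge0 T0 s6; have h6 := mulr_ge0 T0 t6.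
have h7 := mulr_ge0 T0 st; have h8 := mulr_ge0 T0 ts.
rewrite (_ : 4 * T * _ = 27 / 2 * (T * (2 * (s ^+ 2 + s * t + t ^+ 2)) ^+ 3)); last by field.
move: (T * (2 * _) ^+ 3) h3 => Z h3.
clear - h1 hA' hB' hC' hD' h3 h4 h5 h6 h7 h8; lra.
Qed.

(* Edges of the image of an equilateral triangle of circumradius 1, one vertex of which
   lies on the axis [(p, q)], by the linear map with eigenvalues [al = 1 / sqrt mu] along
   [(p, q)] and [1 / sqrt nu] along [(- q, p)]; [ga = sqrt 3 / (2 * sqrt nu)]. *)
Definition edge1x (al ga p q : R) := - (3 / 2) * al * p - ga * q.
Definition edge1y (al ga p q : R) := - (3 / 2) * al * q + ga * p.
Definition edge2x (al ga p q : R) := - (3 / 2) * al * p + ga * q.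
Definition edge2y (al ga p q : R) := - (3 / 2) * al * q - ga * p.

Section TriOfMetric.
Variables al ga p q : R.
Hypotheses (al0 : 0 < al) (ga0 : 0 < ga) (pq : p ^+ 2 + q ^+ 2 = 1).
Let x1 := edge1x al ga p q. Let y1 := edge1y al ga p q.
Let x2 := edge2x al ga p q. Let y2 := edge2y al ga p q.

Lemma tri_det_edge : tri_det x1 y1 x2 y2 = 3 * al * ga.
Proof.
rewrite [RHS](frame_one _ 1 pq) /tri_det /x1 /y1 /x2 /y2.
by rewrite /edge1x /edge1y /edge2x /edge2y; field.
Qed.

Lemma tri_det_edge_neq0 : tri_det x1 y1 x2 y2 != 0.
Proof. by rewrite tri_det_edge gt_eqF// !mulr_gt0. Qed.

Let mu := al ^- 2.
Let nu := 3 / (4 * ga ^+ 2).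

Lemma tri_edge_eig : [/\ tri11 x1 y1 x2 y2 = eig11 mu nu p q,
  tri12 x1 y1 x2 y2 = eig12 mu nu p q & tri22 x1 y1 x2 y2 = eig22 mu nu p q].
Proof.
have a0 : al != 0 by rewrite gt_eqF.
have g0 : ga != 0 by rewrite gt_eqF.
rewrite /tri11 /tri12 /tri22 tri_det_edge /x1 /y1 /x2 /y2 /mu /nu.
rewrite /edge1x /edge1y /edge2x /edge2y /eig11 /eig12 /eig22.
by split; field; rewrite a0 g0.
Qed.

(** The two edges add up to [- 3 * al] times [(p, q)], twice the median from their common vertex, so
    that [ga] does not enter the bound. *)
Lemma edge_grad_le gx gy : ((gx * x1 + gy * y1) + (gx * x2 + gy * y2)) ^+ 2 <=
  (3 * al) ^+ 2 * (gx ^+ 2 + gy ^+ 2).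
Proof.
rewrite (_ : _ + _ = (3 * al) * - (gx * p + gy * q)); last first.
  by rewrite /x1 /y1 /x2 /y2 /edge1x /edge1y /edge2x /edge2y; field.
rewrite exprMn sqrrN ler_wpM2l ?sqr_ge0//.
rewrite (frame_one (gx ^+ 2 + gy ^+ 2) 1 pq) -subr_ge0.
rewrite (_ : _ - _ = (gx * q - gy * p) ^+ 2); last by ring.
exact: sqr_ge0.
Qed.

End TriOfMetric.
End Recovery.

(** * Bivariate polynomials in coordinates *)

Section Bivariate.
Variable R : realType.
Implicit Types p q : mpoly 2 R.

Definition mon i j : multinom 2 :=
  mnm_add (mnm_muln (mnm1 0) i) (mnm_muln (mnm1 1) j).

Lemma mon_eq i j (m : multinom 2) : (mon i j == m) = (i == m 0) && (j == m 1).
Proof.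
apply/eqP/andP => [<-|[/eqP -> /eqP ->]].
  by rewrite !mnmDE !mulmnE !mnm1E /= !mul1n !mul0n addn0 add0n !eqxx.
apply: (mnmP _ _).2 => k; rewrite mnmDE !mulmnE !mnm1E.
case: k => [[|[|//]] ki]; rewrite /= ?mul1n ?mul0n ?addn0 ?add0n; congr (m _); exact: val_inj.
Qed.

Lemma mon0 i j : mon i j 0 = i.
Proof. by have := mon_eq i j (mon i j); rewrite eqxx => /esym/andP[/eqP <-]. Qed.

Lemma mon1 i j : mon i j 1 = j.
Proof. by have := mon_eq i j (mon i j); rewrite eqxx => /esym/andP[_ /eqP <-]. Qed.

Lemma lift01 : lift ord0 ord0 = 1 :> 'I_2. Proof. exact: val_inj. Qed.

Lemma mdeg_mon i j : mdeg (mon i j) = (i + j)%N.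
Proof. by rewrite mdegE !big_ord_recl big_ord0 mon0 lift01 mon1 addn0. Qed.

(** The plain coefficient, whereas [bcoef] is divided by a binomial. *)
Definition pc p i j := mcoeff (mon i j) p.

Lemma pc_msize p k i j : (msize p <= k)%N -> (k <= i + j)%N -> pc p i j = 0.
Proof.
move=> pk kij; apply: memN_msupp_eq0; apply: msize_mdeg_ge.
by rewrite mdeg_mon (leq_trans pk).
Qed.

Lemma pc_homog p k i j : Hspace k p -> (i + j)%N != k -> pc p i j = 0.
Proof.
by rewrite /Hspace /= => hp kij; apply: (dhomog_nemf_coeff hp); rewrite /= mdeg_mon.
Qed.

Lemma msize_homog p k : Hspace k p -> (msize p <= k.+1)%N.
Proof.
rewrite /Hspace /= => /dhomogP hp; rewrite msizeE; apply/bigmax_leqP_seq => m mp _.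
by rewrite (hp _ mp).
Qed.

Lemma mpoly_expand p k : (msize p <= k)%N ->
  p = \sum_(i < k) \sum_(j < k) pc p i j *: mpolyX R (mon i j).
Proof.
move=> pk; apply/mpolyP => m; rewrite raddf_sum /=.
under eq_bigr do rewrite raddf_sum /=.
under eq_bigr do under eq_bigr do rewrite mcoeffZ mcoeffX mon_eq.
have mE : mon (m 0) (m 1) = m by apply/eqP; rewrite mon_eq !eqxx.
have [mk|km] := ltnP (mdeg m) k; last first.
  have -> : mcoeff m p = 0 by rewrite -mE; apply: (pc_msize pk); rewrite -mdeg_mon mE.
  rewrite big1// => i _; rewrite big1// => j _.
  have [/andP[/eqP im /eqP jm]|] := boolP (_ && _); last by rewrite mulr0.
  by rewrite (pc_msize pk) ?mul0r// im jm -mdeg_mon mE.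
have m01 : (m 0%R + m 1%R < k)%N by rewrite -mdeg_mon mE.
have m0k : (m 0%R < k)%N by rewrite (leq_ltn_trans _ m01)// leq_addr.
have m1k : (m 1%R < k)%N by rewrite (leq_ltn_trans _ m01)// leq_addl.
rewrite (bigD1 (Ordinal m0k))//= (bigD1 (Ordinal m1k))//= !eqxx mulr1 /pc mE.
rewrite big1 => [|j jm]; last first.
  rewrite (_ : (j == m 1 :> nat) = false) ?mulr0//.
  by apply: contra_neqF jm => /eqP jm; exact: val_inj.
rewrite addr0 big1 ?addr0// => i im; rewrite big1// => j _.
rewrite (_ : (i == m 0 :> nat) = false) ?mulr0//.
by apply: contra_neqF im => /eqP im; exact: val_inj.
Qed.

Lemma peval_mon i j z : peval (mpolyX R (mon i j)) z = z 0 0 ^+ i * z 1 0 ^+ j.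
Proof. by rewrite /peval mevalX !big_ord_recl big_ord0 mon0 lift01 mon1 mulr1. Qed.

Lemma peval_expand p k z : (msize p <= k)%N ->
  peval p z = \sum_(i < k) \sum_(j < k) pc p i j * (z 0 0 ^+ i * z 1 0 ^+ j).
Proof.
move=> pk; rewrite {1}(mpoly_expand pk) /peval raddf_sum; apply: eq_bigr => i _.
by rewrite raddf_sum; apply: eq_bigr => j _; rewrite /= mevalZ -peval_mon.
Qed.

Lemma mderiv_expand p k d : (msize p <= k)%N -> mderiv d p =
  \sum_(i < k) \sum_(j < k) pc p i j *: ((mon i j d)%:R *: mpolyX R (mnm_sub (mon i j) (mnm1 d))).
Proof.
move=> pk; rewrite {1}(mpoly_expand pk) (raddf_sum (mderiv d)); apply: eq_bigr => i _.
by rewrite (raddf_sum (mderiv d)); apply: eq_bigr => j _; rewrite /= mderivZ mderivX.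
Qed.

(** At [i = 0] the truncated exponent [i.-1] is harmless because the factor [i%:R] vanishes. *)
Lemma peval_dx p k z : (msize p <= k)%N -> peval (mderiv 0 p) z =
  \sum_(i < k) \sum_(j < k) pc p i j * (i%:R * z 0 0 ^+ i.-1 * z 1 0 ^+ j).
Proof.
move=> pk; rewrite (mderiv_expand _ pk) /peval raddf_sum; apply: eq_bigr => i _.
rewrite raddf_sum; apply: eq_bigr => j _; rewrite /= !mevalZ mon0.
congr (_ * _); rewrite -mulrA; congr (_ * _).
by rewrite mevalX !big_ord_recl big_ord0 !mnmBE mon0 lift01 mon1 !mnm1E /= subn0 subn1 mulr1.
Qed.

Lemma peval_dy p k z : (msize p <= k)%N -> peval (mderiv 1 p) z =
  \sum_(i < k) \sum_(j < k) pc p i j * (z 0 0 ^+ i * (j%:R * z 1 0 ^+ j.-1)).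
Proof.
move=> pk; rewrite (mderiv_expand _ pk) /peval raddf_sum; apply: eq_bigr => i _.
rewrite raddf_sum; apply: eq_bigr => j _; rewrite /= !mevalZ mon1.
congr (_ * _); rewrite mulrCA; congr (_ * _).
by rewrite mevalX !big_ord_recl big_ord0 !mnmBE mon0 lift01 mon1 !mnm1E /= subn0 subn1 mulr1.
Qed.

(** Constants are written with [mpolyC] and monomials as products of variables so that [ring] can
    prove identities between polynomials. *)
Lemma mpoly_expandX p k : (msize p <= k)%N ->
  p = \sum_(i < k) \sum_(j < k) mpolyC 2 (pc p i j) *
    (mpolyX R (mnm1 0) ^+ i * mpolyX R (mnm1 1) ^+ j).
Proof.
move=> pk; rewrite {1}(mpoly_expand pk); apply: eq_bigr => i _; apply: eq_bigr => j _.
by rewrite mul_mpolyC mpolyXD -!mpolyXn.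
Qed.
End Bivariate.

(** * Quadratic and cubic forms as polynomials, and their norm *)

Section Forms.
Variable R : realType.
Implicit Types p q : mpoly 2 R.

Lemma bcoefE p i j : bcoef p i j = pc p i j / 'C(i + j, i)%:R.
Proof. by []. Qed.

Lemma pc_bcoef p i j : pc p i j = bcoef p i j * 'C(i + j, i)%:R.
Proof. by rewrite bcoefE divfK// pnatr_eq0 -lt0n bin_gt0 leq_addr. Qed.

Lemma pc_bcoef3 p : ((pc p 3 0 = bcoef p 3 0) * (pc p 2 1 = (3 * bcoef p 2 1)%R) *
  (pc p 1 2 = (3 * bcoef p 1 2)%R) * (pc p 0 3 = bcoef p 0 3))%type.
Proof. by rewrite !pc_bcoef !(mulrC _ _%:R) /= (_ : 'C(3 + 0, 3) = 1%N)// !mul1r. Qed.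

Lemma pc_bcoef2 p : ((pc p 2 0 = bcoef p 2 0) * (pc p 1 1 = (2 * bcoef p 1 1)%R) *
  (pc p 0 2 = bcoef p 0 2))%type.
Proof. by rewrite !pc_bcoef !(mulrC _ _%:R) /= (_ : 'C(2 + 0, 2) = 1%N)// !mul1r. Qed.

Lemma peval_homog3 p z : Hspace 3 p ->
  [/\ peval p z = cubic (bcoef p 3 0) (bcoef p 2 1) (bcoef p 1 2) (bcoef p 0 3) (z 0 0) (z 1 0),
      peval (mderiv 0 p) z = 3 * quadr (bcoef p 3 0) (bcoef p 2 1) (bcoef p 1 2) (z 0 0) (z 1 0) &
      peval (mderiv 1 p) z = 3 * quadr (bcoef p 2 1) (bcoef p 1 2) (bcoef p 0 3) (z 0 0) (z 1 0)].
Proof.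
move=> hp; have mp := msize_homog hp.
rewrite (peval_expand z mp) (peval_dx z mp) (peval_dy z mp).
rewrite !big_ord_recl !big_ord0 /= /bump /= ?add0n ?add1n.
have e i j : (i + j != 3)%N -> pc p i j = 0 by exact: pc_homog.
rewrite (e 0 0)%N// (e 0 1)%N// (e 0 2)%N// (e 1 0)%N// (e 1 1)%N// (e 1 3)%N// (e 2 0)%N//.
rewrite (e 2 2)%N// (e 2 3)%N// (e 3 1)%N// (e 3 2)%N// (e 3 3)%N//.
rewrite !pc_bcoef3 /cubic /quadr /=.
move: (bcoef p 3 0) (bcoef p 2 1) (bcoef p 1 2) (bcoef p 0 3) (z 0 0) (z 1 0) => a b c d x y.
by split; ring.
Qed.

Lemma peval_homog2 p z : Hspace 2 p ->
  [/\ peval p z = quadr (bcoef p 2 0) (bcoef p 1 1) (bcoef p 0 2) (z 0 0) (z 1 0),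
      peval (mderiv 0 p) z = 2 * (bcoef p 2 0 * z 0 0 + bcoef p 1 1 * z 1 0) &
      peval (mderiv 1 p) z = 2 * (bcoef p 1 1 * z 0 0 + bcoef p 0 2 * z 1 0)].
Proof.
move=> hp; have mp := msize_homog hp.
rewrite (peval_expand z mp) (peval_dx z mp) (peval_dy z mp).
rewrite !big_ord_recl !big_ord0 /= /bump /= ?add0n ?add1n.
have e i j : (i + j != 2)%N -> pc p i j = 0 by exact: pc_homog.
rewrite (e 0 0)%N// (e 0 1)%N// (e 1 0)%N// (e 1 2)%N// (e 2 1)%N// (e 2 2)%N//.
rewrite !pc_bcoef2 /quadr /=.
move: (bcoef p 2 0) (bcoef p 1 1) (bcoef p 0 2) (z 0 0) (z 1 0) => a b c x y.
by split; ring.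
Qed.

Lemma peval_deg2 q : (msize q <= 3)%N -> exists k, forall z,
  [/\ peval q z = poly2 k (z 0 0) (z 1 0),
      peval (mderiv 0 q) z = poly2x k (z 0 0) (z 1 0) &
      peval (mderiv 1 q) z = poly2y k (z 0 0) (z 1 0)].
Proof.
move=> mq; exists (pc q 0 0, pc q 1 0, pc q 0 1, pc q 2 0, pc q 1 1, pc q 0 2) => z.
rewrite (peval_expand z mq) (peval_dx z mq) (peval_dy z mq).
rewrite !big_ord_recl !big_ord0 /= /bump /= ?add0n ?add1n.
have e i j : (3 <= i + j)%N -> pc q i j = 0 by exact: pc_msize.
rewrite (e 1 2)%N// (e 2 1)%N// (e 2 2)%N//.
rewrite /poly2 /poly2x /poly2y.
move: (pc q 0 0) (pc q 1 0) (pc q 0 1) (pc q 2 0) (pc q 1 1) (pc q 0 2) (z 0 0) (z 1 0).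
move=> k0 k1 k2 k3 k4 k5 x y.
by split; ring.
Qed.

Lemma peval_deg1 q : (msize q <= 2)%N -> exists k0 k1 k2, forall z,
  [/\ peval q z = k0 + k1 * z 0 0 + k2 * z 1 0,
      peval (mderiv 0 q) z = k1 & peval (mderiv 1 q) z = k2].
Proof.
move=> mq; exists (pc q 0 0), (pc q 1 0), (pc q 0 1) => z.
rewrite (peval_expand z mq) (peval_dx z mq) (peval_dy z mq).
rewrite !big_ord_recl !big_ord0 /= /bump /= ?add0n ?add1n.
have e i j : (2 <= i + j)%N -> pc q i j = 0 by exact: pc_msize.
rewrite (e 1 1)%N//.
move: (pc q 0 0) (pc q 1 0) (pc q 0 1) (z 0 0) (z 1 0) => k0 k1 k2 x y.
by split; ring.
Qed.

Lemma nonunivariate3 p : Hspace 3 p -> ~ univariate 3 p -> forall l u v,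
  ~ [/\ bcoef p 3 0 = l * u ^+ 3, bcoef p 2 1 = l * u ^+ 2 * v,
        bcoef p 1 2 = l * u * v ^+ 2 & bcoef p 0 3 = l * v ^+ 3].
Proof.
move=> hp + l u v [h30 h21 h12 h03]; apply; exists l, u, v.
rewrite [LHS](mpoly_expandX (msize_homog hp)).
rewrite !big_ord_recl !big_ord0 /= /bump /= ?add0n ?add1n.
have e i j : (i + j != 3)%N -> pc p i j = 0 by exact: pc_homog.
rewrite (e 0 0)%N// (e 0 1)%N// (e 0 2)%N// (e 1 0)%N// (e 1 1)%N// (e 1 3)%N// (e 2 0)%N//.
rewrite (e 2 2)%N// (e 2 3)%N// (e 3 1)%N// (e 3 2)%N// (e 3 3)%N//.
rewrite !pc_bcoef3 h30 h21 h12 h03 -!mul_mpolyC.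
move: (mpolyX R (mnm1 0)) (mpolyX R (mnm1 1)) => X Y.
ring.
Qed.

Lemma nonunivariate2 p : Hspace 2 p -> ~ univariate 2 p -> forall l u v,
  ~ [/\ bcoef p 2 0 = l * u ^+ 2, bcoef p 1 1 = l * u * v & bcoef p 0 2 = l * v ^+ 2].
Proof.
move=> hp + l u v [h20 h11 h02]; apply; exists l, u, v.
rewrite [LHS](mpoly_expandX (msize_homog hp)).
rewrite !big_ord_recl !big_ord0 /= /bump /= ?add0n ?add1n.
have e i j : (i + j != 2)%N -> pc p i j = 0 by exact: pc_homog.
rewrite (e 0 0)%N// (e 0 1)%N// (e 1 0)%N// (e 1 2)%N// (e 2 1)%N// (e 2 2)%N//.
rewrite !pc_bcoef2 h20 h11 h02 -!mul_mpolyC.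
move: (mpolyX R (mnm1 0)) (mpolyX R (mnm1 1)) => X Y.
ring.
Qed.

Lemma bcoef_mderiv0 p i j : bcoef (mderiv 0 p) i j = pc p i.+1 j * i.+1%:R / 'C(i + j, i)%:R.
Proof.
rewrite bcoefE /pc mcoeff_deriv mon0 mulr_natr (_ : mnm_add _ _ = mon i.+1 j)//.
apply/esym/eqP; rewrite mon_eq !(mnmDE _ (mon i j)) mon0 mon1 !mnm1E /=.
by rewrite addn1 addn0 !eqxx.
Qed.

Lemma bcoef_mderiv1 p i j : bcoef (mderiv 1 p) i j = pc p i j.+1 * j.+1%:R / 'C(i + j, i)%:R.
Proof.
rewrite bcoefE /pc mcoeff_deriv mon1 mulr_natr (_ : mnm_add _ _ = mon i j.+1)//.
apply/esym/eqP; rewrite mon_eq !(mnmDE _ (mon i j)) mon0 mon1 !mnm1E /=.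
by rewrite addn1 addn0 !eqxx.
Qed.

Lemma bcoef_grad3 p :
  [/\ bcoef (mderiv 0 p) 2 0 = 3 * bcoef p 3 0, bcoef (mderiv 0 p) 1 1 = 3 * bcoef p 2 1 &
      bcoef (mderiv 0 p) 0 2 = 3 * bcoef p 1 2] /\
  [/\ bcoef (mderiv 1 p) 2 0 = 3 * bcoef p 2 1, bcoef (mderiv 1 p) 1 1 = 3 * bcoef p 1 2 &
      bcoef (mderiv 1 p) 0 2 = 3 * bcoef p 0 3].
Proof.
rewrite !bcoef_mderiv0 !bcoef_mderiv1 !pc_bcoef3.
rewrite (_ : 'C(2 + 0, 2) = 1%N)// (_ : 'C(1 + 1, 1) = 2%N)// (_ : 'C(0 + 2, 0) = 1%N)//.
by split; split; rewrite ?(mul1r, mulr1); field.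
Qed.

(** The bound [B] makes [sup] a genuine least upper bound; the set is nonempty because the disc
    contains 0. *)
Lemma pnorm_disc_sup p (f : R -> R -> R) (B : R) :
  (forall z, peval p z = f (z 0 0) (z 1 0)) ->
  (forall x y, x ^+ 2 + y ^+ 2 <= 1 -> `|f x y| <= B) -> disc_sup f (pnorm p).
Proof.
move=> pf hB.
have enormE (u : 'cV[R]_2) : (enorm u <= 1) = (u 0 0 ^+ 2 + u 1 0 ^+ 2 <= 1).
  rewrite /enorm !big_ord_recl big_ord0 lift01 addr0.
  by rewrite -[X in _ <= X]sqrtr1 ler_sqrt.
have hub : ubound [set `|peval p u| | u in [set u | enorm u <= 1]] B.
  by move=> _ [u /= + <-]; rewrite enormE pf; exact: hB.
split=> [x y xy|C hC].
- apply: ub_le_sup; first by exists B.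
  exists (\col_i if i == 0 then x else y); first by rewrite /= enormE !mxE.
  by rewrite pf !mxE.
- apply: sup_le_ub.
    by exists `|peval p 0|, 0 => //=; rewrite enormE !mxE expr0n addr0 ler01.
  by move=> _ [u /= + <-]; rewrite enormE pf; exact: hC.
Qed.

Lemma pnorm3 p : Hspace 3 p ->
  disc_sup (cubic (bcoef p 3 0) (bcoef p 2 1) (bcoef p 1 2) (bcoef p 0 3)) (pnorm p).
Proof.
move=> hp; apply: pnorm_disc_sup => [z|x y]; first by have [] := peval_homog3 z hp.
exact: cubic_le.
Qed.

Lemma quadr_le (a b c x y : R) : x ^+ 2 + y ^+ 2 <= 1 ->
  `|quadr a b c x y| <= `|a| + 2 * `|b| + `|c|.
Proof.
move=> xy.
have hx : `|x| <= 1 by apply: norm_le_sqr => //; nra.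
have hy : `|y| <= 1 by apply: norm_le_sqr => //; nra.
have hxx := normM_le (lexx `|a|) (normM_le hx hx).
have hxy := normM_le (lexx `|b|) (normM_le hx hy).
have hyy := normM_le (lexx `|c|) (normM_le hy hy).
rewrite !mulr1 in hxx hxy hyy.
rewrite (_ : quadr _ _ _ _ _ = a * (x * x) + (b * (x * y) + b * (x * y)) + c * (y * y));
  last by rewrite /quadr; ring.
apply: (le_trans (ler_normD _ _)); apply: lerD => //.
apply: (le_trans (ler_normD _ _)); apply: lerD => //.
by rewrite mulr_natl mulr2n; apply: (le_trans (ler_normD _ _)); apply: lerD.
Qed.

Lemma pnorm2 p : Hspace 2 p ->
  disc_sup (quadr (bcoef p 2 0) (bcoef p 1 1) (bcoef p 0 2)) (pnorm p).
Proof.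
move=> hp; apply: pnorm_disc_sup => [z|x y]; first by have [] := peval_homog2 z hp.
exact: quadr_le.
Qed.

End Forms.

(** * Triangles and Lagrange interpolation *)

Section Coordinates.
Variable R : realType.
Implicit Types T : triangle R.

Lemma ord2P (i : 'I_2) : i = 0 \/ i = 1.
Proof. by case: i => [[|[|//]] ki]; [left|right]; exact: val_inj. Qed.

Lemma ord3P (i : 'I_3) : [\/ i = 0, i = 1 | i = 2%:R].
Proof.
by case: i => [[|[|[|//]]] ki]; [apply: Or31|apply: Or32|apply: Or33]; exact: val_inj.
Qed.

Lemma sum_ord2 (V : nmodType) (F : 'I_2 -> V) : \sum_i F i = F 0 + F 1.
Proof. by rewrite !big_ord_recl big_ord0 lift01 addr0. Qed.

Lemma sum_ord3 (V : nmodType) (F : 'I_3 -> V) : \sum_i F i = F 0 + F 1 + F 2%:R.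
Proof.
have h2 : lift ord0 (lift ord0 ord0) = 2%:R :> 'I_3 by exact: val_inj.
have h1 : lift ord0 ord0 = 1 :> 'I_3 by exact: val_inj.
by rewrite !big_ord_recl big_ord0 addr0 addrA h2 h1.
Qed.

Lemma mx2P (A B : 'M[R]_2) :
  A 0 0 = B 0 0 -> A 0 1 = B 0 1 -> A 1 0 = B 1 0 -> A 1 1 = B 1 1 -> A = B.
Proof.
by move=> h00 h01 h10 h11; apply/matrixP => i j; case: (ord2P i) => ->; case: (ord2P j) => ->.
Qed.

Lemma cv2P (u v : 'cV[R]_2) : u 0 0 = v 0 0 -> u 1 0 = v 1 0 -> u = v.
Proof. by move=> h0 h1; apply/matrixP => i j; rewrite ord1; case: (ord2P i) => ->. Qed.

Lemma det2 (A : 'M[R]_2) : \det A = A 0 0 * A 1 1 - A 0 1 * A 1 0.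
Proof.
rewrite (expand_det_row _ 0) sum_ord2 /cofactor !det_mx11 !mxE /=.
rewrite expr0 mul1r expr1 mulN1r mulrN.
by congr (_ * A _ _ - _ * A _ _); exact: val_inj.
Qed.

Definition sym2 (a b c : R) : 'M[R]_2 :=
  \matrix_(i, j) if (i == 0) && (j == 0) then a else if (i == 1) && (j == 1) then c else b.

Lemma sym2E a b c : (sym2 a b c 0 0 = a) * (sym2 a b c 0 1 = b) *
  (sym2 a b c 1 0 = b) * (sym2 a b c 1 1 = c).
Proof. by rewrite !mxE. Qed.

Lemma sym2_quadr a b c (u : 'cV[R]_2) :
  (u^T *m sym2 a b c *m u) 0 0 = quadr a b c (u 0 0) (u 1 0).
Proof.
rewrite mxE sum_ord2 !mxE !sum_ord2 !sym2E !mxE /quadr; ring.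
Qed.

Lemma sym2_tr (M : 'M[R]_2) : M^T = M -> M = sym2 (M 0 0) (M 0 1) (M 1 1).
Proof.
move=> MT; apply: mx2P; rewrite !sym2E//.
by rewrite -[in LHS]MT mxE.
Qed.

Definition tx0 T := T 0 0 0. Definition ty0 T := T 0 1 0.
Definition tx1 T := T 1 0 0 - T 0 0 0. Definition ty1 T := T 1 1 0 - T 0 1 0.
Definition tx2 T := T 2%:R 0 0 - T 0 0 0. Definition ty2 T := T 2%:R 1 0 - T 0 1 0.
Definition tdet T := tri_det (tx1 T) (ty1 T) (tx2 T) (ty2 T).
Definition tpt T s t : 'cV[R]_2 :=
  pt (tx0 T + tx1 T * s + tx2 T * t, ty0 T + ty1 T * s + ty2 T * t).

Lemma row_mx_det2 (u v : 'cV[R]_2) :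
  \det (row_mx u v : 'M[R]_(1 + 1)) = tri_det (u 0 0) (u 1 0) (v 0 0) (v 1 0).
Proof.
rewrite (det2 (row_mx u v)) /tri_det.
have c0 i : row_mx u v i (0 : 'I_2) = u i 0.
  by rewrite -(row_mxEl u v i 0); congr (row_mx u v i _); exact: val_inj.
have c1 i : row_mx u v i (1 : 'I_2) = v i 0.
  by rewrite -(row_mxEr u v i 0); congr (row_mx u v i _); exact: val_inj.
by rewrite !c0 !c1; ring.
Qed.

Lemma tdet_neq0 T : tdet T != 0.
Proof.
have := triangle_nondegenerate T; rewrite row_mx_det2.
by rewrite !mxE.
Qed.

Lemma hullP T z : hull T z <-> exists s t, [/\ 0 <= s, 0 <= t, s + t <= 1 & z = tpt T s t].
Proof.
split=> [[l [l0 l1 ->]]|[s [t [s0 t0 st ->]]]].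
- rewrite sum_ord3 in l1; exists (l 1), (l 2%:R); split=> //.
    by rewrite -l1 -addrA lerDr.
  have l0E : l 0 = 1 - l 1 - l 2%:R by rewrite -l1; ring.
  rewrite sum_ord3; apply: cv2P; rewrite !mxE/= /tx0 /tx1 /tx2 /ty0 /ty1 /ty2 l0E; ring.
- exists (fun i => if i == 0 then 1 - s - t else if i == 1 then s else t).
  split; first by move=> i; case: (ord3P i) => -> //=; lra.
    by rewrite sum_ord3 /=; ring.
  by rewrite sum_ord3; apply: cv2P; rewrite !mxE/= /tx0 /tx1 /tx2 /ty0 /ty1 /ty2; ring.
Qed.

(** [ts] and [tu] are the barycentric coordinates at vertices 1 and 2, obtained by Cramer's rule. *)
Definition ts T (x : R * R) := ((x.1 - tx0 T) * ty2 T - (x.2 - ty0 T) * tx2 T) / tdet T.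
Definition tu T (x : R * R) := ((x.2 - ty0 T) * tx1 T - (x.1 - tx0 T) * ty1 T) / tdet T.

Lemma tpt_tstu T x : tpt T (ts T x) (tu T x) = pt x.
Proof.
have D0 := tdet_neq0 T.
rewrite /tpt /ts /tu; apply: cv2P; rewrite !mxE /=.
  by move: D0; rewrite /tdet /tri_det => D0; field.
by move: D0; rewrite /tdet /tri_det => D0; field.
Qed.

Lemma tstu_tpt T s t x : pt x = tpt T s t -> ts T x = s /\ tu T x = t.
Proof.
move=> e; have D0 := tdet_neq0 T.
have e1 : x.1 = tx0 T + tx1 T * s + tx2 T * t by have := congr1 (fun z : 'cV_2 => z 0 0) e; rewrite !mxE.
have e2 : x.2 = ty0 T + ty1 T * s + ty2 T * t by have := congr1 (fun z : 'cV_2 => z 1 0) e; rewrite !mxE.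
rewrite /ts /tu e1 e2; move: D0; rewrite /tdet /tri_det => D0.
by split; field.
Qed.

Lemma hull_preimage T :
  @pt R @^-1` hull T = [set x | [/\ 0 <= ts T x, 0 <= tu T x & ts T x + tu T x <= 1]].
Proof.
apply/seteqP; split=> x /=.
  by move=> /hullP[s [t [s0 t0 st e]]]; have [-> ->] := tstu_tpt e.
move=> [s0 t0 st]; apply/hullP; exists (ts T x), (tu T x).
by split=> //; rewrite tpt_tstu.
Qed.

(** It suffices to check that the claimed matrix is a right inverse of the one under [invmx]; seen
    from vertex 0, the barycenter is a third of the sum of the two edges, so only the edges
    matter. *)
Lemma HT_sym2 T : HT T = sym2 (tri11 (tx1 T) (ty1 T) (tx2 T) (ty2 T))
  (tri12 (tx1 T) (ty1 T) (tx2 T) (ty2 T)) (tri22 (tx1 T) (ty1 T) (tx2 T) (ty2 T)).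
Proof.
have D0 := tdet_neq0 T; rewrite /HT; set N := _ *: _; set M := sym2 _ _ _.
have NM : N *m M = 1%:M.
  have z0 : barycenter T 0 0 = tx0 T + (tx1 T + tx2 T) / 3.
    by rewrite /barycenter mxE sum_ord3 !mxE /tx0 /tx1 /tx2; field.
  have z1 : barycenter T 1 0 = ty0 T + (ty1 T + ty2 T) / 3.
    by rewrite /barycenter mxE sum_ord3 !mxE /ty0 /ty1 /ty2; field.
  have t00 : T 0 0 0 = tx0 T by [].
  have t01 : T 0 1 0 = ty0 T by [].
  have t10 : T 1 0 0 = tx0 T + tx1 T by rewrite /tx0 /tx1; ring.
  have t11 : T 1 1 0 = ty0 T + ty1 T by rewrite /ty0 /ty1; ring.
  have t20 : T 2%:R 0 0 = tx0 T + tx2 T by rewrite /tx0 /tx2; ring.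
  have t21 : T 2%:R 1 0 = ty0 T + ty2 T by rewrite /ty0 /ty2; ring.
  have NE i j : N i j = 2 / 3 * (
      (T 0 i 0 - barycenter T i 0) * (T 0 j 0 - barycenter T j 0) +
      (T 1 i 0 - barycenter T i 0) * (T 1 j 0 - barycenter T j 0) +
      (T 2%:R i 0 - barycenter T i 0) * (T 2%:R j 0 - barycenter T j 0)).
    rewrite /N mxE sum_ord3; congr (_ * _).
    by rewrite !mxE !big_ord1 !mxE.
  move: D0; rewrite /tdet /tri_det => D0.
  apply: mx2P; rewrite [LHS]mxE [RHS]mxE sum_ord2 !NE !sym2E /= ?z0 ?z1 ?t00 ?t01 ?t10 ?t11 ?t20 ?t21
    /tri11 /tri12 /tri22 /tri_det ?mulr1n ?mulr0n; by field.
have [Nu _] := mulmx1_unit NM.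
by rewrite -[LHS]mulmx1 -NM mulmxA mulVmx// mul1mx.
Qed.

End Coordinates.

(** * Existence of Lagrange interpolants and the gradient of their error *)

Section Interpolation.
Variable R : realType.
Implicit Types (T : triangle R) (p q : mpoly 2 R).

Definition affp (c a b : R) : mpoly 2 R :=
  mpolyC 2 c + (a *: mpolyX R (mnm1 0) + b *: mpolyX R (mnm1 1)).

Lemma peval_affp c a b z : peval (affp c a b) z = c + a * z 0 0 + b * z 1 0.
Proof. by rewrite /peval !mevalD mevalC !mevalZ !mevalXU addrA. Qed.

Lemma msize_affp c a b : (msize (affp c a b) <= 2)%N.
Proof.
rewrite (leq_trans (msizeD_le _ _))// geq_max; apply/andP; split.
  by rewrite msizeC; case: (c != 0).
rewrite (leq_trans (msizeD_le _ _))// geq_max; apply/andP; split;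
by rewrite (leq_trans (msizeZ_le _ _))// msizeX mdeg1.
Qed.

Lemma peval_is_rmorph z : (forall p q, peval (p + q) z = peval p z + peval q z) *
  (forall p q, peval (p * q) z = peval p z * peval q z) *
  (forall p, peval (- p) z = - peval p z) *
  (forall c p, peval (c *: p) z = c * peval p z).
Proof.
split; [split; [split|]|] => *.
- exact: mevalD.
- exact: mevalM.
- exact: mevalN.
- exact: mevalZ.
Qed.

Lemma barycentric_mpoly T : exists L0 L1 L2 : mpoly 2 R,
  [/\ (msize L0 <= 2)%N, (msize L1 <= 2)%N & (msize L2 <= 2)%N] /\
  forall s t, [/\ peval L0 (tpt T s t) = 1 - s - t,
    peval L1 (tpt T s t) = s & peval L2 (tpt T s t) = t].
Proof.
exists (affp (1 + (tx0 T * ty2 T - ty0 T * tx2 T) / tdet T - (tx0 T * ty1 T - ty0 T * tx1 T) / tdet T)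
  ((ty1 T - ty2 T) / tdet T) ((tx2 T - tx1 T) / tdet T)).
exists (affp (- (tx0 T * ty2 T - ty0 T * tx2 T) / tdet T) (ty2 T / tdet T) (- tx2 T / tdet T)).
exists (affp ((tx0 T * ty1 T - ty0 T * tx1 T) / tdet T) (- ty1 T / tdet T) (tx1 T / tdet T)).
split; first by split; exact: msize_affp.
move=> s t; have := tdet_neq0 T; rewrite !peval_affp !mxE /= /tdet /tri_det => D0.
by split; field.
Qed.

Lemma vertex_tpt T : [/\ T 0 = tpt T 0 0, T 1 = tpt T 1 0 & T 2%:R = tpt T 0 1].
Proof. by split; apply: cv2P; rewrite !mxE /= /tx0 /tx1 /tx2 /ty0 /ty1 /ty2; ring. Qed.

Lemma midpoint_tpt T : [/\ 2^-1 *: (T 0 + T 1) = tpt T 2^-1 0,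
  2^-1 *: (T 0 + T 2%:R) = tpt T 0 2^-1 & 2^-1 *: (T 1 + T 2%:R) = tpt T 2^-1 2^-1].
Proof. by split; apply: cv2P; rewrite !mxE /= /tx0 /tx1 /tx2 /ty0 /ty1 /ty2; field. Qed.

Lemma msizeD_leq p q k : (msize p <= k)%N -> (msize q <= k)%N -> (msize (p + q) <= k)%N.
Proof. by move=> pk qk; rewrite (leq_trans (msizeD_le _ _))// geq_max pk. Qed.

Lemma msizeZ_leq c p k : (msize p <= k)%N -> (msize (c *: p) <= k)%N.
Proof. exact/leq_trans/msizeZ_le. Qed.

Lemma msizeM_deg1 p q : (msize p <= 2)%N -> (msize q <= 2)%N -> (msize (p * q) <= 3)%N.
Proof.
move=> h1 h2.
have [->|n1] := eqVneq p 0; first by rewrite mul0r msize0.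
have [->|n2] := eqVneq q 0; first by rewrite mulr0 msize0.
by rewrite msizeM//; move: (leq_add h1 h2); case: (_ + _)%N.
Qed.

(** [interp] is a choice with default 0, so its properties follow once one interpolant is exhibited,
    here in the basis of barycentric coordinates. *)
Lemma interp2_spec T f : Pspace 2 (interp 2 T f) /\
  forall z, lagrange_points 2 T z -> peval (interp 2 T f) z = f z.
Proof.
apply: (@xgetPex _ 0 [set p | Pspace 2 p /\
  forall z, lagrange_points 2 T z -> peval p z = f z]).
have [L0 [L1 [L2 [[m0 m1 m2] LE]]]] := barycentric_mpoly T.
exists (f (T 0) *: L0 + f (T 1) *: L1 + f (T 2%:R) *: L2); split.
  by apply: msizeD_leq; [apply: msizeD_leq|]; exact: msizeZ_leq.
have [v0 v1 v2] := vertex_tpt T.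
move=> z [[i _ <-]|[//]]; rewrite !peval_is_rmorph.
have [b00 b01 b02] := LE 0 0.
have [b10 b11 b12] := LE 1 0.
have [b20 b21 b22] := LE 0 1.
by case: (ord3P i) => ->; rewrite v0 v1 v2 ?b00 ?b01 ?b02 ?b10 ?b11 ?b12 ?b20 ?b21 ?b22; ring.
Qed.

(** The quadratic Lagrange basis consists of [L * (2 L - 1)] for a vertex and [4 L L'] for the
    midpoint of an edge, with [L] and [L'] barycentric coordinates. *)
Lemma interp3_spec T f : Pspace 3 (interp 3 T f) /\
  forall z, lagrange_points 3 T z -> peval (interp 3 T f) z = f z.
Proof.
apply: (@xgetPex _ 0 [set p | Pspace 3 p /\
  forall z, lagrange_points 3 T z -> peval p z = f z]).
have [L0 [L1 [L2 [[m0 m1 m2] LE]]]] := barycentric_mpoly T.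
pose m01 : 'cV[R]_2 := 2^-1 *: (T 0 + T 1).
pose m02 : 'cV[R]_2 := 2^-1 *: (T 0 + T 2%:R).
pose m12 : 'cV[R]_2 := 2^-1 *: (T 1 + T 2%:R).
exists (f (T 0) *: (2 *: (L0 * L0) - L0) + f (T 1) *: (2 *: (L1 * L1) - L1) +
  f (T 2%:R) *: (2 *: (L2 * L2) - L2) + (4 * f m01) *: (L0 * L1) +
  (4 * f m02) *: (L0 * L2) + (4 * f m12) *: (L1 * L2)); split.
  have mL (L : mpoly 2 R) : (msize L <= 2)%N -> (msize (2 *: (L * L) - L) <= 3)%N.
    move=> L2'; apply: (@msizeD_leq (2 *: (L * L)) (- L)); first by apply: msizeZ_leq; exact: msizeM_deg1.
    by rewrite msizeN; apply: leq_trans L2' _.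
  have q0 := mL _ m0; have q1 := mL _ m1; have q2 := mL _ m2.
  have r0 := msizeM_deg1 m0 m1; have r1 := msizeM_deg1 m0 m2; have r2 := msizeM_deg1 m1 m2.
  by repeat apply: msizeD_leq; apply: msizeZ_leq.
have [v0 v1 v2] := vertex_tpt T.
have [w01 w02 w12] := midpoint_tpt T.
have [b00 b01 b02] := LE 0 0.
have [b10 b11 b12] := LE 1 0.
have [b20 b21 b22] := LE 0 1.
have [b30 b31 b32] := LE 2^-1 0.
have [b40 b41 b42] := LE 0 2^-1.
have [b50 b51 b52] := LE 2^-1 2^-1.
suff H z : [\/ z = T 0, z = T 1 | z = T 2%:R] \/ [\/ z = m01, z = m02 | z = m12] ->
    peval (f (T 0) *: (2 *: (L0 * L0) - L0) + f (T 1) *: (2 *: (L1 * L1) - L1) +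
  f (T 2%:R) *: (2 *: (L2 * L2) - L2) + (4 * f m01) *: (L0 * L1) +
  (4 * f m02) *: (L0 * L2) + (4 * f m12) *: (L1 * L2)) z = f z.
  move=> z zP; apply: H; case: zP => [[i _ <-]|[_ [i [j [ij ->]]]]].
    by left; case: (ord3P i) => ->; [apply: Or31|apply: Or32|apply: Or33].
  right; move: ij; case: (ord3P i) => ->; case: (ord3P j) => -> // _;
  do ?[by apply: Or31; rewrite // addrC | by apply: Or32; rewrite // addrC | by apply: Or33; rewrite // addrC].
move=> [[] ->|[] ->]; rewrite !peval_is_rmorph /m01 /m02 /m12 w01 w02 w12 v0 v1 v2.
- by rewrite b00 b01 b02; ring.
- by rewrite b10 b11 b12; ring.
- by rewrite b20 b21 b22; ring.
- by rewrite b30 b31 b32; field.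
- by rewrite b40 b41 b42; field.
- by rewrite b50 b51 b52; field.
Qed.

Lemma interp2_error_grad T p s t : Hspace 2 p ->
  let a := bcoef p 2 0 in let b := bcoef p 1 1 in let c := bcoef p 0 2 in
  let A := quadr a b c (tx1 T) (ty1 T) in
  let B := polar2 a b c (tx1 T) (ty1 T) (tx2 T) (ty2 T) in
  let C := quadr a b c (tx2 T) (ty2 T) in
  exists gx gy, [/\ grad_sq (p - interp 2 T (peval p)) (tpt T s t) = gx ^+ 2 + gy ^+ 2,
    gx * tx1 T + gy * ty1 T = err2s A B C s t & gx * tx2 T + gy * ty2 T = err2t A B C s t].
Proof.
move=> hp a b c A B C; have [mq qE] := interp2_spec T (peval p).
set q := interp 2 T (peval p) in mq qE *.
have [k0 [k1 [k2 kP]]] := peval_deg1 mq.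
have node s' t' : lagrange_points 2 T (tpt T s' t') ->
    quadr a b c (tx0 T + tx1 T * s' + tx2 T * t') (ty0 T + ty1 T * s' + ty2 T * t') -
    (k0 + k1 * (tx0 T + tx1 T * s' + tx2 T * t') + k2 * (ty0 T + ty1 T * s' + ty2 T * t')) = 0.
  move=> /qE; have [-> _ _] := kP (tpt T s' t').
  have [-> _ _] := peval_homog2 (tpt T s' t') hp; rewrite !mxE /= => ->.
  by rewrite subrr.
have [v0 v1 v2] := vertex_tpt T.
have n0 := node 0 0; have n1 := node 1 0; have n2 := node 0 1.
rewrite -v0 in n0; rewrite -v1 in n1; rewrite -v2 in n2.
have {}n0 := n0 (or_introl (ex_intro2 _ _ 0 I erefl)).
have {}n1 := n1 (or_introl (ex_intro2 _ _ 1 I erefl)).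
have {}n2 := n2 (or_introl (ex_intro2 _ _ 2%:R I erefl)).
rewrite !(mulr0,mulr1,addr0) in n0 n1 n2.
have [e1 e2] := interp_err2 s t n0 n1 n2.
exists (2 * (a * (tpt T s t) 0 0 + b * (tpt T s t) 1 0) - k1),
  (2 * (b * (tpt T s t) 0 0 + c * (tpt T s t) 1 0) - k2); split.
- rewrite /grad_sq sum_ord2 !mderivB !peval_is_rmorph.
  have [_ -> ->] := peval_homog2 (tpt T s t) hp.
  by have [_ -> ->] := kP (tpt T s t).
- by rewrite !mxE /= -e1.
- by rewrite !mxE /= -e2.
Qed.

Lemma interp3_error_grad T p s t : Hspace 3 p ->
  let a := bcoef p 3 0 in let b := bcoef p 2 1 in
  let c := bcoef p 1 2 in let d := bcoef p 0 3 in
  let A := polar3 a b c d (tx1 T) (ty1 T) (tx1 T) (ty1 T) (tx1 T) (ty1 T) in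
  let B := polar3 a b c d (tx1 T) (ty1 T) (tx1 T) (ty1 T) (tx2 T) (ty2 T) in
  let C := polar3 a b c d (tx1 T) (ty1 T) (tx2 T) (ty2 T) (tx2 T) (ty2 T) in
  let D := polar3 a b c d (tx2 T) (ty2 T) (tx2 T) (ty2 T) (tx2 T) (ty2 T) in
  exists gx gy, [/\ grad_sq (p - interp 3 T (peval p)) (tpt T s t) = gx ^+ 2 + gy ^+ 2,
    gx * tx1 T + gy * ty1 T = err3s A B C D s t & gx * tx2 T + gy * ty2 T = err3t A B C D s t].
Proof.
move=> hp a b c d A B C D; have [mq qE] := interp3_spec T (peval p).
set q := interp 3 T (peval p) in mq qE *.
have [k kP] := peval_deg2 mq.
have node s' t' : lagrange_points 3 T (tpt T s' t') ->
    cubic a b c d (tx0 T + tx1 T * s' + tx2 T * t') (ty0 T + ty1 T * s' + ty2 T * t') -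
    poly2 k (tx0 T + tx1 T * s' + tx2 T * t') (ty0 T + ty1 T * s' + ty2 T * t') = 0.
  move=> /qE; have [-> _ _] := kP (tpt T s' t').
  have [-> _ _] := peval_homog3 (tpt T s' t') hp; rewrite !mxE /= => ->.
  by rewrite subrr.
have [v0 v1 v2] := vertex_tpt T.
have [w01 w02 w12] := midpoint_tpt T.
have n0 := node 0 0; have n1 := node 1 0; have n2 := node 0 1.
have n3 := node 2^-1 0; have n4 := node 0 2^-1; have n5 := node 2^-1 2^-1.
rewrite -v0 in n0; rewrite -v1 in n1; rewrite -v2 in n2.
rewrite -w01 in n3; rewrite -w02 in n4; rewrite -w12 in n5.
have {}n0 := n0 (or_introl (ex_intro2 _ _ 0 I erefl)).
have {}n1 := n1 (or_introl (ex_intro2 _ _ 1 I erefl)).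
have {}n2 := n2 (or_introl (ex_intro2 _ _ 2%:R I erefl)).
have {}n3 := n3 (or_intror (conj erefl (ex_intro _ 0 (ex_intro _ 1 (conj isT erefl))))).
have {}n4 := n4 (or_intror (conj erefl (ex_intro _ 0 (ex_intro _ 2%:R (conj isT erefl))))).
have {}n5 := n5 (or_intror (conj erefl (ex_intro _ 1 (ex_intro _ 2%:R (conj isT erefl))))).
have hx : tx0 T + tx1 T * 2^-1 + tx2 T * 2^-1 = tx0 T + (tx1 T + tx2 T) / 2 by field.
have hy : ty0 T + ty1 T * 2^-1 + ty2 T * 2^-1 = ty0 T + (ty1 T + ty2 T) / 2 by field.
rewrite hx hy in n5.
rewrite !(mulr0,mulr1,addr0) in n0 n1 n2 n3 n4.
have [e1 e2] := interp_err3 s t n0 n1 n2 n3 n4 n5.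
exists (3 * quadr a b c ((tpt T s t) 0 0) ((tpt T s t) 1 0) - poly2x k ((tpt T s t) 0 0) ((tpt T s t) 1 0)),
  (3 * quadr b c d ((tpt T s t) 0 0) ((tpt T s t) 1 0) - poly2y k ((tpt T s t) 0 0) ((tpt T s t) 1 0)); split.
- rewrite /grad_sq sum_ord2 !mderivB !peval_is_rmorph.
  have [_ -> ->] := peval_homog3 (tpt T s t) hp.
  by have [_ -> ->] := kP (tpt T s t).
- by rewrite !mxE /= -e1.
- by rewrite !mxE /= -e2.
Qed.

End Interpolation.

(** * Averages over a triangle *)

(** Lebesgue measure is determined by its values on half-open intervals, and the pushforward scaled
    by [k] has the same values there. *)
Lemma lebesgue_measure_affine (R : realType) (c k : R) (A : set R) :
  0 < k -> measurable A ->
  (lebesgue_measure A = k%:E * lebesgue_measure ((fun y => c + k * y)%R @^-1` A))%E.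
Proof.
move=> k0 mA.
have mf : measurable_fun setT (fun y : measurableTypeR R => c + k * y : measurableTypeR R).
  by apply: measurable_funD => //; exact: measurable_funM.
pose push := measure_function_pushforward__canonical__measure_function_Measure
  (@lebesgue_measure R) mf.
rewrite (@lebesgue_measure_unique R (mscale (NngNum (ltW k0)) push))//.
move=> _ [[a b]] _ <-.
transitivity (k%:E * lebesgue_measure ((fun y => c + k * y)%R @^-1` [set` `]a, b]]))%E;
  last by [].
rewrite (_ : _ @^-1` _ = [set` `](a - c) / k, (b - c) / k]]); last first.
  apply/seteqP; split => x /=; rewrite !in_itv/= ltr_pdivrMr// ler_pdivlMr//;
  by rewrite ltrBlDl lerBrDl (mulrC x).
rewrite !lebesgue_measure_itv/= !lte_fin ltr_pM2r ?invr_gt0// ltrD2r.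
case: ifP => _; last by rewrite mule0.
by rewrite -!EFinD -EFinM; congr EFin; field; rewrite gt_eqF.
Qed.

Section homothety.
Context {R : realType}.
Notation mu2 := (@lebesgue2 R).

(** Uniqueness of the product measure reduces the claim to rectangles, where each side contributes
    one factor [k]. *)
Lemma lebesgue2_homothety (c : R * R) (k : R) (A : set (R * R)) :
  0 < k -> measurable A ->
  (mu2 A = (k ^+ 2)%:E * mu2 ((fun x => (c.1 + k * x.1, c.2 + k * x.2))%R @^-1` A))%E.
Proof.
move=> k0 mA; rewrite /lebesgue2.
pose f (x : measurableTypeR R * measurableTypeR R) :=
  (c.1 + k * x.1, c.2 + k * x.2) : measurableTypeR R * measurableTypeR R.
have mf : measurable_fun setT f.
  apply: measurable_fun_pair => /=; apply: measurable_funD => //; apply: measurable_funM => //.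
have k20 : 0 <= k ^+ 2 by rewrite exprn_ge0// ltW.
pose push := measure_function_pushforward__canonical__measure_function_Measure
  (@lebesgue_measure R \x @lebesgue_measure R)%E mf.
rewrite (@product_measure_unique _ _ _ _ _ _ _ (mscale (NngNum k20) push))// => B C mB mC.
transitivity ((k ^+ 2)%:E * (@lebesgue_measure R \x @lebesgue_measure R)
  (((fun y => c.1 + k * y)%R @^-1` B) `*` ((fun y => c.2 + k * y)%R @^-1` C)))%E; first by [].
rewrite product_measure1E//.
- rewrite /=; set u := lebesgue_measure (_ @^-1` B); set v := lebesgue_measure (_ @^-1` C).
  transitivity ((k%:E * u) * (k%:E * v))%E.
    by rewrite expr2 EFinM -!muleA; congr (_ * _)%E; rewrite muleCA.
  by congr (_ * _)%E; rewrite -lebesgue_measure_affine.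
- rewrite -[X in measurable X]setTI.
  have: measurable_fun setT (fun y : measurableTypeR R => c.1 + k * y : measurableTypeR R).
    by apply: measurable_funD => //; exact: measurable_funM.
  by apply.
- rewrite -[X in measurable X]setTI.
  have: measurable_fun setT (fun y : measurableTypeR R => c.2 + k * y : measurableTypeR R).
    by apply: measurable_funD => //; exact: measurable_funM.
  by apply.
Qed.
End homothety.

(** * Area of a triangle, and pointwise bounds against bounds in the mean *)

Section Averages.
Variable R : realType.
Implicit Types (T : triangle R) (p q : mpoly 2 R).
Local Notation mR := (measurableTypeR R).
Local Notation mu2 := ((@lebesgue_measure R \x @lebesgue_measure R)%E).

Definition tset T : set (mR * mR) := @pt R @^-1` hull T.

Lemma measurable_affine (a b c : R) : measurable_fun setT (fun x : mR * mR => a * x.1 + b * x.2 + c : mR).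
Proof.
apply: measurable_funD => //; apply: measurable_funD; apply: measurable_funM => //.
Qed.

Lemma measurable_ge0 (f : mR * mR -> mR) : measurable_fun setT f -> measurable [set x | 0 <= f x].
Proof.
move=> mf; rewrite (_ : [set x | _] = setT `&` f @^-1` [set` `[0, +oo[ : interval R]).
  by apply: mf => //; exact: measurable_itv.
by rewrite setTI; apply/seteqP; split=> x /=; rewrite in_itv/= andbT.
Qed.

Lemma measurable_tset T : measurable (tset T).
Proof.
rewrite /tset hull_preimage.
pose f1 (x : mR * mR) := ts T x : mR. pose f2 (x : mR * mR) := tu T x : mR.
pose f3 (x : mR * mR) := 1 - (ts T x + tu T x) : mR.
have m1 : measurable_fun setT f1.
  rewrite (_ : f1 = fun x => ty2 T / tdet T * x.1 + - tx2 T / tdet T * x.2 +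
    (ty0 T * tx2 T - tx0 T * ty2 T) / tdet T); first exact: measurable_affine.
  by apply/funext => x; rewrite /f1 /ts; ring.
have m2 : measurable_fun setT f2.
  rewrite (_ : f2 = fun x => - ty1 T / tdet T * x.1 + tx1 T / tdet T * x.2 +
    (tx0 T * ty1 T - ty0 T * tx1 T) / tdet T); first exact: measurable_affine.
  by apply/funext => x; rewrite /f2 /tu; ring.
have m3 : measurable_fun setT f3.
  by apply: measurable_funB => //; exact: measurable_funD.
rewrite (_ : [set x | _] = [set x | 0 <= f1 x] `&` ([set x | 0 <= f2 x] `&` [set x | 0 <= f3 x])).
  by apply: measurableI; [|apply: measurableI]; exact: measurable_ge0.
apply/seteqP; split=> x /=; rewrite /f1 /f2 /f3 subr_ge0; first by case.
by move=> [? [? ?]].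
Qed.

Lemma mu2_box (a b c d : R) : a <= b -> c <= d ->
  mu2 ([set` `[a, b]] `*` [set` `[c, d]]) = ((b - a) * (d - c))%:E.
Proof.
move=> ab cd; rewrite product_measure1E//.
rewrite /= !lebesgue_measure_itv /= !lte_fin.
move: ab cd; rewrite !le_eqVlt => /orP[/eqP<-|ab]; first by rewrite ltxx mul0e subrr mul0r.
move=> /orP[/eqP<-|cd]; first by rewrite ltxx mule0 subrr mulr0.
by rewrite ab cd -!EFinD -EFinM.
Qed.

Lemma measurable_box (a b c d : R) : measurable ([set` `[a, b]] `*` [set` `[c, d]] : set (mR * mR)).
Proof. by apply: measurableX; exact: measurable_itv. Qed.

Lemma mu2_tset_lty T : (mu2 (tset T) < +oo)%E.
Proof.
pose r := `|tx1 T| + `|tx2 T| + `|ty1 T| + `|ty2 T|.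
have r0 : 0 <= r by rewrite !addr_ge0.
have h1 : tx0 T - r <= tx0 T + r by lra.
have h2 : ty0 T - r <= ty0 T + r by lra.
apply: (@le_lt_trans _ _ (mu2 ([set` `[tx0 T - r, tx0 T + r]] `*` [set` `[ty0 T - r, ty0 T + r]]))).
  apply: le_measure; rewrite ?inE; [exact: measurable_tset|exact: measurable_box|].
  move=> x; rewrite /tset /= => /hullP[s [t [s0 t0 st e]]].
  have s1 : `|s| <= 1 by rewrite ger0_norm//; lra.
  have t1 : `|t| <= 1 by rewrite ger0_norm//; lra.
  have e1 : x.1 = tx0 T + tx1 T * s + tx2 T * t by have := congr1 (fun z : 'cV_2 => z 0 0) e; rewrite !mxE.
  have e2 : x.2 = ty0 T + ty1 T * s + ty2 T * t by have := congr1 (fun z : 'cV_2 => z 1 0) e; rewrite !mxE.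
  have b1 := normM_le (lexx `|tx1 T|) s1; have b2 := normM_le (lexx `|tx2 T|) t1.
  have b3 := normM_le (lexx `|ty1 T|) s1; have b4 := normM_le (lexx `|ty2 T|) t1.
  have n1 := normr_ge0 (tx1 T); have n2 := normr_ge0 (tx2 T).
  have n3 := normr_ge0 (ty1 T); have n4 := normr_ge0 (ty2 T).
  rewrite !mulr1 !ler_norml in b1 b2 b3 b4.
  move: b1 b2 b3 b4 => /andP[? ?] /andP[? ?] /andP[? ?] /andP[? ?].
  by rewrite /= !in_itv /= e1 e2 /r; split; apply/andP; split; lra.
by rewrite mu2_box// ltry.
Qed.

(** The triangle contains a square around its barycenter: [r] is such that [ts] and [tu] stay within
    1/6 of 1/3, so both remain positive with sum at most 1. *)
Lemma mu2_tset_gt0 T : (0 < mu2 (tset T))%E.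
Proof.
have D0 := tdet_neq0 T.
pose S := 1 + `|tx1 T| + `|tx2 T| + `|ty1 T| + `|ty2 T|.
have S0 : 0 < S by rewrite /S -!addrA ltr_pwDl// !addr_ge0.
pose r := `|tdet T| / (6 * S).
have r0 : 0 < r by rewrite divr_gt0 ?normr_gt0// mulr_gt0.
pose cx := tx0 T + tx1 T / 3 + tx2 T / 3; pose cy := ty0 T + ty1 T / 3 + ty2 T / 3.
have h1 : cx - r <= cx + r by lra.
have h2 : cy - r <= cy + r by lra.
apply: (@lt_le_trans _ _ (mu2 ([set` `[cx - r, cx + r]] `*` [set` `[cy - r, cy + r]]))).
  rewrite mu2_box// lte_fin mulr_gt0//; lra.
apply: le_measure; rewrite ?inE; [exact: measurable_box|exact: measurable_tset|].
move=> x /= []; rewrite !in_itv /= => hx hy.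
rewrite /tset hull_preimage /=.
have {}hx : `|x.1 - cx| <= r by rewrite ler_norml; lra.
have {}hy : `|x.2 - cy| <= r by rewrite ler_norml; lra.
have bound a b : `|a| + `|b| <= S -> `|((x.1 - cx) * a - (x.2 - cy) * b) / tdet T| <= 6^-1.
  move=> ab; rewrite normrM normfV ler_pdivrMr ?normr_gt0//.
  have e : r * S = 6^-1 * `|tdet T| by rewrite /r; field; rewrite gt_eqF.
  rewrite -e; apply: (le_trans (ler_normB _ _)).
  have b1 := normM_le hx (lexx `|a|); have b2 := normM_le hy (lexx `|b|).
  apply: (le_trans (lerD b1 b2)); rewrite -mulrDr ler_wpM2l// ltW//.
have n1 := normr_ge0 (tx1 T); have n2 := normr_ge0 (tx2 T).
have n3 := normr_ge0 (ty1 T); have n4 := normr_ge0 (ty2 T).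
have es : ts T x = 3^-1 + ((x.1 - cx) * ty2 T - (x.2 - cy) * tx2 T) / tdet T.
  by move: D0; rewrite /ts /cx /cy /tdet /tri_det => D0; field.
have et : tu T x = 3^-1 + ((x.1 - cx) * - ty1 T - (x.2 - cy) * - tx1 T) / tdet T.
  by move: D0; rewrite /tu /cx /cy /tdet /tri_det => D0; field.
have /ler_normlP[bs1 bs2] := bound (ty2 T) (tx2 T) ltac:(rewrite /S; lra).
have /ler_normlP[bt1 bt2] := bound (- ty1 T) (- tx1 T) ltac:(rewrite /S !normrN; lra).
rewrite es et; split; lra.
Qed.

Definition ar T : R := fine (mu2 (tset T)).

Lemma arE T : mu2 (tset T) = (ar T)%:E.
Proof. by rewrite fineK// ge0_fin_numE ?mu2_tset_lty. Qed.

Lemma ar_gt0 T : 0 < ar T.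
Proof. by rewrite -lte_fin -arE mu2_tset_gt0. Qed.

Lemma eT_def m T p : eT m T p = Num.sqrt ((ar T)^-1 *
  fine (\int[mu2]_(x in tset T) (grad_sq (p - interp m T (peval p)) (pt x))%:E)%E).
Proof. by []. Qed.

Lemma measurable_peval q : measurable_fun setT (fun x : mR * mR => peval q (pt x) : mR).
Proof.
rewrite (_ : (fun _ => _) = fun x : mR * mR => \sum_(i < msize q) \sum_(j < msize q)
   pc q i j * (x.1 ^+ i * x.2 ^+ j)); last first.
  apply/funext => x; rewrite (peval_expand (pt x) (leqnn _)).
  by apply: eq_bigr => i _; apply: eq_bigr => j _; rewrite !mxE.
apply: measurable_sum => i; apply: measurable_sum => j; apply: measurable_funM => //.
by apply: measurable_funM; apply: measurable_funX.
Qed.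

Lemma measurable_grad_sq q : measurable_fun setT (fun x : mR * mR => grad_sq q (pt x) : mR).
Proof.
rewrite (_ : (fun _ => _) = fun x : mR * mR => peval (mderiv 0 q) (pt x) ^+ 2 + peval (mderiv 1 q) (pt x) ^+ 2).
  by apply: measurable_funD; apply: measurable_funX; exact: measurable_peval.
by apply/funext => x; rewrite /grad_sq sum_ord2.
Qed.

Lemma grad_sq_ge0 q z : 0 <= grad_sq q z.
Proof. by rewrite /grad_sq sum_ord2 addr_ge0 ?sqr_ge0. Qed.

Let mg q (D : set (mR * mR)) : measurable_fun D (fun x : mR * mR => (grad_sq q (pt x))%:E).
Proof. by apply/measurable_EFinP; apply: measurable_funTS; exact: measurable_grad_sq. Qed.

Lemma integral_grad_le q T B : 0 <= B ->
  (forall s t, 0 <= s -> 0 <= t -> s + t <= 1 -> grad_sq q (tpt T s t) <= B) ->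
  (\int[mu2]_(x in tset T) (grad_sq q (pt x))%:E <= (B * ar T)%:E)%E.
Proof.
move=> B0 hB; have mT := measurable_tset T.
apply: (@le_trans _ _ (\int[mu2]_(x in tset T) (cst B%:E x)))%E.
  apply: ge0_le_integral => //.
  - by move=> x _; rewrite lee_fin grad_sq_ge0.
  - by move=> x; rewrite /tset /= => /hullP[s [t [s0 t0 st ->]]]; rewrite lee_fin hB.
by rewrite integral_cst//= arE.
Qed.

Lemma eT_le m T p B : 0 <= B ->
  (forall s t, 0 <= s -> 0 <= t -> s + t <= 1 ->
     grad_sq (p - interp m T (peval p)) (tpt T s t) <= B ^+ 2) ->
  eT m T p <= B.
Proof.
move=> B0 hB; rewrite eT_def -(ger0_norm B0) -sqrtr_sqr ler_wsqrtr//.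
have B20 : 0 <= B ^+ 2 by rewrite sqr_ge0.
have h := integral_grad_le B20 hB.
rewrite mulrC ler_pdivrMr ?ar_gt0// -lee_fin fineK//.
rewrite ge0_fin_numE ?(le_lt_trans h) ?ltry//.
by apply: integral_ge0 => x _; rewrite lee_fin grad_sq_ge0.
Qed.

(** If the squared gradient exceeded [2 / l ^+ 2] on the whole copy of the triangle of ratio [l] and
    center [tpt T s t], whose area is [l ^+ 2] times the full area, its mean over the triangle would
    be at least 2. The bound [B] guarantees a finite integral. *)
Lemma eT_near m T p l B : 0 < l -> l <= 1 -> 0 <= B ->
  (forall s t, 0 <= s -> 0 <= t -> s + t <= 1 ->
     grad_sq (p - interp m T (peval p)) (tpt T s t) <= B) ->
  eT m T p <= 1 ->
  forall s t, 0 <= s -> 0 <= t -> s + t <= 1 -> exists s' t',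
    [/\ `|s' - s| <= l, `|t' - t| <= l &
        grad_sq (p - interp m T (peval p)) (tpt T s' t') <= 2 / l ^+ 2].
Proof.
move=> l0 l1 B0 hB e1 s t s0 t0 st; apply: contrapT => no.
set q := p - interp m T (peval p) in hB no *.
have ln0 : l != 0 by rewrite gt_eqF.
(* The translation part of the homothety of ratio [l^-1] fixing [tpt T s t]; the preimage [Y] of the
   triangle under it is the copy of ratio [l]. *)
pose c : R * R := ((tx0 T + tx1 T * s + tx2 T * t) * (1 - l^-1),
                   (ty0 T + ty1 T * s + ty2 T * t) * (1 - l^-1)).
pose Y : set (mR * mR) := (fun x => (c.1 + l^-1 * x.1, c.2 + l^-1 * x.2)) @^-1` tset T.
have mT := measurable_tset T.
have li0 : 0 < l^-1 by rewrite invr_gt0.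
have YE : (mu2 (tset T) = (l^-1 ^+ 2)%:E * mu2 Y)%E by exact: lebesgue2_homothety.
have mY : measurable Y.
  rewrite -[Y]setTI.
  have : measurable_fun setT (fun x : mR * mR => (c.1 + l^-1 * x.1, c.2 + l^-1 * x.2) : mR * mR).
    by apply: measurable_fun_pair => /=; apply: measurable_funD => //; apply: measurable_funM.
  by apply.
have Ypt x : Y x -> exists s' t', [/\ pt x = tpt T s' t', `|s' - s| <= l & `|t' - t| <= l] /\
    [/\ 0 <= s', 0 <= t' & s' + t' <= 1].
  rewrite /Y /tset /= => /hullP[a [b [a0 b0 ab e]]].
  have e1' : c.1 + l^-1 * x.1 = tx0 T + tx1 T * a + tx2 T * b by have := congr1 (fun z : 'cV_2 => z 0 0) e; rewrite !mxE.
  have e2' : c.2 + l^-1 * x.2 = ty0 T + ty1 T * a + ty2 T * b by have := congr1 (fun z : 'cV_2 => z 1 0) e; rewrite !mxE.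
  have x1 : x.1 = l * (tx0 T + tx1 T * a + tx2 T * b) - l * c.1 by rewrite -e1' mulrDr mulVKf// addrAC subrr add0r.
  have x2 : x.2 = l * (ty0 T + ty1 T * a + ty2 T * b) - l * c.2 by rewrite -e2' mulrDr mulVKf// addrAC subrr add0r.
  have al : 0 <= l * a by rewrite mulr_ge0// ltW.
  have bl : 0 <= l * b by rewrite mulr_ge0// ltW.
  have sl : 0 <= (1 - l) * s by rewrite mulr_ge0// subr_ge0.
  have tl : 0 <= (1 - l) * t by rewrite mulr_ge0// subr_ge0.
  exists (s + l * (a - s)), (t + l * (b - t)).
  have as1 : `|a - s| <= 1 by rewrite ler_norml; lra.
  have bt1 : `|b - t| <= 1 by rewrite ler_norml; lra.
  split; split.
  - by apply: cv2P; rewrite !mxE /= ?x1 ?x2 /c /=; field.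
  - by rewrite addrAC subrr add0r normrM (gtr0_norm l0) ler_piMr// ltW.
  - by rewrite addrAC subrr add0r normrM (gtr0_norm l0) ler_piMr// ltW.
  - by lra.
  - by lra.
  - have : l * (a + b) <= l by rewrite ler_piMr// ltW.
    have : (1 - l) * (s + t) <= 1 - l by rewrite ler_piMr// subr_ge0.
    lra.
have YT : Y `<=` tset T.
  move=> x /Ypt[s' [t' [[e _ _] [s'0 t'0 st']]]]; rewrite /tset /= e.
  by apply/hullP; exists s', t'.
have muY : mu2 Y = (l ^+ 2 * ar T)%:E.
  have : ((l ^+ 2)%:E * mu2 (tset T) = mu2 Y)%E.
    by rewrite YE muleA -EFinM -exprMn divff// expr1n mul1e.
  by rewrite arE -EFinM => <-.
have low : ((2 * ar T)%:E <= \int[mu2]_(x in tset T) (grad_sq q (pt x))%:E)%E.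
  apply: (@le_trans _ _ (\int[mu2]_(x in Y) (grad_sq q (pt x))%:E)%E); last first.
    by apply: ge0_subset_integral => // x _; rewrite lee_fin grad_sq_ge0.
  apply: (@le_trans _ _ (\int[mu2]_(x in Y) (cst (2 / l ^+ 2)%:E x))%E).
    rewrite integral_cst//= muY -EFinM lee_fin le_eqVlt; apply/orP; left; apply/eqP.
    by field.
  apply: ge0_le_integral => //.
  - by move=> x _; rewrite lee_fin divr_ge0// sqr_ge0.
  - move=> x /Ypt[s' [t' [[e hs ht] _]]]; rewrite lee_fin e leNgt; apply/negP => /ltW h.
    by apply: no; exists s', t'.
have up := integral_grad_le B0 hB.
(* Finiteness is essential: [fine] sends an infinite integral to 0, and the lower bound would be
   lost. *)
have fin : (\int[mu2]_(x in tset T) (grad_sq q (pt x))%:E)%E \is a fin_num.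
  rewrite ge0_fin_numE ?(le_lt_trans up) ?ltry//.
  by apply: integral_ge0 => x _; rewrite lee_fin grad_sq_ge0.
move: e1; apply/negP; rewrite -ltNge eT_def -/q.
rewrite -[ltLHS]sqrtr1 ltr_sqrt.
  rewrite mulrC ltr_pdivlMr ?ar_gt0// mul1r -lte_fin (fineK fin).
  by apply: lt_le_trans low; rewrite lte_fin; have := ar_gt0 T; lra.
rewrite mulr_gt0 ?invr_gt0 ?ar_gt0// -lte_fin (fineK fin).
by apply: lt_le_trans low; rewrite lte_fin mulr_gt0 ?ar_gt0.
Qed.

End Averages.

(** * Spectral maps of symmetric matrices *)

Section Spectral.
Variable R : realType.

Definition eigmx (mu nu p q : R) : 'M[R]_2 :=
  sym2 (eig11 mu nu p q) (eig12 mu nu p q) (eig22 mu nu p q).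

(** [D] is the gap between the eigenvalues, and [(p, q)] are the cosine and sine of an angle whose
    double has cosine [(a - c) / D] and sine [2 * b / D]. Half-angle formulas give the squares [u]
    and [v]; [q] carries the sign of [b]. *)
Lemma diagonalize2 (a b c : R) : exists p q mu nu, [/\ p ^+ 2 + q ^+ 2 = 1, nu <= mu,
  a = eig11 mu nu p q, b = eig12 mu nu p q & c = eig22 mu nu p q].
Proof.
pose D := Num.sqrt ((a - c) ^+ 2 + 4 * b ^+ 2).
have D2 : D ^+ 2 = (a - c) ^+ 2 + 4 * b ^+ 2.
  by rewrite sqr_sqrtr// addr_ge0 ?sqr_ge0// mulr_ge0 ?sqr_ge0.
have D0 : 0 <= D by exact: sqrtr_ge0.
have [Dz|Dn] := eqVneq D 0.
  have ac : a = c by have := sqr_ge0 b; have := sqr_ge0 (a - c); rewrite Dz expr0n /= in D2; nra.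
  have b0 : b = 0 by have := sqr_ge0 b; have := sqr_ge0 (a - c); rewrite Dz expr0n /= in D2; nra.
  exists 1, 0, a, a; rewrite /eig11 /eig12 /eig22 -ac b0 !expr0n /=.
  by split=> //; ring.
have Dp : 0 < D by rewrite lt_neqAle eq_sym Dn.
have acD : `|a - c| <= D by apply: norm_le_sqr => //; have := sqr_ge0 b; lra.
have /ler_normlP[ac1 ac2] := acD.
pose u := (1 + (a - c) / D) / 2; pose v := (1 - (a - c) / D) / 2.
have u0 : 0 <= u.
  rewrite /u divr_ge0//; have : -1 <= (a - c) / D by rewrite ler_pdivlMr// mulN1r; lra.
  lra.
have v0 : 0 <= v.
  rewrite /v divr_ge0//; have : (a - c) / D <= 1 by rewrite ler_pdivrMr// mul1r; lra.
  lra.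
have uv : u + v = 1 by rewrite /u /v; field.
pose p := Num.sqrt u; pose q := (if 0 <= b then 1 else -1) * Num.sqrt v.
have p2 : p ^+ 2 = u by rewrite sqr_sqrtr.
have q2 : q ^+ 2 = v.
  by rewrite exprMn sqr_sqrtr//; case: ifP => _; rewrite ?sqrrN expr1n mul1r.
have pq : p * q = b / D.
  have -> : p * q = (if 0 <= b then 1 else -1) * Num.sqrt (u * v).
    by rewrite sqrtrM// /p /q; ring.
  have -> : u * v = (b / D) ^+ 2.
    rewrite (_ : u * v = (D ^+ 2 - (a - c) ^+ 2) / (4 * D ^+ 2)); last by rewrite /u /v; field.
    rewrite (_ : D ^+ 2 - (a - c) ^+ 2 = 4 * b ^+ 2); last by rewrite D2; ring.
    by field.
  rewrite sqrtr_sqr normrM normfV (gtr0_norm Dp) mulrA; congr (_ / _).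
  have [b0|b0] := leP 0 b; first by rewrite mul1r ger0_norm.
  by rewrite ltr0_norm// mulN1r opprK.
exists p, q, ((a + c + D) / 2), ((a + c - D) / 2); split.
- by rewrite p2 q2.
- by lra.
- by rewrite /eig11 p2 q2 /u /v; field.
- by rewrite /eig12 -mulrA pq; field.
- by rewrite /eig22 p2 q2 /u /v; field.
Qed.

Lemma diag_mx2 (d : 'rV[R]_2) : (diag_mx d 0 0 = d 0 0) * (diag_mx d 0 1 = 0) *
  (diag_mx d 1 0 = 0) * (diag_mx d 1 1 = d 0 1).
Proof. by rewrite !mxE /= ?mulr1n ?mulr0n. Qed.

Lemma mulmx2 (A B : 'M[R]_2) i j : (A *m B) i j = A i 0 * B 0 j + A i 1 * B 1 j.
Proof. by rewrite mxE sum_ord2. Qed.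

(** [P] may be a rotation or a reflection: its second column is [(- q, p)] or the opposite, and only
    the squares and the product of its entries [r], [s] occur, which are the same in both cases. *)
Lemma orthogonal_eigmx (P : 'M[R]_2) : P^T *m P = 1%:M ->
  exists p q, p ^+ 2 + q ^+ 2 = 1 /\
    forall d : 'rV[R]_2, P *m diag_mx d *m P^T = eigmx (d 0 0) (d 0 1) p q.
Proof.
move=> PP.
have e00 := congr1 (fun A : 'M[R]_2 => A 0 0) PP.
have e01 := congr1 (fun A : 'M[R]_2 => A 0 1) PP.
have e11 := congr1 (fun A : 'M[R]_2 => A 1 1) PP.
rewrite /= !mulmx2 !mxE /= ?mulr1n ?mulr0n in e00 e01 e11.
set p := P 0 0 in e00 e01 e11 *; set r := P 0 1 in e00 e01 e11 *.
set q := P 1 0 in e00 e01 e11 *; set s := P 1 1 in e00 e01 e11 *.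
have r2 : r ^+ 2 = q ^+ 2.
  have : (r ^+ 2 - q ^+ 2) = r ^+ 2 * (1 - (p * p + q * q)) + (p * r + q * s) * (p * r - q * s)
    - q ^+ 2 * (1 - (r * r + s * s)) by ring.
  by rewrite e00 e01 e11 !subrr mul0r !mulr0 addr0 subr0 => /eqP; rewrite subr_eq0 => /eqP.
have s2 : s ^+ 2 = p ^+ 2.
  have : s ^+ 2 - p ^+ 2 = (r * r + s * s) - (p * p + q * q) - (r ^+ 2 - q ^+ 2) by ring.
  by rewrite e00 e11 r2 !subrr => /eqP; rewrite subr_eq0 => /eqP.
have rs : r * s = - (p * q).
  have : r * s + p * q = r * s * (1 - (p * p + q * q)) + p * q * (1 - (r * r + s * s)) +
    (p * r + q * s) * (p * s + q * r) by ring.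
  by rewrite e00 e01 e11 !subrr mul0r !mulr0 !addr0 => /eqP; rewrite addr_eq0 => /eqP.
exists p, q; split; first by rewrite !expr2.
move=> d; apply: mx2P; rewrite !mulmx2 !diag_mx2 !sym2E ![P^T _ _]mxE -/p -/q -/r -/s
  /eig11 /eig12 /eig22.
- by rewrite -r2; ring.
- rewrite (_ : _ + _ = d 0 0 * (p * q) + d 0 1 * (r * s)); last by ring.
  by rewrite rs; ring.
- rewrite (_ : _ + _ = d 0 0 * (p * q) + d 0 1 * (r * s)); last by ring.
  by rewrite rs; ring.
- by rewrite -s2; ring.
Qed.

(** One diagonalization shows that the set under [xget] is inhabited; the chosen value comes with a
    diagonalization of its own, and that one supplies the frame. *)
Lemma spectral_map_eigmx (f : R -> R) (a b c : R) : exists p q mu nu,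
  [/\ p ^+ 2 + q ^+ 2 = 1, sym2 a b c = eigmx mu nu p q &
      spectral_map f (sym2 a b c) = eigmx (f mu) (f nu) p q].
Proof.
set X := [set B | exists (P : 'M[R]_2) (d : 'rV[R]_2),
    [/\ P^T *m P = 1%:M, sym2 a b c = P *m diag_mx d *m P^T &
        B = P *m diag_mx (map_mx f d) *m P^T]].
have : X (spectral_map f (sym2 a b c)).
  apply: (@xgetPex _ 0 X).
  have [p [q [mu [nu [pq _ aE bE cE]]]]] := diagonalize2 a b c.
  pose P : 'M[R]_2 := \matrix_(i, j) if i == j then p else if i == 0 then - q else q.
  pose d : 'rV[R]_2 := \row_j if j == 0 then mu else nu.
  exists (P *m diag_mx (map_mx f d) *m P^T), P, d; split=> //.
    apply: mx2P; rewrite !mulmx2 !mxE /= ?mulr1n ?mulr0n; try by rewrite -pq; ring.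
      by ring.
    by ring.
  apply: mx2P; rewrite !mulmx2 !diag_mx2 !sym2E !mxE /= ?aE ?bE ?cE
    /eig11 /eig12 /eig22; ring.
move=> [P [d [/orthogonal_eigmx[p [q [pq PE]]] SE ->]]].
exists p, q, (d 0 0), (d 0 1); rewrite SE !PE; split=> //.
by rewrite !mxE.
Qed.

Lemma eigmx_S2plus (mu nu p q : R) : p ^+ 2 + q ^+ 2 = 1 -> 0 < mu -> 0 < nu ->
  S2plus (eigmx mu nu p q).
Proof.
move=> pq mu0 nu0; split.
  by apply: mx2P; rewrite mxE !sym2E.
move=> u un; rewrite /eigmx sym2_quadr quadr_eig.
set x := u 0 0; set y := u 1 0.
have xy : 0 < x ^+ 2 + y ^+ 2.
  rewrite lt_neqAle addr_ge0 ?sqr_ge0// andbT eq_sym paddr_eq0 ?sqr_ge0// !sqrf_eq0.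
  by apply/negP => /andP[/eqP x0 /eqP y0]; case/eqP: un; apply: cv2P; rewrite mxE.
have e : (p * x + q * y) ^+ 2 + (p * y - q * x) ^+ 2 = x ^+ 2 + y ^+ 2.
  by rewrite [RHS](frame_one _ 1 pq); ring.
have X0 := sqr_ge0 (p * x + q * y); have Y0 := sqr_ge0 (p * y - q * x).
move: X0 Y0 e; set X := (p * x + q * y) ^+ 2; set Y := (p * y - q * x) ^+ 2 => X0 Y0 e.
have [Xz|Xn] := eqVneq X 0; first by rewrite Xz mulr0 add0r mulr_gt0//; lra.
have X1 : 0 < X by rewrite lt_neqAle eq_sym Xn.
by have := mulr_gt0 mu0 X1; have := mulr_ge0 (ltW nu0) Y0; lra.
Qed.

Lemma det_eigmx (mu nu p q : R) : p ^+ 2 + q ^+ 2 = 1 -> \det (eigmx mu nu p q) = mu * nu.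
Proof. by move=> pq; rewrite det2 !sym2E -expr2 det_eig. Qed.

Lemma eigmx_unit (mu nu p q : R) : p ^+ 2 + q ^+ 2 = 1 -> 0 < mu -> 0 < nu ->
  eigmx mu nu p q \in unitmx.
Proof.
by move=> pq mu0 nu0; rewrite unitmxE det_eigmx// unitfE gt_eqF// mulr_gt0.
Qed.

(** Eigenvalues are written as squares because the bounds of the coefficients are polynomial in
    their roots; the order [t <= s] singles out the axis that carries a vertex of the test
    triangle. *)
Lemma S2plus_eigmx (M : 'M[R]_2) : S2plus M -> exists s t p q,
  [/\ p ^+ 2 + q ^+ 2 = 1, 0 < t, t <= s & M = eigmx (s ^+ 2) (t ^+ 2) p q].
Proof.
move=> [/sym2_tr ME pos]; rewrite ME in pos *.
have [p [q [mu [nu [pq numu a b c]]]]] := diagonalize2 (M 0 0) (M 0 1) (M 1 1).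
have nu0 : 0 < nu.
  have := pos (pt (- q, p)); rewrite sym2_quadr a b c quadr_eig !mxE /=.
  rewrite (_ : _ + _ = nu * (p ^+ 2 + q ^+ 2) ^+ 2); last by ring.
  rewrite pq expr1n mulr1; apply.
  apply/eqP => /(congr1 (fun z : 'cV_2 => (z 0 0, z 1 0))); rewrite !mxE /= => -[/eqP + p0].
  by rewrite oppr_eq0 => /eqP q0; move: pq; rewrite q0 p0 expr0n addr0 => /eqP; rewrite eq_sym oner_eq0.
have mu0 : 0 < mu by exact: lt_le_trans numu.
exists (Num.sqrt mu), (Num.sqrt nu), p, q; split=> //.
- by rewrite sqrtr_gt0.
- by rewrite ler_wsqrtr.
- by rewrite !sqr_sqrtr ?ltW// a b c.
Qed.

Lemma Mmap2_eigmx (f : mpoly 2 R) : exists p q mu nu, [/\ p ^+ 2 + q ^+ 2 = 1,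
    bcoef f 2 0 = eig11 mu nu p q, bcoef f 1 1 = eig12 mu nu p q,
    bcoef f 0 2 = eig22 mu nu p q &
    Mmap2 f = eigmx (pnorm f * `|mu|) (pnorm f * `|nu|) p q].
Proof.
have qE : quadmx f = sym2 (bcoef f 2 0) (bcoef f 1 1) (bcoef f 0 2).
  by apply: mx2P; rewrite !mxE.
have [p [q [mu [nu [pq SE fE]]]]] :=
  spectral_map_eigmx (fun x => `|x|) (bcoef f 2 0) (bcoef f 1 1) (bcoef f 0 2).
exists p, q, mu, nu; split=> //.
- by have := congr1 (fun A : 'M[R]_2 => A 0 0) SE; rewrite /= !sym2E.
- by have := congr1 (fun A : 'M[R]_2 => A 0 1) SE; rewrite /= !sym2E.
- by have := congr1 (fun A : 'M[R]_2 => A 1 1) SE; rewrite /= !sym2E.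
rewrite /Mmap2 /mxabs qE fE; apply: mx2P; rewrite mxE !sym2E /eig11 /eig12 /eig22; ring.
Qed.

Lemma Mmap3_eigmx (f : mpoly 2 R) (e : R) :
  e = Num.max (- disc f / pnorm f) 0 `^ 3^-1 ->
  let a := bcoef f 3 0 in let b := bcoef f 2 1 in
  let c := bcoef f 1 2 in let d := bcoef f 0 3 in
  exists p q s1 s2, [/\ p ^+ 2 + q ^+ 2 = 1, 0 <= s1 & 0 <= s2] /\
   [/\ gram11 a b c d = eig11 (s1 ^+ 2) (s2 ^+ 2) p q,
    gram12 a b c d = eig12 (s1 ^+ 2) (s2 ^+ 2) p q,
    gram22 a b c d = eig22 (s1 ^+ 2) (s2 ^+ 2) p q &
    Mmap3 f = eigmx (s1 + e) (s2 + e) p q].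
Proof.
move=> eE a b c d.
have [[x20 x11 x02] [y20 y11 y02]] := bcoef_grad3 f.
have GE : quadmx (mderiv 0 f) *m quadmx (mderiv 0 f) + quadmx (mderiv 1 f) *m quadmx (mderiv 1 f)
    = sym2 (gram11 a b c d) (gram12 a b c d) (gram22 a b c d).
  by apply: mx2P; rewrite mxE !mulmx2 !sym2E !mxE /= ?addn0 ?add0n ?addn1 /= ?subnn ?subn0
    ?x20 ?x11 ?x02 ?y20 ?y11 ?y02 /gram11 /gram12 /gram22 -/a -/b -/c -/d; ring.
have [p [q [mu [nu [pq SE fE]]]]] :=
  spectral_map_eigmx Num.sqrt (gram11 a b c d) (gram12 a b c d) (gram22 a b c d).
have g11 : gram11 a b c d = eig11 mu nu p q.
  by have := congr1 (fun A : 'M[R]_2 => A 0 0) SE; rewrite /= !sym2E.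
have g12 : gram12 a b c d = eig12 mu nu p q.
  by have := congr1 (fun A : 'M[R]_2 => A 0 1) SE; rewrite /= !sym2E.
have g22 : gram22 a b c d = eig22 mu nu p q.
  by have := congr1 (fun A : 'M[R]_2 => A 1 1) SE; rewrite /= !sym2E.
(* [mu] is a diagonal entry of the Gram matrix in the rotated frame, hence a sum of squares. *)
have mu0 : 0 <= mu.
  have := gram11_rot a b c d p q; rewrite pq expr1n mul1r g11 g12 g22.
  rewrite [RHS](_ : _ = mu * (p ^+ 2 + q ^+ 2) ^+ 2); last by rewrite /eig11 /eig12 /eig22; ring.
  rewrite pq expr1n mulr1 => <-; rewrite /gram11.
  by rewrite mulr_ge0// !addr_ge0 ?sqr_ge0// mulr_ge0 ?sqr_ge0.
have nu0 : 0 <= nu.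
  have := gram22_rot a b c d p q; rewrite pq expr1n mul1r g11 g12 g22.
  rewrite [RHS](_ : _ = nu * (p ^+ 2 + q ^+ 2) ^+ 2); last by rewrite /eig11 /eig12 /eig22; ring.
  rewrite pq expr1n mulr1 => <-; rewrite /gram22.
  by rewrite mulr_ge0// !addr_ge0 ?sqr_ge0// mulr_ge0 ?sqr_ge0.
exists p, q, (Num.sqrt mu), (Num.sqrt nu); rewrite !sqr_sqrtr// !sqrtr_ge0.
split; split=> //.
rewrite /Mmap3 /mxsqrt GE fE -eE.
have ee : e = (p ^+ 2 + q ^+ 2) * e by rewrite pq mul1r.
apply: mx2P; rewrite mxE !sym2E [e%:M _ _]mxE /= ?mulr1n ?mulr0n /eig11 /eig12 /eig22.
- by rewrite {1}ee; ring.
- by ring.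
- by ring.
- by rewrite {1}ee; ring.
Qed.

End Spectral.

(** * The interpolation error seminorm of a metric *)

Section Equivalence.
Variable R : realType.
Implicit Types (T : triangle R) (p : mpoly 2 R).

Definition htr T := tri11 (tx1 T) (ty1 T) (tx2 T) (ty2 T) + tri22 (tx1 T) (ty1 T) (tx2 T) (ty2 T).

Lemma htr_ge0 T : 0 <= htr T.
Proof.
have h x y : 0 <= 3 * (x ^+ 2 + y ^+ 2 - x * y) :> R.
  by have := sqr_ge0 (x - y); have := sqr_ge0 x; have := sqr_ge0 y; lra.
by rewrite /htr /tri11 /tri22 addr_ge0// divr_ge0 ?sqr_ge0.
Qed.

Definition hquadr T := quadr (tri11 (tx1 T) (ty1 T) (tx2 T) (ty2 T))
  (tri12 (tx1 T) (ty1 T) (tx2 T) (ty2 T)) (tri22 (tx1 T) (ty1 T) (tx2 T) (ty2 T)).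

Lemma grad_le_of_err T z (u v L : R) (q : mpoly 2 R) :
  (exists gx gy, [/\ grad_sq q z = gx ^+ 2 + gy ^+ 2,
    gx * tx1 T + gy * ty1 T = u & gx * tx2 T + gy * ty2 T = v]) ->
  htr T * (u ^+ 2 + v ^+ 2) <= L -> grad_sq q z <= 2 / 3 * L.
Proof.
move=> [gx [gy [-> <- <-]]] h.
apply: le_trans (tri_grad_le gx gy (tdet_neq0 T)) _.
by rewrite -mulrA ler_wpM2l.
Qed.

(** In this constant 2/3 comes from [tri_grad_le], 450 from [err2_le] and [err3_le], and 729 from
    [tri_quadr_coefs] and [tri_cubic_coefs]. *)
Lemma upper_const_ge0 (K : R) : 0 <= K -> 0 <= 2 / 3 * (450 * (729 * K)).
Proof.
move=> K0; apply: mulr_ge0; first exact: divr_ge0.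
exact: (mulr_ge0 (ler0n _ 450) (mulr_ge0 (ler0n _ 729) K0)).
Qed.

Lemma eT2_le T p K : Hspace 2 p -> 0 <= K ->
  (forall x y, htr T * quadr (bcoef p 2 0) (bcoef p 1 1) (bcoef p 0 2) x y ^+ 2 <=
    K * hquadr T x y ^+ 2) ->
  eT 2 T p <= Num.sqrt (2 / 3 * (450 * (729 * K))).
Proof.
move=> hp K0 hK.
have [hA hB hC] := tri_quadr_coefs (tdet_neq0 T) (htr_ge0 T) K0 hK.
have c0 := upper_const_ge0 K0.
apply: eT_le; first exact: sqrtr_ge0.
move=> s t s0 t0 st; rewrite (sqr_sqrtr c0).
apply: grad_le_of_err (interp2_error_grad T s t hp) _.
exact: (err2_le (htr_ge0 T) s0 t0 st hA hB hC).
Qed.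

Lemma eT3_le T p K : Hspace 3 p -> 0 <= K ->
  (forall x y, htr T * cubic (bcoef p 3 0) (bcoef p 2 1) (bcoef p 1 2) (bcoef p 0 3) x y ^+ 2 <=
    K * hquadr T x y ^+ 3) ->
  eT 3 T p <= Num.sqrt (2 / 3 * (450 * (729 * K))).
Proof.
move=> hp K0 hK.
have [hA hB hC hD] := tri_cubic_coefs (tdet_neq0 T) (htr_ge0 T) K0 hK.
have c0 := upper_const_ge0 K0.
apply: eT_le; first exact: sqrtr_ge0.
move=> s t s0 t0 st; rewrite (sqr_sqrtr c0).
apply: grad_le_of_err (interp3_error_grad T s t hp) _.
exact: (err3_le (htr_ge0 T) s0 t0 st hA hB hC hD).
Qed.

Lemma triangle_of_edges (x1 y1 x2 y2 : R) : tri_det x1 y1 x2 y2 != 0 ->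
  exists T, [/\ tx1 T = x1, ty1 T = y1, tx2 T = x2 & ty2 T = y2].
Proof.
move=> D0.
pose v (i : 'I_3) : 'cV[R]_2 := if i == 0 then 0 else if i == 1 then pt (x1, y1) else pt (x2, y2).
have vD : \det (row_mx (v 1 - v 0) (v 2%:R - v 0) : 'M[R]_(1 + 1)) != 0.
  by rewrite row_mx_det2 /v /= !mxE /= !subr0.
by exists (Triangle vD); split; rewrite /tx1 /ty1 /tx2 /ty2 /= /v /= !mxE /= subr0.
Qed.

Lemma metric_triangle (s t p q : R) : p ^+ 2 + q ^+ 2 = 1 -> 0 < s -> 0 < t ->
  exists T, [/\ HT T = eigmx (s ^+ 2) (t ^+ 2) p q,
    (forall gx gy, ((gx * tx1 T + gy * ty1 T) + (gx * tx2 T + gy * ty2 T)) ^+ 2 <=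
       (3 / s) ^+ 2 * (gx ^+ 2 + gy ^+ 2)) &
    forall x y, hquadr T x y = quadr (eig11 (s ^+ 2) (t ^+ 2) p q)
      (eig12 (s ^+ 2) (t ^+ 2) p q) (eig22 (s ^+ 2) (t ^+ 2) p q) x y].
Proof.
move=> pq s0 t0.
pose al := s^-1; pose ga := Num.sqrt 3 / (2 * t).
have al0 : 0 < al by rewrite invr_gt0.
have ga0 : 0 < ga by rewrite divr_gt0 ?sqrtr_gt0// mulr_gt0.
have [T [e1 e2 e3 e4]] := triangle_of_edges (tri_det_edge_neq0 al0 ga0 pq).
have [h11 h12 h22] := tri_edge_eig al0 ga0 pq.
have sE : al ^- 2 = s ^+ 2 by rewrite /al exprVn invrK.
have tE : 3 / (4 * ga ^+ 2) = t ^+ 2.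
  rewrite /ga expr_div_n sqr_sqrtr//; field; rewrite gt_eqF//.
exists T; split.
- by rewrite HT_sym2 e1 e2 e3 e4 h11 h12 h22 sE tE.
- by move=> gx gy; rewrite e1 e2 e3 e4; exact: edge_grad_le.
- by move=> x y; rewrite /hquadr e1 e2 e3 e4 h11 h12 h22 sE tE.
Qed.

(** The ratio of the copies in [eT_near], small enough for the absorption in [err2_recover] and
    [err3_recover]. *)
Definition small : R := 1000^-1.
Lemma small_gt0 : 0 < small. Proof. by rewrite invr_gt0 ltr0n. Qed.
Lemma small_le1 : small <= 1. Proof. by rewrite invf_le1 ?ltr0n// ler1n. Qed.
Lemma small_1000 : 1000 * small <= 1. Proof. by rewrite /small divff ?pnatr_eq0 ?lexx. Qed.

(** Here 5 comes from [norm_of_grad], where [18 <= 5 ^+ 2], and 44 from the recovery lemmas; the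
    leading 2 offsets the factor 4 in [quadr_le_of_coefs] and [cubic_le_of_coefs]. *)
Definition kconst : R := 2 * (44 * (5 / small)).
Lemma kconst_ge0 : 0 <= kconst.
Proof. by rewrite !mulr_ge0// invr_ge0 ltW// small_gt0. Qed.

Lemma norm_of_grad (s g X : R) : 0 < s -> X ^+ 2 <= (3 / s) ^+ 2 * g -> g <= 2 / small ^+ 2 ->
  `|X| <= 5 / (s * small).
Proof.
move=> s0 hX hg; have l0 := small_gt0.
apply: norm_le_sqr; first by rewrite divr_ge0// mulr_ge0 ?ltW.
apply: (le_trans hX); apply: (le_trans (ler_wpM2l (sqr_ge0 _) hg)).
move: small l0 => l l0.
rewrite (_ : (3 / s) ^+ 2 * (2 / l ^+ 2) = 18 * (s * l) ^- 2); last by field; rewrite !gt_eqF.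
rewrite expr_div_n ler_wpM2r//; first by rewrite invr_ge0 sqr_ge0.
by lra.
Qed.

Lemma kconst_sqr (s A : R) : 0 < s -> `|A| <= 44 * (5 / (s * small)) ->
  A ^+ 2 <= kconst ^+ 2 / (4 * s ^+ 2).
Proof.
move=> s0 /sqr_le_norm; have l0 := small_gt0; move/le_trans; apply.
rewrite le_eqVlt; apply/orP; left; apply/eqP; rewrite /kconst.
by move: small l0 => l l0; field; rewrite !gt_eqF.
Qed.

Lemma eM2_lower (M : 'M[R]_2) p (s t r w : R) : Hspace 2 p ->
  r ^+ 2 + w ^+ 2 = 1 -> 0 < s -> 0 < t -> M = eigmx (s ^+ 2) (t ^+ 2) r w ->
  (eM 2 M p <= 1)%E ->
  forall x y, s ^+ 2 * quadr (bcoef p 2 0) (bcoef p 1 1) (bcoef p 0 2) x y ^+ 2 <=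
    kconst ^+ 2 * quadr (eig11 (s ^+ 2) (t ^+ 2) r w) (eig12 (s ^+ 2) (t ^+ 2) r w)
      (eig22 (s ^+ 2) (t ^+ 2) r w) x y ^+ 2.
Proof.
move=> hp rw s0 t0 ME hM x y.
have [T [HE hg hq]] := metric_triangle rw s0 t0.
have e1 : eT 2 T p <= 1.
  rewrite -lee_fin; apply: le_trans hM.
  by apply: ereal_sup_ubound; exists T => //=; rewrite HE ME.
set a := bcoef p 2 0; set b := bcoef p 1 1; set c := bcoef p 0 2.
pose A := quadr a b c (tx1 T) (ty1 T).
pose B := polar2 a b c (tx1 T) (ty1 T) (tx2 T) (ty2 T).
pose C := quadr a b c (tx2 T) (ty2 T).
(* An a priori bound depending on the form: it serves only to make the integral finite in [eT_near],
   and does not enter the final constant. *)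
pose L := htr T * (A ^+ 2 + B ^+ 2 + C ^+ 2).
have h0 := htr_ge0 T.
have L0 : 0 <= L by rewrite mulr_ge0// !addr_ge0 ?sqr_ge0.
have LA : htr T * A ^+ 2 <= L by rewrite ler_wpM2l// -addrA lerDl addr_ge0 ?sqr_ge0.
have LB : htr T * B ^+ 2 <= L by rewrite ler_wpM2l// addrAC lerDr addr_ge0 ?sqr_ge0.
have LC : htr T * C ^+ 2 <= L by rewrite ler_wpM2l// lerDr addr_ge0 ?sqr_ge0.
have near : near_bounded (fun s' t' => err2s A B C s' t' + err2t A B C s' t') small (5 / (s * small)).
  move=> s' t' s'0 t'0 st'.
  have bnd u v : 0 <= u -> 0 <= v -> u + v <= 1 ->
      grad_sq (p - interp 2 T (peval p)) (tpt T u v) <= 2 / 3 * (450 * L).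
    move=> u0 v0 uv; apply: grad_le_of_err (interp2_error_grad T u v hp) _.
    exact: (err2_le h0 u0 v0 uv LA LB LC).
  have BB : 0 <= 2 / 3 * (450 * L).
    by apply: mulr_ge0; [exact: divr_ge0|exact: (mulr_ge0 (ler0n _ 450) L0)].
  have [s1 [t1 [hs ht hgr]]] := eT_near small_gt0 small_le1 BB bnd e1 s'0 t'0 st'.
  exists s1, t1; split=> //.
  have [gx [gy [gE <- <-]]] := interp2_error_grad T s1 t1 hp.
  rewrite gE in hgr.
  exact: (norm_of_grad s0 (hg gx gy) hgr).
have [hA hB hC] := err2_recover (ltW small_gt0) small_1000 near.
have [u [v [-> ->]]] := tri_span x y (tdet_neq0 T).
rewrite -hq /hquadr quadr_tri ?tdet_neq0//.
have -> : quadr a b c (tx1 T * u + tx2 T * v) (ty1 T * u + ty2 T * v) = quadr A B C u v.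
  by rewrite /A /B /C /quadr /polar2; ring.
have := quadr_le_of_coefs u v (kconst_sqr s0 hA) (kconst_sqr s0 hB) (kconst_sqr s0 hC).
move=> /(ler_wpM2l (sqr_ge0 s)) /le_trans; apply.
rewrite le_eqVlt; apply/orP; left; apply/eqP.
by move: kconst => k; field; rewrite gt_eqF.
Qed.

Lemma eM3_lower (M : 'M[R]_2) p (s t r w : R) : Hspace 3 p ->
  r ^+ 2 + w ^+ 2 = 1 -> 0 < s -> 0 < t -> M = eigmx (s ^+ 2) (t ^+ 2) r w ->
  (eM 3 M p <= 1)%E ->
  forall x y, s ^+ 2 * cubic (bcoef p 3 0) (bcoef p 2 1) (bcoef p 1 2) (bcoef p 0 3) x y ^+ 2 <=
    kconst ^+ 2 * quadr (eig11 (s ^+ 2) (t ^+ 2) r w) (eig12 (s ^+ 2) (t ^+ 2) r w)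
      (eig22 (s ^+ 2) (t ^+ 2) r w) x y ^+ 3.
Proof.
move=> hp rw s0 t0 ME hM x y.
have [T [HE hg hq]] := metric_triangle rw s0 t0.
have e1 : eT 3 T p <= 1.
  rewrite -lee_fin; apply: le_trans hM.
  by apply: ereal_sup_ubound; exists T => //=; rewrite HE ME.
set a := bcoef p 3 0; set b := bcoef p 2 1; set c := bcoef p 1 2; set d := bcoef p 0 3.
pose A := polar3 a b c d (tx1 T) (ty1 T) (tx1 T) (ty1 T) (tx1 T) (ty1 T).
pose B := polar3 a b c d (tx1 T) (ty1 T) (tx1 T) (ty1 T) (tx2 T) (ty2 T).
pose C := polar3 a b c d (tx1 T) (ty1 T) (tx2 T) (ty2 T) (tx2 T) (ty2 T).
pose D := polar3 a b c d (tx2 T) (ty2 T) (tx2 T) (ty2 T) (tx2 T) (ty2 T).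
pose L := htr T * (A ^+ 2 + B ^+ 2 + C ^+ 2 + D ^+ 2).
have h0 := htr_ge0 T.
have A0 := sqr_ge0 A; have B0 := sqr_ge0 B; have C0 := sqr_ge0 C; have D0 := sqr_ge0 D.
have L0 : 0 <= L by rewrite mulr_ge0// !addr_ge0.
have LA : htr T * A ^+ 2 <= L by rewrite ler_wpM2l//; lra.
have LB : htr T * B ^+ 2 <= L by rewrite ler_wpM2l//; lra.
have LC : htr T * C ^+ 2 <= L by rewrite ler_wpM2l//; lra.
have LD : htr T * D ^+ 2 <= L by rewrite ler_wpM2l//; lra.
have near : near_bounded (fun s' t' => err3s A B C D s' t' + err3t A B C D s' t') small (5 / (s * small)).
  move=> s' t' s'0 t'0 st'.
  have bnd u v : 0 <= u -> 0 <= v -> u + v <= 1 ->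
      grad_sq (p - interp 3 T (peval p)) (tpt T u v) <= 2 / 3 * (450 * L).
    move=> u0 v0 uv; apply: grad_le_of_err (interp3_error_grad T u v hp) _.
    exact: (err3_le h0 u0 v0 uv LA LB LC LD).
  have BB : 0 <= 2 / 3 * (450 * L).
    by apply: mulr_ge0; [exact: divr_ge0|exact: (mulr_ge0 (ler0n _ 450) L0)].
  have [s1 [t1 [hs ht hgr]]] := eT_near small_gt0 small_le1 BB bnd e1 s'0 t'0 st'.
  exists s1, t1; split=> //.
  have [gx [gy [gE <- <-]]] := interp3_error_grad T s1 t1 hp.
  rewrite gE in hgr.
  exact: (norm_of_grad s0 (hg gx gy) hgr).
have [hA hB hC hD] := err3_recover (ltW small_gt0) small_1000 near.
have [u [v [-> ->]]] := tri_span x y (tdet_neq0 T).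
rewrite -hq /hquadr quadr_tri ?tdet_neq0// cubic_polar -/A -/B -/C -/D.
have := cubic_le_of_coefs u v (kconst_sqr s0 hA) (kconst_sqr s0 hB) (kconst_sqr s0 hC) (kconst_sqr s0 hD).
move=> /(ler_wpM2l (sqr_ge0 s)) /le_trans; apply.
rewrite le_eqVlt; apply/orP; left; apply/eqP.
by move: kconst => k; field; rewrite gt_eqF.
Qed.

Lemma HT_eigmx T (mu nu p q : R) : HT T = eigmx mu nu p q -> p ^+ 2 + q ^+ 2 = 1 ->
  htr T = mu + nu /\
  forall x y, hquadr T x y = quadr (eig11 mu nu p q) (eig12 mu nu p q) (eig22 mu nu p q) x y.
Proof.
rewrite HT_sym2 => HE pq.
have e1 := congr1 (fun A : 'M[R]_2 => A 0 0) HE.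
have e2 := congr1 (fun A : 'M[R]_2 => A 0 1) HE.
have e3 := congr1 (fun A : 'M[R]_2 => A 1 1) HE.
rewrite /= !sym2E in e1 e2 e3.
by rewrite /htr /hquadr e1 e2 e3 trace_eig.
Qed.

(** The supremum of the first estimate and the infimum of the second are unfolded into inequalities
    between reals, with one constant for both. *)
Definition near_minimizer (m : nat) p (C : R) :=
  [/\ Mmap m p \in unitmx, S2plus (Mmap m p),
    (forall T, HT T = Mmap m p -> eT m T p <= C) &
    forall M, S2plus M -> (eM m M p <= 1)%E -> \det (Mmap m p) <= C * \det M].

Lemma near_minimizer2 : exists C : R, 0 < C /\
  forall p, Hspace 2 p -> ~ univariate 2 p -> near_minimizer 2 p C.
Proof.
pose C1 : R := Num.sqrt (2 / 3 * (450 * (729 * 2))).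
pose C2 : R := 32 * kconst ^+ 4.
have C10 : 0 <= C1 by exact: sqrtr_ge0.
have C20 : 0 <= C2 by rewrite mulr_ge0// exprn_ge0// kconst_ge0.
have C1le : C1 <= 1 + C1 + C2 by rewrite addrAC lerDr addr_ge0.
have C2le : C2 <= 1 + C1 + C2 by rewrite lerDr addr_ge0.
exists (1 + C1 + C2); split; first by rewrite -addrA ltr_pwDl// addr_ge0.
move=> p hp un.
have nP := pnorm2 hp; have nonuniv := nonunivariate2 hp un.
have [q [r [mu [nu [qr aE bE cE ME]]]]] := Mmap2_eigmx p.
have n0 := quadr_norm_gt0 nP nonuniv qr aE bE cE.
have [mu0 nu0] := quadr_eig_neq0 nonuniv aE bE cE.
have m1 : 0 < pnorm p * `|mu| by rewrite mulr_gt0// normr_gt0.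
have m2 : 0 < pnorm p * `|nu| by rewrite mulr_gt0// normr_gt0.
split.
- by rewrite /Mmap /= ME eigmx_unit.
- by rewrite /Mmap /= ME; exact: eigmx_S2plus.
- move=> T; rewrite /Mmap /= ME => /HT_eigmx/(_ qr)[trE qE].
  apply: (le_trans _ C1le).
  apply: eT2_le => // x y; rewrite trE qE.
  exact: (metric2_upper_frame nP nonuniv qr aE bE cE).
- move=> M PM eM1; have [s [t [u [v [uv t0 ts MsE]]]]] := S2plus_eigmx PM.
  have s0 : 0 < s by exact: lt_le_trans ts.
  have low := eM2_lower hp uv s0 t0 MsE eM1.
  rewrite /Mmap /= ME MsE !det_eigmx//.
  apply: (le_trans (metric2_lower_frame nP nonuniv qr aE bE cE uv t0 ts kconst_ge0 low)).
  by apply: (ler_wpM2r _ C2le); apply: mulr_ge0; exact: sqr_ge0.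
Qed.

Lemma near_minimizer3 : exists C : R, 0 < C /\
  forall p, Hspace 3 p -> ~ univariate 3 p -> near_minimizer 3 p C.
Proof.
pose C1 : R := Num.sqrt (2 / 3 * (450 * (729 * 2560))).
pose C2 : R := 1200 * kconst ^+ 2.
have C10 : 0 <= C1 by exact: sqrtr_ge0.
have C20 : 0 <= C2 := mulr_ge0 (ler0n _ 1200) (sqr_ge0 _).
have C1le : C1 <= 1 + C1 + C2 by rewrite addrAC lerDr addr_ge0.
have C2le : C2 <= 1 + C1 + C2 by rewrite lerDr addr_ge0.
exists (1 + C1 + C2); split; first by rewrite -addrA ltr_pwDl// addr_ge0.
move=> p hp un.
have nP := pnorm3 hp; have nonuniv := nonunivariate3 hp un.
have n0 := cubic_norm_gt0 nP nonuniv.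
pose e := Num.max (- disc p / pnorm p) 0 `^ 3^-1.
have e0 : 0 <= e by exact: powR_ge0.
have eE : pnorm p * e ^+ 3 =
    Num.max (- cdisc (bcoef p 3 0) (bcoef p 2 1) (bcoef p 1 2) (bcoef p 0 3)) 0.
  rewrite -powR_mulrn// -powRrM mulVf// powRr1; last by rewrite le_max lexx orbT.
  by rewrite maxr_pMr ?(ltW n0)// mulr0 mulrCA divff ?mulr1// gt_eqF.
have [q [r [s1 [s2 [[qr s10 s20] [g11 g12 g22 ME]]]]]] := Mmap3_eigmx (erefl e).
have [p1 p2] := gram_eig_gt0 nonuniv qr s10 s20 g11 g12 g22.
have m1 : 0 < s1 + e by rewrite ltr_pwDl.
have m2 : 0 < s2 + e by rewrite ltr_pwDl.
split.
- by rewrite /Mmap /= ME eigmx_unit.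
- by rewrite /Mmap /= ME; exact: eigmx_S2plus.
- move=> T; rewrite /Mmap /= ME => /HT_eigmx/(_ qr)[trE qE].
  apply: (le_trans _ C1le).
  apply: (eT3_le hp (ler0n _ 2560)) => x y; rewrite trE qE.
  have := metric3_upper_frame nP nonuniv qr s10 s20 g11 g12 g22 e0 eE x y.
  by rewrite (_ : s1 + s2 + 2 * e = s1 + e + (s2 + e)); last by ring.
- move=> M PM eM1; have [s [t [u [v [uv t0 ts MsE]]]]] := S2plus_eigmx PM.
  have s0 : 0 < s by exact: lt_le_trans ts.
  have low := eM3_lower hp uv s0 t0 MsE eM1.
  rewrite /Mmap /= ME MsE !det_eigmx//.
  apply: (le_trans (metric3_lower_frame nP nonuniv qr s10 s20 g11 g12 g22 e0 eE uv t0 ts kconst_ge0 low)).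
  by apply: (ler_wpM2r _ C2le); apply: mulr_ge0; exact: sqr_ge0.
Qed.

End Equivalence.

Unset Implicit Arguments.

Theorem mainTheorem1 (R : realType) (m : nat) (hm : m = 2%N \/ m = 3%N) :
  (forall p : mpoly 2 R, Hspace m p -> ~ univariate m p ->
     Mmap m p \in unitmx /\ S2plus (Mmap m p)) /\
  exists C : R, forall p : mpoly 2 R, Hspace m p -> ~ univariate m p ->
    (eM m (Mmap m p) p <= C%:E)%E /\
    ((\det (Mmap m p))%:E <=
       C%:E * ereal_inf [set (\det M)%:E | M in
                [set M : 'M[R]_2 | S2plus M /\ (eM m M p <= 1)%E]])%E.
Proof.
have [C [C0 H]] : exists C : R, 0 < C /\
    forall p, Hspace m p -> ~ univariate m p -> near_minimizer m p C.
  by case: hm => ->; [exact: near_minimizer2|exact: near_minimizer3].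
split=> [p hp un|]; first by have [] := H p hp un.
exists C => p hp un; have [_ _ hU hL] := H p hp un; split.
  by apply: ge_ereal_sup => _ [T /= TM <-]; rewrite lee_fin; exact: hU.
(* With [C > 0] cancelled, the claim is that [\det (Mmap m p) / C] is a lower bound of the set,
   which requires no finiteness of the infimum. *)
rewrite -(divfK (lt0r_neq0 C0) (\det _)) mulrC EFinM lee_pmul2l//.
apply: le_ereal_inf_tmp => _ [M /= [PM eM1] <-].
by rewrite lee_fin ler_pdivrMr// mulrC; exact: hL.
Qed.
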